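(* Let $M$ be a flat semiumbilical surface in $\mathbb R^4$ with first and second fundamental forms $g$ and $\alpha$. Let $c$ be the section of $NM$ such that $c\cdot\alpha=g$, let $e\in\mathfrak X(M)$ be such that $\nabla^\top_Xe=X$ for all $X\in\mathfrak X(M)$, let $j=\frac12\operatorname{grad}(c\cdot c)\in\mathfrak X(M)$, and let $t\in\mathbb R$. Define $f:M\to\mathbb R^4$ by $f(p)=p+tc_p-(1-t)e_p$. Then $df(T_pM)\subset N_pM$ for any $p\in M$. If $f$ is an immersion, then the surface $f(M)$ is flat and semiumbilical, and if $\phi$ denotes a local inverse of $f$, and $\tilde g$, $\tilde\alpha$ are the first and second fundamental forms of $f(M)$, we have: (1) If $X_p\in N_{f(p)}f(M)=T_pM$, $u_p,v_p\in T_{f(p)}f(M)=N_pM$ and $Y_p\in T_pM$, then $$X_p\cdot\tilde\alpha(u_p,v_p)=-v_p\cdot\alpha(X_p,d\phi(u_p)),\qquad X_p\cdot\tilde\alpha(df(Y_p),v_p)=-v_p\cdot\alpha(X_p,Y_p).$$ (2) The section $\tilde c$ of $Nf(M)$ such that $\tilde c\cdot\tilde\alpha=\tilde g$ is $$\tilde c=\bigl((1-t)e-\tfrac t2\operatorname{grad}(c\cdot c)\bigr)\circ\phi=((1-t)e-tj)\circ\phi.$$ (3) If $t\ne1$, there is (locally) a section $k\in\Gamma NM$ such that $(D_X(e-k))^\bot=0$ for all tangent $X$. This section is determined up to the addition of a parallel section of $NM$. A tangent vector field $\tilde e$ on $f(M)$ satisfying $\nabla^\top_u\tilde e=u$ for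 all tangent $u$ is given by $\tilde e=(tc-(1-t)k)\circ\phi$.
   Context: $M$ is a smooth 2-dimensional surface immersed in $\mathbb R^4$; since everything is local it may be regarded as embedded and shrunk when necessary. $T_pM$ and $N_pM=(T_pM)^\bot$ are regarded as vector subspaces of $\mathbb R^4$; $\cdot$ is the standard inner product; $\mathfrak X(M)$ is the space of smooth tangent vector fields, $\Gamma NM$ the space of smooth normal sections; both are regarded as $\mathbb R^4$-valued maps. $D$ is the ordinary directional derivative; $\nabla^\top_XY=(D_XY)^\top$, $\alpha(X,Y)=(D_XY)^\bot$ and $\nabla^\bot_Xu=(D_Xu)^\bot$ for $u\in\Gamma NM$ ($u$ is parallel if $\nabla^\bot u=0$); $\operatorname{grad}$ is the gradient with respect to $g$. A surface is flat if the curvature of $\nabla^\top$ is zero everywhere. The curvature ellipse at $p$ is $\{\alpha_p(t,t)/(t\cdot t): t\in T_pM\setminus\{0\}\}\subset N_pM$. A point $p$ is semiumbilic if its curvature ellipse lies in an affine line (a segment or a point), and a point of inflection if it lies in an affine line through the origin of $N_pM$ (umbilic points, where the ellipse is a single point, count as inflection points). A surface is called semiumbilical if all its points are semiumbilic and none is a point of inflection; i.e. at each point the curvature ellipse is a nondegenerate segment not collinear with the origin. The section $c$ of $NM$ with $c\cdot\alpha=g$, i.e. $c\cdot\alpha(X,Y)=X\cdot Y$ for all tangent $X,Y$, exists and is unique on a semiumbilical surface in $\mathbb R^4$. When $f$ is an immersion, $f(M)$ is regarded as a surface immersed via $f$; a tilde denotes the object on $f(M)$ corresponding to the one on $M$ with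 the same letter. *)

(* Defs.v *)
(* Subspaces of R^4 are row spaces of matrices (scope %MS). *)
From HB Require Import structures.
From mathcomp Require Import all_boot all_order all_algebra.
From mathcomp Require Import all_classical all_reals all_analysis.
Set Implicit Arguments.
Unset Strict Implicit.
Unset Printing Implicit Defensive.
Import Order.TTheory GRing.Theory Num.Theory.
Import numFieldNormedType.Exports.
Local Open Scope classical_set_scope.
Local Open Scope ring_scope.

Definition dot {R : realType} (u v : 'rV[R]_4) : R := (u *m v^T) 0 0.

(* Meant for open W only: derivatives are those of the total function h. *)
Fixpoint Ck {R : realType} {V : normedModType R} (k : nat)
    (W : set 'rV[R]_2) (h : 'rV[R]_2 -> V) : Prop :=
  if k is k'.+1 then
    (forall u, W u -> differentiable h u) /\
    (forall v : 'rV[R]_2, Ck k' W (fun u => 'D_v h u))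
  else forall u, W u -> {for u, continuous h}.

Definition smooth {R : realType} {V : normedModType R}
    (W : set 'rV[R]_2) (h : 'rV[R]_2 -> V) : Prop :=
  forall k, Ck k W h.

(* Smooth 2-manifolds; [par a] is the inverse of the chart [coord a]. *)
Record surface (R : realType) := Surface {
  carrier :> topologicalType;
  carrier_hausdorff : hausdorff_space carrier;
  carrier_second_countable : @second_countable carrier;
  atlas : Type;
  dom : atlas -> set carrier;
  coord : atlas -> carrier -> 'rV[R]_2;
  par : atlas -> 'rV[R]_2 -> carrier;
  dom_open : forall a, open (dom a);
  codom_open : forall a, open (coord a @` dom a);
  coordK : forall a p, dom a p -> par a (coord a p) = p;
  coord_continuous : forall a, {within dom a, continuous (coord a)};
  par_continuous : forall a, {within coord a @` dom a, continuous (par a)};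
  atlas_cover : forall p, exists a, dom a p;
  transition_smooth : forall a b,
    smooth (coord a @` (dom a `&` dom b)) (coord b \o par a) }.

Section Immersed.
Context {R : realType} {M : surface R}.
Implicit Types (x : M -> 'rV[R]_4) (p : M) (W : set M).

Definition smooth_on {V : normedModType R} W (F : M -> V) : Prop :=
  forall a : atlas M, smooth (coord a @` (dom a `&` W)) (F \o par a).

Definition chart_at p : atlas M := projT1 (cid (atlas_cover p)).

Definition jac x p : 'M[R]_(2, 4) :=
  'J (x \o par (chart_at p)) (coord (chart_at p) p).

Definition immersion x : Prop :=
  smooth_on setT x /\ forall p, row_free (jac x p).

(* Below, M is regarded as a surface of R^4 via an immersion x. *)

(* <<_>> is canonical, so this does not depend on the choice of the chart. *)
Definition tangent x p : 'M[R]_4 := <<jac x p>>%MS.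

Definition normal x p : 'M[R]_4 := kermx (tangent x p)^T.

Definition tpart x p (v : 'rV[R]_4) : 'rV[R]_4 :=
  v *m proj_mx (tangent x p) (normal x p).

Definition npart x p (v : 'rV[R]_4) : 'rV[R]_4 :=
  v *m proj_mx (normal x p) (tangent x p).

(* The derivative of F at p along X in T_pM, also denoted dF(X); the vector
   X *m pinvmx (jac x p) of R^2 represents X in the chart. *)
Definition D x {V : normedModType R} (F : M -> V) p (X : 'rV[R]_4) : V :=
  'd (F \o par (chart_at p)) (coord (chart_at p) p) (X *m pinvmx (jac x p)).

Definition vector_field x W (X : M -> 'rV[R]_4) : Prop :=
  smooth_on W X /\ forall p, W p -> (X p <= tangent x p)%MS.

Definition normal_section x W (u : M -> 'rV[R]_4) : Prop :=
  smooth_on W u /\ forall p, W p -> (u p <= normal x p)%MS.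

Definition nablaT x (Y : M -> 'rV[R]_4) p (X : 'rV[R]_4) : 'rV[R]_4 :=
  tpart x p (D x Y p X).

Definition nablaN x (u : M -> 'rV[R]_4) p (X : 'rV[R]_4) : 'rV[R]_4 :=
  npart x p (D x u p X).

Definition parallel x W (u : M -> 'rV[R]_4) : Prop :=
  normal_section x W u /\
  forall p X, W p -> (X <= tangent x p)%MS -> nablaN x u p X = 0.

(* (D_X Y)^\bot at p, for Y in T_pM extended to the tangent vector field
   q |-> (Y)^\top in T_qM. *)
Definition alpha x p (X Y : 'rV[R]_4) : 'rV[R]_4 :=
  npart x p (D x (fun q => tpart x q Y) p X).

Definition bracket x (X Y : M -> 'rV[R]_4) p : 'rV[R]_4 :=
  D x Y p (X p) - D x X p (Y p).

Definition curvature x (X Y Z : M -> 'rV[R]_4) p : 'rV[R]_4 :=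
  nablaT x (fun q => nablaT x Z q (Y q)) p (X p)
  - nablaT x (fun q => nablaT x Z q (X q)) p (Y p)
  - nablaT x Z p (bracket x X Y p).

Definition flat x : Prop :=
  forall X Y Z, vector_field x setT X -> vector_field x setT Y ->
    vector_field x setT Z -> forall p, curvature x X Y Z p = 0.

Definition curvature_ellipse x p : set 'rV[R]_4 :=
  [set (dot v v)^-1 *: alpha x p v v |
    v in [set v : 'rV[R]_4 | (v <= tangent x p)%MS /\ v != 0]].

Definition line (a d : 'rV[R]_4) : set 'rV[R]_4 :=
  [set a + s *: d | s in [set: R]].

Definition semiumbilic x p : Prop :=
  exists a d : 'rV[R]_4,
    [/\ (a <= normal x p)%MS, (d <= normal x p)%MS, d != 0
      & curvature_ellipse x p `<=` line a d].

Definition inflection x p : Prop :=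
  exists d : 'rV[R]_4,
    [/\ (d <= normal x p)%MS, d != 0 & curvature_ellipse x p `<=` line 0 d].

Definition semiumbilical x : Prop :=
  forall p, semiumbilic x p /\ ~ inflection x p.

Definition grad x (h : M -> R) p : 'rV[R]_4 :=
  xget 0 [set v : 'rV[R]_4 | (v <= tangent x p)%MS /\
    forall X : 'rV[R]_4, (X <= tangent x p)%MS ->
      dot v X = D x (h : M -> R^o) p X].

(* Sections c of NM over W such that c . alpha = g. *)
Definition metric_section x W (c : M -> 'rV[R]_4) : Prop :=
  normal_section x W c /\
  forall p (X Y : 'rV[R]_4), W p ->
    (X <= tangent x p)%MS -> (Y <= tangent x p)%MS ->
    dot (c p) (alpha x p X Y) = dot X Y.

(* phi, defined on f(V), is the inverse of the restriction of f to V. *)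
Definition local_inverse (f : M -> 'rV[R]_4) (V : set M)
    (phi : 'rV[R]_4 -> M) : Prop :=
  open V /\ forall p, V p -> phi (f p) = p.

(* dphi(u), in T_pM, for u tangent to f(M) at f(p): the surface f(M) is M
   immersed via f, and a map G defined on f(M) is represented by G \o f. *)
Definition dinverse x (f : M -> 'rV[R]_4) (phi : 'rV[R]_4 -> M) p
    (u : 'rV[R]_4) : 'rV[R]_4 :=
  D f (x \o phi \o f) p u.

End Immersed.

(* Main.v *)
(* At each point of a flat surface whose second fundamental form has a dual
   section [c], the Gauss equation makes the shape operators diagonal in an
   orthonormal basis E1, E2 with alpha(E1,E2) = 0 and with a1 = alpha(E1,E1),
   a2 = alpha(E2,E2) nonzero and orthogonal, so that c = a1/|a1|^2 + a2/|a2|^2.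
   Differentiating c . alpha = g and using the Codazzi equation one finds
   D_X c = - X + alpha(j, X), whereas D_X e = X + alpha(e, X); hence
   df(X) = - alpha((1-t)e - tj, X), which is normal to M. The tangent and normal
   planes of f(M) are therefore those of M exchanged, and
   X . alpha~(df Y, v) = - v . alpha(X, Y) follows by differentiating X . v = 0;
   the normalized a1, a2 are then principal for f(M), which gives flatness and
   semiumbilicity, and the other formulas are read off in the basis E1, E2.
   For (3), the diagonalization makes the normal connection flat, so there is a
   local parallel orthonormal frame m1, m2 of NM, obtained by rotating any frame
   by a potential of the connection form. The 1-forms X |-> D_X e . m_i are closed,
   and potentials k_i of them give k = k_1 m_1 + k_2 m_2. *)
Require Import Defs.
From HB Require Import structures.
From mathcomp Require Import all_boot all_order all_algebra.
From mathcomp Require Import all_classical all_reals all_analysis.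
From mathcomp Require Import ring lra.
Set Implicit Arguments.
Unset Strict Implicit.
Unset Printing Implicit Defensive.
Import Order.TTheory GRing.Theory Num.Theory.
Import numFieldNormedType.Exports.
Local Open Scope classical_set_scope.
Local Open Scope ring_scope.

(** * Smooth maps on the plane *)

(** Derivatives along the surface are taken in a chart that varies with the point, and the tangent
    and normal parts are matrix projections; neither form shows smooth dependence on the point. The
    coordinate fields of a fixed chart repair both: derivatives along them are chart derivatives,
    and the tangential projection is Cramer's rule in them. They also commute, so that Schwarz's
    theorem yields the symmetry of alpha and the Codazzi and Gauss equations. Flatness speaks of
    fields, but it is used for M and proved for f(M) as an identity for alpha at each point. The
    projections of constant vectors link the two forms, since they extend any tangent vector to a
    global field. The term alpha(j, X) of D_X c arises as follows. The form nabla^bot_Y c . alpha(Z,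
    U) is totally symmetric, so alpha(E1,E2) = 0 makes nabla^bot_{Ei} c a multiple of ai; pairing
    with c gives the factor j . Ei. With d = (1-t)e - tj and gi = d . Ei one gets df(Ei) = - gi ai.
    The gi are nonzero because f is an immersion, and the normalized ai then satisfy alpha~(ai, ai)
    = Ei / gi. *)

Section SmoothCalculus.
Context {R : realType}.
Implicit Types (W : set 'rV[R]_2).

(** The difference [g - f] vanishes near [x], so the zero map is its differential there, and [g] is
    [f + (g - f)]. *)
Lemma near_eq_differentiable (U V : normedModType R) (f g : U -> V) (x : U) :
  {near x, f =1 g} -> differentiable f x -> differentiable g x.
Proof.
move=> fg df.
have h0 : (g - f) \o shift x = cst ((g - f) x) + (\0 : {linear U -> V}) +o_ 0 id.
  apply/eqaddoP => _/posnumP[e].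
  have fgx : f x = g x by exact: (nbhs_singleton fg).
  have : \forall y \near 0, f (y + x) = g (y + x).
    by move: fg; rewrite (near_shift 0) subr0.
  apply: filterS => y /= fgy.
  by rewrite !fctE /= fgy fgx !subrr addr0 subr0 normr0 mulr_ge0.
have c0 : continuous (\0 : {linear U -> V}) by move=> y; exact: cvg_cst.
have -> : g = f + (g - f) by rewrite addrC subrK.
apply: differentiableD => //.
by apply/diff_locallyP; rewrite (diff_unique c0 h0).
Qed.

Section GeneralTarget.
Context {V : normedModType R}.
Implicit Types h g : 'rV[R]_2 -> V.

Lemma derive_near_eq W h g v : open W -> (forall u, W u -> h u = g u) ->
  forall u, W u -> 'D_v h u = 'D_v g u.
Proof.
move=> oW hg u Wu; apply: near_eq_derive.
by apply: filterS (open_nbhs_nbhs (conj oW Wu)).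
Qed.

(** Iterated derivatives are those of total functions; on an open [W] they see only the values on
    [W]. Every computation of a derivative below is transported by this lemma. *)
Lemma Ck_eq k W h g : open W -> (forall u, W u -> h u = g u) ->
  Ck k W h -> Ck k W g.
Proof.
move=> oW; elim: k h g => [|k IH] h g hg /=.
  move=> ch u Wu; have := ch u Wu.
  rewrite /prop_for /continuous_at (hg _ Wu); apply: cvg_trans.
  apply: (@near_eq_cvg _ _ (nbhs u)).
  by apply: filterS (open_nbhs_nbhs (conj oW Wu)) => y Wy; rewrite hg.
move=> [dh ch]; split=> [u Wu|v].
  apply: near_eq_differentiable (dh u Wu).
  by apply: filterS (open_nbhs_nbhs (conj oW Wu)).
by apply: IH (ch v) => u Wu; exact: derive_near_eq Wu.
Qed.

Lemma Ck_sub k W W' h : W' `<=` W -> Ck k W h -> Ck k W' h.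
Proof.
move=> WW'; elim: k h => [|k IH] h /=; first by move=> ch u /WW'; exact: ch.
by move=> [dh ch]; split=> [u /WW'/dh//|v]; exact: IH.
Qed.

Lemma CkW k W h : Ck k.+1 W h -> Ck k W h.
Proof.
elim: k h => [|k IH] h /= [dh ch].
  by move=> u Wu; exact/differentiable_continuous/dh.
by split=> // v; exact: IH.
Qed.

Lemma Ck_cst k W (a : V) : Ck k W (cst a).
Proof.
elim: k a => [|k IH] a.
  by move=> u _; exact: cst_continuous.
split=> [u _|v]; first exact: differentiable_cst.
rewrite (_ : (fun u => _) = cst 0); first exact: IH.
by apply/funext => u; rewrite derive_cst.
Qed.

Lemma CkD k W h g : open W -> Ck k W h -> Ck k W g -> Ck k W (h + g).
Proof.
move=> oW; elim: k h g => [|k IH] h g /=.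
  move=> ch cg u Wu; rewrite /prop_for /continuous_at.
  have ch' : h y @[y --> u] --> h u := ch u Wu.
  have cg' : g y @[y --> u] --> g u := cg u Wu.
  exact: (cvgD ch' cg').
move=> [dh ch] [dg cg]; split=> [u Wu|v].
  by apply: differentiableD; [exact: dh|exact: dg].
apply: (Ck_eq oW _ (IH _ _ (ch v) (cg v))) => u Wu.
by rewrite fctE deriveD//; apply: diff_derivable; [exact: dh|exact: dg].
Qed.

End GeneralTarget.

Lemma Ck_lin (V V' : normedModType R) (L : {linear V -> V'}) k W h :
  continuous L -> open W -> Ck k W h -> Ck k W (L \o h).
Proof.
move=> cL oW; elim: k h => [|k IH] h /=.
  by move=> ch u Wu; apply: continuous_comp; [exact: ch|exact: cL].
move=> [dh ch]; have dL y : differentiable L y by exact: linear_differentiable.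
split=> [u Wu|v]; first by apply: differentiable_comp; [exact: dh|].
apply: (Ck_eq oW _ (IH _ (ch v))) => u Wu /=.
rewrite !deriveE; [|by apply: differentiable_comp; [exact: dh|]|exact: dh].
rewrite (diff_comp (dh u Wu) (dL _)) /=.
by have /= -> := @diff_lin _ _ _ L (h u) cL.
Qed.

(** The derivative of B(f, g) is B(f, g') + B(f', g), again of the same form, so the induction
    closes; undifferentiated factors are lowered by [CkW]. Scaling and the inner product are both
    instances. *)
Lemma Ck_bilin (U V V' : normedModType R) (B : {bilinear U -> V -> V'}) k W f g :
  continuous (fun p : U * V => B p.1 p.2) -> open W ->
  Ck k W f -> Ck k W g -> Ck k W (fun u => B (f u) (g u)).
Proof.
move=> cB oW; elim: k f g => [|k IH] f g /=.
  move=> cf cg u Wu; rewrite /prop_for /continuous_at.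
  have cf' : f y @[y --> u] --> f u := cf u Wu.
  have cg' : g y @[y --> u] --> g u := cg u Wu.
  exact: (cvg_comp (fun u => (f u, g u)) (fun p => B p.1 p.2)
    (cvg_pair cf' cg') (cB (f u, g u))).
move=> Cf Cg; have [df cf] := Cf; have [dg cg] := Cg.
have dB p : differentiable (fun p => B p.1 p.2) p by exact: differentiable_bilin.
split=> [u Wu|v].
  apply: (@differentiable_comp _ _ _ _ (fun u => (f u, g u)) (fun p => B p.1 p.2)) => //.
  by apply: differentiable_pair; [exact: df|exact: dg].
have Cf' : Ck k W f by exact: CkW Cf.
have Cg' : Ck k W g by exact: CkW Cg.
apply: (Ck_eq oW _ (CkD oW (IH _ _ Cf' (cg v)) (IH _ _ (cf v) Cg'))) => u Wu.
have dp : differentiable (fun u => (f u, g u)) u.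
  by apply: differentiable_pair; [exact: df|exact: dg].
rewrite fctE [in RHS]deriveE; last exact: (differentiable_comp dp (dB _)).
rewrite (diff_comp dp (dB _)) /= diff_bilin//= diff_pair/=; [|exact: df|exact: dg].
by rewrite !deriveE; [|exact: df|exact: dg].
Qed.

End SmoothCalculus.

(** * Products and compositions of maps of class C^k *)

Section Bilinear.
Context {R : realType}.

Lemma dot_is_bilinear : bilinear_for *:%R *:%R (@dot R).
Proof.
split=> [v|v] a x y; rewrite /dot.
  by rewrite mulmxDl -scalemxAl !mxE.
by rewrite linearD linearZ /= mulmxDr -scalemxAr !mxE.
Qed.
HB.instance Definition _ := bilinear_isBilinear.Build R _ _ R _ _ (@dot R)
  dot_is_bilinear.

Lemma dotE (u v : 'rV[R]_4) : dot u v = \sum_i u 0 i * v 0 i.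
Proof. by rewrite /dot mxE; apply: eq_bigr => i _; rewrite mxE. Qed.

Lemma dotC (u v : 'rV[R]_4) : dot u v = dot v u.
Proof. by rewrite !dotE; apply: eq_bigr => i _; rewrite mulrC. Qed.

Lemma dot_continuous : continuous (fun p : 'rV[R]_4 * 'rV[R]_4 => dot p.1 p.2).
Proof.
move=> p; rewrite /continuous_at dotE; under eq_fun do rewrite dotE.
apply: cvg_big => [|i _]; first exact: add_continuous.
apply: cvgM.
  apply: (@cvg_comp _ _ _ fst (fun v : 'rV[R]_4 => v 0 i)); first exact: cvg_fst.
  exact: coord_continuous.
apply: (@cvg_comp _ _ _ snd (fun v : 'rV[R]_4 => v 0 i)); first exact: cvg_snd.
exact: coord_continuous.
Qed.

Lemma scale_is_bilinear (V : lmodType R) :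
  bilinear_for *:%R *:%R (@GRing.scale R V : R^o -> V -> V).
Proof.
split=> [v|v] a x y /=; first by rewrite scalerDl -scalerA.
by rewrite scalerDr !scalerA mulrC.
Qed.
HB.instance Definition _ (V : lmodType R) := bilinear_isBilinear.Build R R^o V V _ _
  (@GRing.scale R V : R^o -> V -> V) (@scale_is_bilinear V).

End Bilinear.

Section CkOperations.
Context {R : realType}.
Implicit Types (W : set 'rV[R]_2).

Lemma CkZ (V : normedModType R) k W (f : 'rV[R]_2 -> R^o) (g : 'rV[R]_2 -> V) :
  open W -> Ck k W f -> Ck k W g -> Ck k W (fun u => f u *: g u).
Proof.
apply: (Ck_bilin (B := (@GRing.scale R V : R^o -> V -> V))).
exact: scale_continuous.
Qed.

Lemma Ck_dot k W (f g : 'rV[R]_2 -> 'rV[R]_4) :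
  open W -> Ck k W f -> Ck k W g -> Ck k W (fun u => dot (f u) (g u) : R^o).
Proof. by apply: Ck_bilin; exact: dot_continuous. Qed.

Lemma derive_dot (f g : 'rV[R]_2 -> 'rV[R]_4) u v :
  differentiable f u -> differentiable g u ->
  'D_v (fun y => dot (f y) (g y) : R^o) u =
  dot (f u) ('D_v g u) + dot ('D_v f u) (g u).
Proof.
move=> df dg; have dp := differentiable_pair df dg.
have dB p := differentiable_bilin (f := @dot R) p dot_continuous.
rewrite deriveE; last exact: (differentiable_comp dp (dB _)).
rewrite (diff_comp dp (dB _)) /= (diff_bilin _ dot_continuous) /= diff_pair//=.
by rewrite !deriveE.
Qed.

Lemma derive_scale (V : normedModType R) (f : 'rV[R]_2 -> R^o)
    (g : 'rV[R]_2 -> V) u v :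
  differentiable f u -> differentiable g u ->
  'D_v (fun y => f y *: g y) u = f u *: 'D_v g u + 'D_v f u *: g u.
Proof.
move=> df dg; have dp := differentiable_pair df dg.
pose B : {bilinear R^o -> V -> V} := (@GRing.scale R V : R^o -> V -> V).
have cB : continuous (fun p : R^o * V => B p.1 p.2) by exact: scale_continuous.
have dB p := differentiable_bilin p cB.
rewrite deriveE; last exact: (differentiable_comp dp (dB _)).
rewrite (diff_comp dp (dB _)) /= (diff_bilin _ cB) /= diff_pair//=.
by rewrite !deriveE.
Qed.

Lemma derive_comp (V : normedModType R) (h : 'rV[R]_2 -> V)
    (g : 'rV[R]_2 -> 'rV[R]_2) u v :
  differentiable g u -> differentiable h (g u) ->
  'D_v (h \o g) u = 'D_('D_v g u) h (g u).
Proof.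
move=> dg dh; rewrite [LHS]deriveE; last exact: differentiable_comp.
by rewrite (diff_comp dg dh) /= -(deriveE _ dg) -(deriveE _ dh).
Qed.

Lemma Ck_coord k W (g : 'rV[R]_2 -> 'rV[R]_2) i :
  open W -> Ck k W g -> Ck k W (fun u => g u 0 i : R^o).
Proof.
have lin : linear (fun M : 'rV[R]_2 => M 0 i : R^o).
  by move=> a x y; rewrite !mxE.
pose L : {linear 'rV[R]_2 -> R^o} := HB.pack (fun M : 'rV[R]_2 => M 0 i : R^o)
  (GRing.isLinear.Build _ _ _ _ _ lin).
by apply: (Ck_lin (L := L)); exact: coord_continuous.
Qed.

Lemma derive_rV2 (V : normedModType R) (h : 'rV[R]_2 -> V) u v :
  differentiable h u ->
  'D_v h u = v 0 0 *: 'D_('e_0) h u + v 0 1 *: 'D_('e_1) h u.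
Proof.
move=> dh; rewrite !deriveE// {1}[v]row_sum_delta !big_ord_recl big_ord0 addr0.
rewrite linearD !linearZ.
by have -> : lift ord0 ord0 = 1 :> 'I_2 by exact/val_inj.
Qed.

(** Written in the canonical basis, the chain rule makes each derivative of [h \o g] a sum of
    products of a coordinate of g' with a partial derivative of [h] composed with the same [g],
    which the induction covers. *)
Lemma Ck_comp (V : normedModType R) k W W' (h : 'rV[R]_2 -> V)
    (g : 'rV[R]_2 -> 'rV[R]_2) :
  open W -> (forall u, W u -> W' (g u)) ->
  Ck k W' h -> Ck k W g -> Ck k W (h \o g).
Proof.
move=> oW gW; elim: k h g gW => [|k IH] h g gW.
  move=> ch cg u Wu; apply: continuous_comp; first exact: cg.
  exact: (ch _ (gW _ Wu)).
move=> [dh ch] Cg; have [dg cg] := Cg; split=> [u Wu|v].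
  by apply: differentiable_comp; [exact: dg|exact/dh/gW].
have Ci i : Ck k W (fun u => 'D_v g u 0 i *: ('D_('e_i) h \o g) u).
  apply: CkZ => //; first exact: (Ck_coord i oW (cg v)).
  exact: (IH _ _ gW (ch _) (CkW Cg)).
apply: (Ck_eq oW _ (CkD oW (Ci 0) (Ci 1))) => u Wu.
rewrite derive_comp; [|exact: dg|exact/dh/gW].
by rewrite [RHS]derive_rV2//; exact/dh/gW.
Qed.

Lemma derive_comp_fun (p : R -> R) (h : 'rV[R]_2 -> R^o) u v dp :
  is_derive (h u) (1 : R) p dp -> differentiable h u ->
  differentiable (fun u => p (h u) : R^o) u /\
  'D_v (fun u => p (h u) : R^o) u = dp * 'D_v h u :> R.
Proof.
move=> [dp1 dpE] dh.
have dp' : differentiable (p : R -> R^o) (h u) by exact/derivable1_diffP.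
have dph : differentiable (fun u => p (h u) : R^o) u.
  exact: (@differentiable_comp _ _ _ _ h p).
split=> //; rewrite deriveE// (diff_comp dh dp') /= diff1E//.
by rewrite derive1E dpE (deriveE _ dh) -[LHS]mulrC.
Qed.

(** The induction needs all derivatives of the outer function at once, hence a family [Phi] of real
    functions closed under derivation on [A]. *)
Lemma Ck_comp_fun (Phi : set (R -> R)) (A : set R) k W (h : 'rV[R]_2 -> R^o) :
  (forall p, Phi p -> exists2 q, Phi q &
    forall y, A y -> is_derive y (1 : R) p (q y)) ->
  open W -> (forall u, W u -> A (h u)) -> Ck k W h ->
  forall p, Phi p -> Ck k W (fun u => p (h u) : R^o).
Proof.
move=> HPhi oW hA; elim: k => [|k IH].
  move=> ch p /HPhi [q _ pq] u Wu; apply: (@continuous_comp _ _ _ h p).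
    exact: ch.
  have [dp _] := pq _ (hA _ Wu).
  exact/differentiable_continuous/derivable1_diffP.
move=> Ch p Pp; have [q Pq pq] := HPhi p Pp; have [dh ch] := Ch.
have dph u v : W u -> differentiable (fun u => p (h u) : R^o) u /\
    'D_v (fun u => p (h u) : R^o) u = q (h u) * 'D_v h u :> R.
  by move=> Wu; apply: derive_comp_fun; [exact/pq/hA|exact: dh].
split=> [u Wu|v]; first by have [] := dph u 0 Wu.
apply: (Ck_eq oW _ (CkZ oW (IH (CkW Ch) q Pq) (ch v))) => u Wu.
by have [_ ->] := dph u v Wu.
Qed.

End CkOperations.

(** * Smooth maps, real powers, sine and cosine *)

Section Smooth.
Context {R : realType}.
Implicit Types (W : set 'rV[R]_2).

Section GeneralTarget.
Context {V : normedModType R}.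
Implicit Types h g : 'rV[R]_2 -> V.

Lemma smooth_eq W h g : open W -> (forall u, W u -> h u = g u) ->
  smooth W h -> smooth W g.
Proof. by move=> oW hg sh k; apply: Ck_eq hg (sh k). Qed.

Lemma smooth_sub W W' h : W' `<=` W -> smooth W h -> smooth W' h.
Proof. by move=> WW' sh k; apply: Ck_sub (sh k). Qed.

Lemma smooth_differentiable W h u : smooth W h -> W u -> differentiable h u.
Proof. by move=> /(_ 1%N)[dh _]; exact: dh. Qed.

Lemma smooth_continuous W h u : smooth W h -> W u -> {for u, continuous h}.
Proof. by move=> /(_ 0%N); exact. Qed.

Lemma smooth_derive W h v : smooth W h -> smooth W ('D_v h).
Proof. by move=> sh k; have [_] := sh k.+1; exact. Qed.

Lemma smooth_cst W (a : V) : smooth W (cst a).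
Proof. by move=> k; exact: Ck_cst. Qed.

Lemma smoothD W h g : open W -> smooth W h -> smooth W g -> smooth W (h + g).
Proof. by move=> oW sh sg k; exact: CkD. Qed.

Lemma smoothZ W (f : 'rV[R]_2 -> R^o) g :
  open W -> smooth W f -> smooth W g -> smooth W (fun u => f u *: g u).
Proof. by move=> oW sh sg k; exact: CkZ. Qed.

Lemma smoothN W h : open W -> smooth W h -> smooth W (- h).
Proof.
move=> oW sh.
apply: (@smooth_eq _ (fun u => (-1 : R^o) *: h u)) => // [u _|].
  by rewrite scaleN1r.
apply: smoothZ => // k.
exact: (@Ck_cst R R^o k W (-1)).
Qed.

Lemma smoothB W h g : open W -> smooth W h -> smooth W g -> smooth W (h - g).
Proof. by move=> oW sh sg; apply: smoothD => //; exact: smoothN. Qed.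

Lemma smooth_comp W W' h (g : 'rV[R]_2 -> 'rV[R]_2) :
  open W -> (forall u, W u -> W' (g u)) ->
  smooth W' h -> smooth W g -> smooth W (h \o g).
Proof. by move=> oW gW sh sg k; exact: Ck_comp gW (sh k) (sg k). Qed.

End GeneralTarget.

Lemma smoothM W (f g : 'rV[R]_2 -> R^o) :
  open W -> smooth W f -> smooth W g -> smooth W (fun u => f u * g u : R^o).
Proof. exact: smoothZ. Qed.

Lemma smooth_dot W (f g : 'rV[R]_2 -> 'rV[R]_4) : open W ->
  smooth W f -> smooth W g -> smooth W (fun u => dot (f u) (g u) : R^o).
Proof. by move=> oW sh sg k; exact: Ck_dot. Qed.

(** The functions c y^b are closed under derivation where y > 0. The exponent -1 serves for inverses
    of Gram determinants and -1/2 for normalizing sections. *)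
Lemma smooth_powR W (h : 'rV[R]_2 -> R^o) a : open W ->
  (forall u, W u -> 0 < h u) -> smooth W h -> smooth W (fun u => h u `^ a : R^o).
Proof.
move=> oW h0 sh k.
pose Phi := [set p : R -> R | exists c b, p = fun y => c * y `^ b].
have := @Ck_comp_fun R Phi [set y | 0 < y] k W h _ oW h0 (sh k) (fun y => 1 * y `^ a).
have -> : (fun u => 1 * h u `^ a : R^o) = (fun u => h u `^ a : R^o).
  by apply/funext => u; rewrite mul1r.
apply; last by exists 1, a.
move=> _ [c [b ->]]; exists (fun y => (c * b) * y `^ (b - 1)); first by exists (c * b), (b - 1).
move=> y y0; rewrite -mulrA.
have d := is_derive1_powR b y0.
exact: (is_deriveZ c d).
Qed.

Lemma smooth_sin_cos W (h : 'rV[R]_2 -> R^o) : open W -> smooth W h ->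
  smooth W (fun u => sin (h u) : R^o) /\ smooth W (fun u => cos (h u) : R^o).
Proof.
move=> oW sh.
pose Phi := [set p : R -> R | exists a b, p = fun y => a * sin y + b * cos y].
have H k a b : Ck k W (fun u => a * sin (h u) + b * cos (h u) : R^o).
  apply: (@Ck_comp_fun R Phi setT k W h _ oW _ (sh k) (fun y => a * sin y + b * cos y)) => //.
    move=> _ [c [d ->]]; exists (fun y => - d * sin y + c * cos y); first by exists (- d), c.
    move=> y _; have := is_deriveD (is_deriveZ c (is_derive_sin y)) (is_deriveZ d (is_derive_cos
      y)).
    suff -> : - d * sin y + c * cos y = c *: cos y + d *: - sin y :> R by [].
    by rewrite addrC mulNr -mulrN.
  by exists a, b.
split=> k.
  have := H k 1 0; congr (Ck _ _ _); apply/funext => u.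
  by rewrite mul1r mul0r addr0.
have := H k 0 1; congr (Ck _ _ _); apply/funext => u.
by rewrite mul1r mul0r add0r.
Qed.

End Smooth.

(** * Symmetry of second derivatives *)

Section SecondDerivatives.
Context {R : realType}.
Implicit Types (W : set 'rV[R]_2) (u v w : 'rV[R]_2).

Lemma is_derive_along (V : normedModType R) (h : 'rV[R]_2 -> V) a v (s : R) (dh : V) :
  is_derive (a + s *: v) v h dh ->
  is_derive s (1 : R) (fun r : R => h (a + r *: v)) dh.
Proof.
move=> [dhv vh].
have E : (fun k : R => k^-1 *: (((fun r : R => h (a + r *: v)) \o shift s) (k *: (1 : R))
      - h (a + s *: v))) =
    (fun k => k^-1 *: ((h \o shift (a + s *: v)) (k *: v) - h (a + s *: v))).
  apply/funext => k /=; congr (_ *: (h _ - _)).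
  by rewrite -[k *: 1]/(k * 1) mulr1 scalerDl addrCA.
by apply: DeriveDef; [rewrite /derivable E|rewrite /derive E].
Qed.

Lemma is_derive_line (V : normedModType R) (h : 'rV[R]_2 -> V) a v (s : R) :
  differentiable h (a + s *: v) ->
  is_derive s (1 : R) (fun r : R => h (a + r *: v)) ('D_v h (a + s *: v)).
Proof. by move=> dh; apply/is_derive_along/derivableP/diff_derivable. Qed.

Lemma MVT_pos (f df : R -> R) (a b : R) : a < b ->
  (forall x, a <= x <= b -> is_derive x (1 : R) f (df x)) ->
  exists2 x, a < x < b & f b - f a = df x * (b - a).
Proof.
move=> ab dfP.
have H1 x : x \in `]a, b[ -> is_derive x 1 f (df x).
  by rewrite in_itv /= => /andP[/ltW ax /ltW xb]; apply: dfP; rewrite ax.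
have H2 : {within `[a, b], continuous f}.
  apply: derivable_within_continuous => x; rewrite in_itv /= => xab.
  by have [] := dfP x xab.
have [x xab E] := MVT ab H1 H2.
by exists x => //; move: xab; rewrite in_itv.
Qed.

Lemma near_plane (P : set 'rV[R]_2) u v w : nbhs u P ->
  exists2 d : R, 0 < d & forall s r, `|s| <= d -> `|r| <= d -> P (u + s *: v + r *: w).
Proof.
move=> /nbhs_ballP[e /= e0 eP].
have k0 : 0 < `|v| + `|w| + 1 by rewrite ltr_wpDl.
(* The summand 1 keeps the denominator positive when both vectors vanish; the half leaves room for a
   strict inequality. *)
exists (e / 2 / (`|v| + `|w| + 1)); first by rewrite !divr_gt0.
move=> s r hs hr; apply: eP; rewrite -ball_normE /=.
rewrite -addrA opprD addNKr normrN.
apply: (@le_lt_trans _ _ (e / 2)); last by rewrite ltr_pdivrMr// ltr_pMr// ltr1n.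
apply: (le_trans (ler_normD _ _)); rewrite !normrZ.
apply: (@le_trans _ _ (e / 2 / (`|v| + `|w| + 1) * (`|v| + `|w|))).
  by rewrite mulrDr lerD// ler_wpM2r.
by rewrite -mulrA ler_piMr ?divr_ge0 ?ltW// ltr_pdivrMl// mulr1 ltrDl.
Qed.

(** The mean value theorem is applied twice: along [v] to h(u + s w + r v) - h(u + r v) as a
    function of r, then along [w] to the derivative so obtained. The quotient becomes a value of the
    mixed derivative at a point close to [u], and continuity concludes. *)
Lemma second_difference W (h : 'rV[R]_2 -> R^o) u v w : open W -> smooth W h ->
  W u -> forall e : R, 0 < e -> exists2 d : R, 0 < d &
    forall s : R, 0 < s <= d ->
    `|((h (u + s *: v + s *: w) : R) - (h (u + s *: v) : R) -
       (h (u + s *: w) : R) + (h u : R)) / s ^+ 2 - ('D_w ('D_v h) u : R)| <= e.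
Proof.
move=> oW sh Wu e e0.
have sv := smooth_derive v sh; have svw := smooth_derive w sv.
have cont := smooth_continuous svw Wu.
have /(near_plane v w)[d d0 dP] : nbhs u (fun y => W y /\
    `|'D_w ('D_v h) u - 'D_w ('D_v h) y| <= e).
  apply: filterI; first exact: open_nbhs_nbhs.
  by move/cvgrPdist_le : cont => /(_ _ e0).
exists d => // s /andP[s0 sd].
have small r : 0 <= r <= s -> `|r| <= d.
  by move=> /andP[r0 rs]; rewrite ger0_norm// (le_trans rs).
have ss : 0 <= s <= s by rewrite ltW//=.
have dphi r : 0 <= r <= s -> is_derive r (1 : R)
    (fun r => h (u + s *: w + r *: v) - h (u + r *: v))
    ('D_v h (u + s *: w + r *: v) - 'D_v h (u + r *: v)).
  move=> rs; apply: is_deriveB; apply: is_derive_line.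
    apply: (smooth_differentiable sh); rewrite addrAC.
    by have [] := dP r s (small _ rs) (small _ ss).
  apply: (smooth_differentiable sh).
  by have [] := dP r 0 (small _ rs); rewrite ?normr0 ?(ltW d0)// scale0r addr0.
have [xi xis E1] := MVT_pos s0 dphi.
have xi' : 0 <= xi <= s by have /andP[/ltW -> /ltW ->] := xis.
have dpsi r : 0 <= r <= s -> is_derive r (1 : R)
    (fun r => 'D_v h (u + xi *: v + r *: w)) ('D_w ('D_v h) (u + xi *: v + r *: w)).
  move=> rs; apply: is_derive_line; apply: (smooth_differentiable sv).
  by have [] := dP xi r (small _ xi') (small _ rs).
have [eta etas E2] := MVT_pos s0 dpsi.
have eta' : 0 <= eta <= s by have /andP[/ltW -> /ltW ->] := etas.
have distC (a b : R) : `|a - b| <= e -> `|b - a| <= e by rewrite distrC.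
have [_ /distC] := dP xi eta (small _ xi') (small _ eta').
suff -> : ((h (u + s *: v + s *: w) : R) - (h (u + s *: v) : R) -
    (h (u + s *: w) : R) + (h u : R)) / s ^+ 2
  = ('D_w ('D_v h) (u + xi *: v + eta *: w) : R) by [].
move: E1 E2; rewrite !subr0 !scale0r !addr0 => E1 E2.
have -> : (h (u + s *: v + s *: w) : R) - (h (u + s *: v) : R) -
    (h (u + s *: w) : R) + (h u : R) =
   ('D_w ('D_v h) (u + xi *: v + eta *: w) : R) * s * s.
  have alg (p q r k A B C : R) : p - q - (r - k) = (A - B) * s -> A - B = C * s ->
      p - q - r + k = C * s * s by move=> pA AB; rewrite -AB -pA; ring.
  rewrite (addrAC u (s *: w) (s *: v)) (addrAC u (s *: w) (xi *: v)) in E1.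
  exact: (alg _ _ _ _ _ _ _ E1 E2).
have alg (a : R) : a * s * s / s ^+ 2 = a by field; rewrite gt_eqF.
exact: alg.
Qed.

(** The second difference is symmetric in [v] and [w], so one quotient is within [e / 2] of both
    mixed derivatives. *)
Lemma schwarz_real W (h : 'rV[R]_2 -> R^o) u v w : open W -> smooth W h ->
  W u -> 'D_w ('D_v h) u = 'D_v ('D_w h) u.
Proof.
move=> oW sh Wu; suff : ('D_w ('D_v h) u : R) = ('D_v ('D_w h) u : R) by [].
apply/eqP; rewrite -subr_eq0 -normr_le0; apply/ler_addgt0Pr => e e0.
have e2 : 0 < e / 2 by rewrite divr_gt0.
have [d d0 dP] := second_difference v w oW sh Wu e2.
have [d' d'0 dP'] := second_difference w v oW sh Wu e2.
pose s := Num.min d d'.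
have s0 : 0 < s by rewrite lt_min d0.
have := dP s; rewrite s0 ge_min lexx => /(_ isT) H1.
have := dP' s; rewrite s0 ge_min lexx orbT => /(_ isT) H2.
rewrite add0r; move: H1; set a := _ / _ => H1.
have E : ((h (u + s *: w + s *: v) : R) - (h (u + s *: w) : R) -
    (h (u + s *: v) : R) + (h u : R)) / s ^+ 2 = a.
  by rewrite /a (addrAC u); congr ((_ + _) / _); exact: addrAC.
move: H2; rewrite E => H2.
have tri (b p q : R) : `|b - p| <= e / 2 -> `|b - q| <= e / 2 -> `|p - q| <= e.
  move=> bp bq; have -> : p - q = (b - q) - (b - p) by ring.
  by rewrite [e]splitr; apply: (le_trans (ler_normB _ _)); rewrite lerD.
clear E; clearbody a; exact: (tri a ('D_w ('D_v h) u) ('D_v ('D_w h) u) H1 H2).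
Qed.

Lemma dot_delta (a : 'rV[R]_4) i : dot a 'e_i = a 0 i.
Proof. by rewrite /dot trmx_delta -colE mxE. Qed.

Lemma dot_inj (a b : 'rV[R]_4) : (forall c, dot a c = dot b c) -> a = b.
Proof. by move=> ab; apply/rowP => i; rewrite -!dot_delta ab. Qed.

Lemma derive_dotl (f : 'rV[R]_2 -> 'rV[R]_4) u v (a : 'rV[R]_4) :
  differentiable f u -> 'D_v (fun y => dot (f y) a : R^o) u = dot ('D_v f u) a.
Proof.
move=> df; rewrite (derive_dot _ df); last exact: differentiable_cst.
by rewrite derive_cst linear0r add0r.
Qed.

(** Pairing with constant vectors reduces the vector case to the real one. *)
Lemma schwarz W (h : 'rV[R]_2 -> 'rV[R]_4) u v w : open W -> smooth W h ->
  W u -> 'D_w ('D_v h) u = 'D_v ('D_w h) u.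
Proof.
move=> oW sh Wu; apply: dot_inj => a.
have sd : smooth W (fun y => dot (h y) a : R^o).
  by apply: smooth_dot => //; exact: smooth_cst.
have E v' w' : 'D_w' ('D_v' (fun y => dot (h y) a : R^o)) u = dot ('D_w' ('D_v' h) u) a.
  rewrite -derive_dotl; last exact: (smooth_differentiable (smooth_derive _ sh)).
  apply: derive_near_eq oW _ _ Wu => y Wy.
  by rewrite derive_dotl//; exact: (smooth_differentiable sh).
by have := schwarz_real v w oW sd Wu; rewrite !E.
Qed.

End SecondDerivatives.

(** * Functions whose directional derivatives are prescribed *)

Section Potential.
Context {R : realType}.
Implicit Types (W : set 'rV[R]_2) (u v w : 'rV[R]_2).

Lemma norm_coord u i : `|u 0 i| <= `|u|.
Proof.
rewrite /Num.norm /= mx_normrE.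
exact: (le_bigmax (0 : R) (fun ij : 'I_1 * 'I_2 => `|u ij.1 ij.2|) (0, i)).
Qed.

Lemma differentiable_bound (V V' : normedModType R) (F : V -> V') (u : V)
    (L : {linear V -> V'}) : continuous L ->
  (forall e : R, 0 < e -> \forall v \near 0, `|F (v + u) - F u - L v| <= e * `|v|) ->
  differentiable F u.
Proof.
move=> cL FL; have LO : F \o shift u = cst (F u) + L +o_ 0 id.
  apply/eqaddoP => e /FL; apply: filterS => v.
  by rewrite !fctE /= opprD addrA.
by apply/diff_locallyP; rewrite (diff_unique cL LO).
Qed.

(** The mean value theorem on the segment from [u] to [u + v] replaces the increment of [F] by the
    linear form at an intermediate point; continuity of [P] and [Q] bounds the error by [e] times
    the norm of [v]. *)
Lemma differentiable_partials W (F P Q : 'rV[R]_2 -> R^o) : open W ->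
  (forall u, W u -> {for u, continuous P}) ->
  (forall u, W u -> {for u, continuous Q}) ->
  (forall u v, W u -> is_derive u v F (v 0 0 * P u + v 0 1 * Q u)) ->
  forall u, W u -> differentiable F u.
Proof.
move=> oW cP cQ dF u Wu.
have lin : linear (fun v => v 0 0 * P u + v 0 1 * Q u : R^o).
  move=> a x y; rewrite !mxE -[a *: _]/(a * _); ring.
pose L : {linear 'rV[R]_2 -> R^o} := HB.pack (fun v => v 0 0 * P u + v 0 1 * Q u : R^o)
  (GRing.isLinear.Build _ _ _ _ _ lin).
have cL' : continuous (fun z : 'rV[R]_2 => z 0 0 * (P u : R) + z 0 1 * (Q u : R)).
  move=> y; have dc i : differentiable (fun z : 'rV[R]_2 => z 0 i : R) y.
    exact: differentiable_coord.
  have dM i (a : R) := differentiableM (dc i) (differentiable_cst a y).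
  exact: differentiable_continuous (differentiableD (dM 0 (P u)) (dM 1 (Q u))).
have cL : continuous L by exact: cL'.
apply: (differentiable_bound cL) => e e0.
have e2 : 0 < e / 2 by rewrite divr_gt0.
have : nbhs u (fun y => [/\ W y, `|P u - P y| <= e / 2 & `|Q u - Q y| <= e / 2]).
  have N1 : nbhs u W by exact: open_nbhs_nbhs.
  have /cvgrPdist_le /(_ _ e2) N2 := cP u Wu.
  have /cvgrPdist_le /(_ _ e2) N3 := cQ u Wu.
  by near do split => //.
move=> /nbhs_ballP[d /= d0 dP].
suff H (v : 'rV[R]_2) : `|v| < d -> `|F (v + u) - F u - L v| <= e * `|v|.
  by apply/nbhs_ballP; exists d => // v; rewrite -ball_normE /= sub0r normrN; exact: H.
move=> vd.
have inB r : 0 <= r <= 1 -> ball u d (u + r *: v).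
  move=> /andP[r0 r1]; rewrite -ball_normE /= opprD addNKr normrN normrZ.
  by rewrite ger0_norm//; apply: le_lt_trans vd; rewrite ler_piMl.
have dFr (r : R) : 0 <= r <= 1 -> is_derive r (1 : R) (fun r : R => F (u + r *: v))
    (v 0 0 * P (u + r *: v) + v 0 1 * Q (u + r *: v)).
  by move=> r01; apply/is_derive_along/dF; have [] := dP _ (inB r r01).
have [x /andP[x0 x1]] := MVT_pos ltr01 dFr.
rewrite scale1r scale0r addr0 subr0 mulr1 => E.
have [_ HP HQ] : [/\ W (u + x *: v), `|P u - P (u + x *: v)| <= e / 2 &
   `|Q u - Q (u + x *: v)| <= e / 2].
  by apply: dP; apply: inB; rewrite !ltW.
rewrite (addrC v) /L /= E.
have -> : v 0 0 * P (u + x *: v) + v 0 1 * Q (u + x *: v)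
    - (v 0 0 * P u + v 0 1 * Q u) =
    - (v 0 0 * (P u - P (u + x *: v)) + v 0 1 * (Q u - Q (u + x *: v))) by ring.
rewrite normrN; apply: (le_trans (ler_normD _ _)).
rewrite !normrM [e in leRHS]splitr mulrDl.
by apply: lerD; rewrite mulrC ler_pM// norm_coord.
Unshelve. all: by end_near.
Qed.

(** Only the first order concerns [F] itself; its derivatives are combinations of [P] and [Q], which
    supply all the others. *)
Lemma smooth_primitive W (F P Q : 'rV[R]_2 -> R^o) : open W ->
  smooth W P -> smooth W Q ->
  (forall u v, W u -> is_derive u v F (v 0 0 * P u + v 0 1 * Q u)) -> smooth W F.
Proof.
move=> oW sP sQ dF.
have df u : W u -> differentiable F u.
  have cP y : W y -> {for y, continuous P} by exact: smooth_continuous.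
  have cQ y : W y -> {for y, continuous Q} by exact: smooth_continuous.
  exact: (differentiable_partials oW cP cQ dF).
case=> [u Wu|k]; first exact/differentiable_continuous/df.
split=> [|v]; first exact: df.
have sc (a : R^o) : smooth W (cst a) by exact: smooth_cst.
apply: (Ck_eq oW _ (smoothD oW (smoothM oW (sc (v 0 0)) sP) (smoothM oW (sc (v 0 1)) sQ) k)).
by move=> u Wu; have [_ ->] := dF u v Wu.
Qed.

End Potential.

(** * The Poincare lemma *)

Section Poincare.
Context {R : realType}.
Implicit Types (W : set 'rV[R]_2) (u v w y : 'rV[R]_2).

Local Notation mu := (@lebesgue_measure R).

(** The 1-form P dx + Q dy at the point [u], applied to the vector [w]. *)
Definition form (P Q : 'rV[R]_2 -> R^o) w u : R := w 0 0 * (P u : R) + w 0 1 * (Q u : R).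

Lemma smooth_form W (P Q : 'rV[R]_2 -> R^o) w :
  open W -> smooth W P -> smooth W Q -> smooth W (form P Q w : _ -> R^o).
Proof.
move=> oW sP sQ; have sc (a : R^o) : smooth W (cst a) by exact: smooth_cst.
exact: (smoothD oW (smoothM oW (sc (w 0 0)) sP) (smoothM oW (sc (w 0 1)) sQ)).
Qed.

Lemma derive_form (P Q : 'rV[R]_2 -> R^o) u v w :
  differentiable P u -> differentiable Q u ->
  'D_v (form P Q w : _ -> R^o) u =
  v 0 0 * (w 0 0 * 'D_('e_0) P u + w 0 1 * 'D_('e_0) Q u) +
  v 0 1 * (w 0 0 * 'D_('e_1) P u + w 0 1 * 'D_('e_1) Q u) :> R.
Proof.
move=> dP dQ.
have dc (a : R) (F : 'rV[R]_2 -> R^o) : differentiable F u ->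
    differentiable (fun y => a *: F y) u by move=> dF; exact: differentiableZ.
have E : (form P Q w : _ -> R^o) = (fun y => w 0 0 *: P y) + (fun y => w 0 1 *: Q y).
  by [].
rewrite E deriveD; [|by apply: diff_derivable; exact: dc..].
rewrite (deriveZ (w 0 0) (diff_derivable dP)) (deriveZ (w 0 1) (diff_derivable dQ)).
rewrite (derive_rV2 v dP) (derive_rV2 v dQ).
have alg (a b c d p q r s : R) : a * (c * p + d * q) + b * (c * r + d * s) =
  c * (a * p + b * r) + d * (a * q + b * s) by ring.
exact: alg.
Qed.

Lemma is_derive_scaled_line (G : 'rV[R]_2 -> R^o) a v (s h : R) :
  differentiable G (a + h *: (s *: v)) ->
  is_derive h (1 : R) (fun h : R => G (a + h *: (s *: v)) : R)
    (s * ('D_v G (a + h *: (s *: v)) : R)).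
Proof.
move=> dG; have := is_derive_line dG.
by rewrite (deriveE _ dG) linearZ /= -(deriveE _ dG).
Qed.

Lemma bilinear_bound (a b p q A B : R) : `|a| <= A -> `|b| <= A ->
  `|p| <= B -> `|q| <= B -> `|a * p + b * q| <= A * B *+ 2.
Proof.
move=> aA bA pB qB; rewrite mulr2n; apply: (le_trans (ler_normD _ _)).
by rewrite !normrM lerD// ler_pM.
Qed.

Lemma lt_one_plus_sum (a b c d e f : R) :
  0 <= a -> 0 <= b -> 0 <= c -> 0 <= d -> 0 <= e -> 0 <= f ->
  let K := 1 + (a + b + (c + d + (e + f))) in
  [/\ a < K, b < K & [/\ c < K, d < K, e < K & f < K]].
Proof. by move=> ? ? ? ? ? ? /=; do !split; lra. Qed.

Lemma poincare W (P Q : 'rV[R]_2 -> R^o) u0 : open W -> W u0 ->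
  smooth W P -> smooth W Q ->
  (forall u, W u -> 'D_('e_1) P u = 'D_('e_0) Q u) ->
  exists W' (F : 'rV[R]_2 -> R^o), [/\ open W', W' u0, W' `<=` W, smooth W' F &
    forall u v, W' u -> 'D_v F u = form P Q v u].
Proof.
(* F integrates the 1-form along segments from u0 *)
move=> oW W0 sP sQ closed.
(* Closedness without coordinates: differentiating the form along one vector and applying it to
   another is symmetric in the two vectors. *)
have swap u v w : W u -> 'D_v (form P Q w : _ -> R^o) u = 'D_w (form P Q v : _ -> R^o) u.
  move=> Wu; rewrite !derive_form; try exact: smooth_differentiable Wu.
  rewrite closed//; set a : R := 'D_ _ P u; set b : R := 'D_ _ Q u; set d : R := 'D_ _ Q u.
  have alg (v0 v1 w0 w1 : R) : v0 * (w0 * a + w1 * b) + v1 * (w0 * b + w1 * d) =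
    w0 * (v0 * a + v1 * b) + w1 * (v0 * b + v1 * d) by ring.
  exact: alg.
(* A constant strictly above all six values at [u0]: by continuity it bounds [P], [Q] and their
   partial derivatives on a ball, as domination under the integral sign requires. *)
pose K0 : R := 1 + (`|(P u0 : R)| + `|(Q u0 : R)| +
  (`|('D_('e_0) P u0 : R)| + `|('D_('e_1) P u0 : R)| +
   (`|('D_('e_0) Q u0 : R)| + `|('D_('e_1) Q u0 : R)|))).
have bnd (G : 'rV[R]_2 -> R^o) : smooth W G -> `|(G u0 : R)| < K0 ->
    \forall y \near u0, `|(G y : R)| <= K0.
  move=> sG; rewrite -subr_gt0 => G0.
  have /cvgrPdist_le /(_ _ G0) N := smooth_continuous sG W0.
  have tri (a b k : R) : `|a - b| <= k - `|a| -> `|b| <= k.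
    move=> ab; rewrite -[b](subKr a); apply: (le_trans (ler_normB _ _)).
    by rewrite addrC -lerBrDr.
  by apply: filterS N => y; exact: tri.
have /nbhs_ballP[r /= r0 rP] : nbhs u0 (fun y => [/\ W y,
    `|(P y : R)| <= K0 /\ `|(Q y : R)| <= K0,
    `|('D_('e_0) P y : R)| <= K0 /\ `|('D_('e_1) P y : R)| <= K0 &
    `|('D_('e_0) Q y : R)| <= K0 /\ `|('D_('e_1) Q y : R)| <= K0]).
  have N0 : nbhs u0 W by exact: open_nbhs_nbhs.
  have nn (a : R) : 0 <= `|a| by [].
  have N1 := bnd P sP; have N2 := bnd Q sQ.
  have N3 := bnd _ (smooth_derive 'e_0 sP); have N4 := bnd _ (smooth_derive 'e_1 sP).
  have N5 := bnd _ (smooth_derive 'e_0 sQ); have N6 := bnd _ (smooth_derive 'e_1 sQ).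
  have [L1 L2 [L3 L4 L5 L6]] := lt_one_plus_sum (nn (P u0)) (nn (Q u0)) (nn ('D_('e_0) P u0))
    (nn ('D_('e_1) P u0)) (nn ('D_('e_0) Q u0)) (nn ('D_('e_1) Q u0)).
  have M1 := N1 L1; have M2 := N2 L2; have M3 := N3 L3.
  have M4 := N4 L4; have M5 := N5 L5; have M6 := N6 L6.
  apply: filterS (filterI (filterI N0 (filterI M1 M2))
    (filterI (filterI M3 M4) (filterI M5 M6))).
  by move=> y [[? [? ?]] [[? ?] [? ?]]].
pose F u : R := \int[lebesgue_measure]_(s in `[0, 1]) form P Q (u - u0) (u0 + s *: (u - u0)).
suff dF u v : ball u0 r u -> is_derive u v (F : _ -> R^o) (form P Q v u).
  have oB : open (ball u0 r) by exact: ball_open.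
  have BW : ball u0 r `<=` W by move=> y /rP[].
  exists (ball u0 r), F; split => //; first exact: ballxx.
    apply: (@smooth_primitive R _ F P Q) => //; exact: smooth_sub BW _.
  by move=> u v Bu; have [] := dF u v Bu.
move=> Bu; pose y : 'rV[R]_2 := u - u0.
have [d d0 dP] : exists2 d : R, 0 < d & forall h : R, `|h| <= d -> ball u0 r (u + h *: v).
  have [d d0 dP] := near_plane v 0 (open_nbhs_nbhs (conj (ball_open _ _ : open (ball u0 r)) Bu)).
  exists d => // h hd; have := dP h 0 hd; rewrite normr0 scale0r addr0.
  by apply; exact: ltW.
pose yh (h : R) := y + h *: v.
have yhr (h : R) : `|h| <= d -> `|yh h| < r.
  move=> /dP; rewrite -ball_normE /=.
  by rewrite /yh /y distrC addrAC.
have pB (h s : R) : `|h| <= d -> 0 <= s <= 1 -> ball u0 r (u0 + s *: yh h).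
  move=> /yhr yr /andP[s0 s1]; rewrite -ball_normE /= opprD addNKr normrN normrZ.
  by rewrite ger0_norm//; apply: le_lt_trans yr; rewrite ler_piMl.
pose f (h s : R) : R := form P Q (yh h) (u0 + s *: yh h).
(* Derivative of the integrand in [h]. Its two terms arise because [yh h] occurs both in the base
   point, with the factor [s], and as the vector to which the form is applied. *)
pose fd (h s : R) : R := s * ('D_v (form P Q (yh h) : _ -> R^o) (u0 + s *: yh h) : R) +
  form P Q v (u0 + s *: yh h).
have hf (h s : R) : `|h| <= d -> 0 <= s <= 1 -> is_derive h (1 : R) (f ^~ s) (fd h s).
  move=> hd s01; have [Wp _ _ _] := rP _ (pB h s hd s01).
  have E k : u0 + s *: yh k = (u0 + s *: y) + k *: (s *: v).
    by rewrite /yh scalerDr addrA !scalerA mulrC.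
  have dPp : differentiable P (u0 + s *: yh h) by exact: smooth_differentiable Wp.
  have dQp : differentiable Q (u0 + s *: yh h) by exact: smooth_differentiable Wp.
  rewrite /fd (derive_form v (yh h) dPp dQp).
  have LP : is_derive h (1 : R) (fun h : R => P (u0 + s *: yh h) : R) (s * ('D_v P (u0 + s *: yh
    h) : R)).
    have /funext EP : (fun h : R => P (u0 + s *: yh h) : R) =1 (fun h : R => P ((u0 + s *: y) +
      h *: (s *: v)) : R).
      by move=> k; rewrite E.
    by rewrite EP E; apply: is_derive_scaled_line; rewrite -E.
  have LQ : is_derive h (1 : R) (fun h : R => Q (u0 + s *: yh h) : R) (s * ('D_v Q (u0 + s *: yh
    h) : R)).
    have /funext EQ : (fun h : R => Q (u0 + s *: yh h) : R) =1 (fun h : R => Q ((u0 + s *: y) +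
      h *: (s *: v)) : R).
      by move=> k; rewrite E.
    by rewrite EQ E; apply: is_derive_scaled_line; rewrite -E.
  have Ly i : is_derive h (1 : R) (fun h : R => yh h 0 i : R) (v 0 i).
    have /funext EY : (fun h : R => yh h 0 i : R) =1 (cst (y 0 i) + (v 0 i \*: (id : R -> R^o)))%R.
      by move=> k; rewrite /yh !mxE mulrC.
    have := is_deriveD (is_derive_cst (y 0 i : R) h (1 : R))
      (is_deriveZ (v 0 i) (is_derive_id h (1 : R))).
    rewrite EY add0r; congr (is_derive _ _ _ _).
    by rewrite -[LHS]/(_ * _) mulr1.
  have := is_deriveD (is_deriveM (Ly 0) LP) (is_deriveM (Ly 1) LQ).
  rewrite (derive_rV2 v dPp) (derive_rV2 v dQp).
  congr (is_derive _ _ _ _).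
  have alg (a b v0 v1 p q A B C D : R) :
     a * (s * (v0 * A + v1 * B)) + p * v0 + (b * (s * (v0 * C + v1 * D)) + q * v1) =
     s * (v0 * (a * A + b * C) + v1 * (a * B + b * D)) + (v0 * p + v1 * q) by ring.
  exact: alg.
pose I : set R := [set` `](- d), d[].
have ID (h : R) : I h -> `|h| <= d.
  by rewrite /I /= in_itv /= => /andP[h1 h2]; rewrite ler_norml (ltW h1) (ltW h2).
have line_derivable (G : 'rV[R]_2 -> R^o) (h s : R) : smooth W G -> `|h| <= d -> 0 <= s <= 1 ->
    is_derive s (1 : R) (fun s : R => G (u0 + s *: yh h) : R) ('D_(yh h) G (u0 + s *: yh h)).
  move=> sG hd s01; have [Wp _ _ _] := rP _ (pB h s hd s01).
  by apply: is_derive_line; exact: smooth_differentiable sG Wp.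
have sform w : smooth W (form P Q w : _ -> R^o) by exact: smooth_form.
have intf (h : R) : I h -> mu.-integrable `[0, 1] (EFin \o f h).
  move=> /ID hd; apply: continuous_compact_integrable; first exact: segment_compact.
  apply: derivable_within_continuous => s; rewrite in_itv /= => s01.
  by have [] := line_derivable _ h s (sform (yh h)) hd s01.
have I0 : I 0 by rewrite /I /= in_itv /= oppr_lt0 d0.
have derf1 (h s : R) : I h -> [set` `[(0 : R), 1]] s -> derivable (f ^~ s) h 1.
  by move=> /ID hd; rewrite /= in_itv /= => s01; have [] := hf h s hd s01.
have d1f (h s : R) : I h -> [set` `[(0 : R), 1]] s -> partial1of2 f h s = fd h s.
  move=> /ID hd; rewrite /= in_itv /= => s01; rewrite partial1of2E.
  by have [] := hf h s hd s01.
have K00 : 0 <= K0.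
  have [_ [PK _] _ _] := rP _ (ballxx u0 r0); exact: le_trans PK.
(* A bound for [fd]: the coordinates of [yh h] are at most [r], those of [v] at most its norm, and
   the coefficients at most [K0]; each [*+ 2] counts the two coordinates of a sum. *)
pose C : R := `|v| * (r * K0 *+ 2) *+ 2 + `|v| * K0 *+ 2.
have fdC (h s : R) : I h -> [set` `[(0 : R), 1]] s -> `|fd h s| <= C.
  move=> /ID hd; rewrite /= in_itv /= => s01.
  have [Wp [P1 Q1] [P2 P3] [Q2 Q3]] := rP _ (pB h s hd s01).
  have /andP[s0 s1] := s01.
  have yr i : `|yh h 0 i| <= r by apply: le_trans (norm_coord _ _) _; exact/ltW/yhr.
  have vr i : `|v 0 i| <= `|v| by exact: norm_coord.
  rewrite /fd (derive_form v (yh h)); try exact: smooth_differentiable Wp.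
  apply: (le_trans (ler_normD _ _)); apply: lerD.
    rewrite normrM (ger0_norm s0) -[leRHS]mul1r ler_pM//.
    by apply: bilinear_bound => //; exact: bilinear_bound.
  exact: bilinear_bound.
have G_ub (h s : R) : I h -> [set` `[(0 : R), 1]] s -> `|partial1of2 f h s| <= cst C s.
  by move=> Ih Is; rewrite d1f//; exact: fdC.
have intG : mu.-integrable `[0, 1] (EFin \o cst C).
  apply: continuous_compact_integrable; first exact: segment_compact.
  by move=> z; exact: cvg_cst.
have C0 (s : R) : 0 <= cst C s by rewrite /C addr_ge0// mulrn_wge0// mulr_ge0// mulrn_wge0//
  mulr_ge0// ltW.
have m01 : measurable (`[0, 1] : set R) by exact: measurable_itv.
have key := @cvg_differentiation_under_integral R _ _ mu f `[0, 1] m01 0 (- d) d I0 intf derf1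
  (cst C) C0 intG G_ub.
(* By [swap] the differentiated integrand at h = 0 is the derivative of [H]. Its integral is
   therefore H(1) - H(0), which is the form at [u] applied to [v]. *)
pose H (s : R) : R := s * form P Q v (u0 + s *: y).
have yh0 : yh 0 = y by rewrite /yh scale0r addr0.
have d00 : `|0 : R| <= d by rewrite normr0 ltW.
have dH (s : R) : 0 <= s <= 1 -> is_derive s (1 : R) H (fd 0 s).
  move=> s01; have := line_derivable _ 0 s (sform v) d00 s01; rewrite yh0 => L.
  have := is_deriveM (is_derive_id s 1) L; congr (is_derive _ _ _ _).
  rewrite /fd yh0; have [Wp _ _ _] := rP _ (pB 0 s d00 s01); rewrite yh0 in Wp.
  rewrite (swap _ v y Wp).
  by congr (_ + _); rewrite -[LHS]/(_ * _) mulr1.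
have intE : \int[mu]_(s in `[0, 1]) partial1of2 f 0 s = form P Q v u.
  transitivity (\int[mu]_(s in `[0, 1]) fd 0 s).
    by apply: eq_Rintegral => s; rewrite inE => Is; exact: d1f.
  rewrite /Rintegral (@continuous_FTC2 _ (fd 0) H 0 1 ltr01).
  - by rewrite /= /H mul0r subr0 mul1r scale1r /y addrC subrK.
  - apply: derivable_within_continuous => s; rewrite in_itv /= => s01.
    have L1 := line_derivable _ 0 s (sform v) d00 s01.
    have L2 := line_derivable _ 0 s (smooth_derive v (sform (yh 0))) d00 s01.
    by have [] := is_deriveD (is_deriveM (is_derive_id s 1) L2) L1.
  - split.
    + move=> s; rewrite in_itv /= => /andP[/ltW s0 /ltW s1].
      by have [] := dH s; rewrite ?s0.
    + apply: cvg_at_right_filter.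
      have [] := dH 0; first by rewrite lexx ler01.
      by move=> /derivable1_diffP /differentiable_continuous.
    + apply: cvg_at_left_filter.
      have [] := dH 1; first by rewrite lexx ler01.
      by move=> /derivable1_diffP /differentiable_continuous.
  - move=> s; rewrite in_itv /= => /andP[/ltW s0 /ltW s1].
    by rewrite derive1E; have [] := dH s; rewrite ?s0.
rewrite intE in key.
have EF : (fun h : R => h^-1 *: (((F : _ -> R^o) \o shift u) (h *: v) - F u)) =
   (fun h : R => h^-1 *: ((\int[mu]_(s in `[0, 1]) f (h + 0) s) - \int[mu]_(s in `[0, 1]) f 0 s)).
  have F0 (k : R) : F (u + k *: v) = \int[mu]_(s in `[0, 1]) f k s.
    by rewrite /F /f /yh /y (addrAC u).
  have E1 (h : R) : F (h *: v + u) = \int[mu]_(s in `[0, 1]) f (h + 0) s.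
    by rewrite [h + 0]addr0 -F0 addrC.
  have E2 : F u = \int[mu]_(s in `[0, 1]) f 0 s by rewrite -F0 scale0r addr0.
  by apply/funext => h; rewrite -E1 -E2.
apply: DeriveDef.
  by apply/cvg_ex; exists (form P Q v u); rewrite EF.
by rewrite /derive EF; exact: cvg_lim key.
Qed.

End Poincare.

(** * Calculus on an immersed surface *)

Local Notation coord := Defs.coord.

Section Charts.
Context {R : realType} {M : surface R}.
Implicit Types (p q : M) (a b : atlas M) (W : set M).

Lemma chart_image_open a W : open W -> open (coord a @` (dom a `&` W)).
Proof.
move=> oW; have oC : open (coord a @` dom a) by exact: codom_open.
have cp : {in coord a @` dom a, continuous (par a)}.
  by rewrite -continuous_open_subspace//; exact: par_continuous.
rewrite openE => _ [p [dp Wp] <-] /=.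
have Cp : (coord a @` dom a) (coord a p) by exists p.
have N1 : nbhs (coord a p) (coord a @` dom a) by exact: open_nbhs_nbhs.
have N2 : nbhs (coord a p) (par a @^-1` W).
  apply: (cp _ (mem_set Cp)); rewrite coordK//.
  exact: open_nbhs_nbhs.
apply: filterS (filterI N1 N2) => _ [[q dq <-]]; rewrite /= coordK// => Wq.
by exists q.
Qed.

Lemma dom_chart_at p : dom (chart_at p) p.
Proof. by rewrite /chart_at; case: cid. Qed.

Context {V : normedModType R}.
Implicit Types (F G : M -> V).

Lemma smooth_on_eq W F G : open W -> (forall q, W q -> F q = G q) ->
  smooth_on W F -> smooth_on W G.
Proof.
move=> oW FG sF a; apply: smooth_eq (sF a); first exact: chart_image_open.
by move=> _ [q [dq Wq] <-] /=; rewrite coordK// FG.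
Qed.

Lemma smooth_on_sub W W' F : W' `<=` W -> smooth_on W F -> smooth_on W' F.
Proof.
move=> WW' sF a; apply: smooth_sub (sF a).
by apply: image_subset => q [dq /WW'].
Qed.

Lemma smooth_on_cst W (v : V) : smooth_on W (fun=> v).
Proof. by move=> a; exact: smooth_cst. Qed.

Lemma smooth_onD W F G : open W -> smooth_on W F -> smooth_on W G ->
  smooth_on W (fun q => F q + G q).
Proof. by move=> oW sF sG a; apply: smoothD => //; exact: chart_image_open. Qed.

Lemma smooth_onB W F G : open W -> smooth_on W F -> smooth_on W G ->
  smooth_on W (fun q => F q - G q).
Proof. by move=> oW sF sG a; apply: smoothB => //; exact: chart_image_open. Qed.

Lemma smooth_onZ W (s : M -> R^o) F : open W -> smooth_on W s -> smooth_on W F ->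
  smooth_on W (fun q => s q *: F q).
Proof. by move=> oW sF sG a; apply: smoothZ => //; exact: chart_image_open. Qed.

Lemma smooth_on_dot W (F G : M -> 'rV[R]_4) : open W -> smooth_on W F ->
  smooth_on W G -> smooth_on W (fun q => dot (F q) (G q) : R^o).
Proof. by move=> oW sF sG a; apply: smooth_dot => //; exact: chart_image_open. Qed.

(** Smoothness seen in one chart passes to the others by composition with the transition maps. *)
Lemma smooth_on_comp_coord a W (H : 'rV[R]_2 -> V) : open W -> W `<=` dom a ->
  smooth (coord a @` W) H -> smooth_on W (H \o coord a).
Proof.
move=> oW Wa sH b.
have oB : open (coord b @` (dom b `&` W)) by exact: chart_image_open.
rewrite -compA; apply: (smooth_comp (W' := coord a @` W)) => //.
  by move=> _ [q [dq Wq] <-] /=; exists q; rewrite ?coordK.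
apply: smooth_sub (transition_smooth b a).
by apply: image_subset => q [dq /Wa].
Qed.

Lemma differentiable_chart a p W F : W p -> dom a p -> smooth_on W F ->
  differentiable (F \o par a) (coord a p).
Proof. by move=> Wp dp sF; apply: (smooth_differentiable (sF a)); exists p. Qed.

Lemma transition_differentiable a b p : dom a p -> dom b p ->
  differentiable (coord b \o par a) (coord a p).
Proof. by move=> da db; apply: (smooth_differentiable (transition_smooth a b)); exists p. Qed.

Lemma derive_transition a b p W F v : W p -> dom a p -> dom b p -> smooth_on W F ->
  'D_v (F \o par a) (coord a p) =
  'D_('D_v (coord b \o par a) (coord a p)) (F \o par b) (coord b p).
Proof.
move=> Wp da db sF.
have oA : open (coord a @` (dom a `&` dom b)) by apply: chart_image_open; exact: dom_open.
transitivity ('D_v ((F \o par b) \o (coord b \o par a)) (coord a p)).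
  apply: (derive_near_eq v oA); last by exists p.
  by move=> _ [q [dq dbq] <-] /=; rewrite !coordK.
rewrite derive_comp; first by rewrite /= coordK.
  exact: transition_differentiable.
by rewrite /= coordK//; exact: (differentiable_chart Wp db sF).
Qed.

Lemma derive_transitionK a b p w : dom a p -> dom b p ->
  'D_('D_w (coord a \o par b) (coord b p)) (coord b \o par a) (coord a p) = w.
Proof.
move=> da db.
have oB : open (coord b @` (dom b `&` dom a)) by apply: chart_image_open; exact: dom_open.
transitivity ('D_w ((coord b \o par a) \o (coord a \o par b)) (coord b p)).
  rewrite derive_comp; first by rewrite /= coordK.
    exact: transition_differentiable.
  by rewrite /= coordK//; exact: transition_differentiable.
rewrite (derive_near_eq w oB (g := id)); last by exists p.
  by rewrite derive_id.
by move=> _ [q [dq dbq] <-] /=; rewrite !coordK.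
Qed.

End Charts.

(* The canonical basis of R^2, sealed: unification would otherwise unfold
   ordinals when comparing ['e_0] with ['e_1]. *)
Fact dir_subproof {R : realType} :
  {e : bool -> 'rV[R]_2 | e false = 'e_0 /\ e true = 'e_1}.
Proof. by exists (fun b => if b then 'e_1 else 'e_0). Qed.

Definition dir {R : realType} (b : bool) : 'rV[R]_2 := sval dir_subproof b.

Lemma dirE {R : realType} :
  (dir false = 'e_0 :> 'rV[R]_2) * (dir true = 'e_1 :> 'rV[R]_2).
Proof. by split; rewrite /dir; case: dir_subproof => ? []. Qed.

(* Sealed version of [D x]: unification would otherwise unfold differentials
   when comparing two derivatives. *)
Fact deriv_subproof {R : realType} {M : surface R} (x : M -> 'rV[R]_4) :
  {d : forall V : normedModType R, (M -> V) -> M -> 'rV[R]_4 -> V |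
    forall V F p X, d V F p X = D x F p X}.
Proof. by exists (fun V => @D R M x V). Qed.

Definition deriv {R : realType} {M : surface R} (x : M -> 'rV[R]_4)
    {V : normedModType R} : (M -> V) -> M -> 'rV[R]_4 -> V :=
  sval (deriv_subproof x) V.

Lemma derivE {R : realType} {M : surface R} (x : M -> 'rV[R]_4)
    {V : normedModType R} (F : M -> V) p X : deriv x F p X = D x F p X.
Proof. exact: (svalP (deriv_subproof x)). Qed.

(** * Coordinate fields and derivatives along tangent vectors *)

Section Immersion.
Context {R : realType} {M : surface R}.
Implicit Types (p q : M) (a b : atlas M) (W : set M).
Variables (x : M -> 'rV[R]_4) (hx : immersion x).
Local Notation c0 p := (coord (chart_at p) p).

(** The coordinate field of the chart [a] in the constant direction [v], as a map into R^4. It is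
    sealed for the same reason as [deriv]. *)
Fact cfield_subproof : {c : atlas M -> 'rV[R]_2 -> M -> 'rV[R]_4 |
  forall a v q, c a v q = 'D_v (x \o par a) (coord a q)}.
Proof. by exists (fun a v q => 'D_v (x \o par a) (coord a q)). Qed.

Definition cfield : atlas M -> 'rV[R]_2 -> M -> 'rV[R]_4 := sval cfield_subproof.

Lemma cfieldE a v q : cfield a v q = 'D_v (x \o par a) (coord a q).
Proof. exact: (svalP cfield_subproof). Qed.

Lemma smooth_immersion : smooth_on setT x. Proof. by have [] := hx. Qed.

Lemma jacE p w : w *m jac x p = 'D_w (x \o par (chart_at p)) (c0 p).
Proof.
rewrite /jac deriveEjacobian//.
exact: (differentiable_chart (W := setT) _ (dom_chart_at p) smooth_immersion).
Qed.

Lemma cfield_jac a p v : dom a p ->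
  cfield a v p = 'D_v (coord (chart_at p) \o par a) (coord a p) *m jac x p.
Proof.
move=> da; rewrite jacE cfieldE; have Tp : setT p by [].
exact: (derive_transition v Tp da (dom_chart_at p) smooth_immersion).
Qed.

Lemma tangentP a p X : dom a p ->
  (X <= tangent x p)%MS <-> exists v, X = cfield a v p.
Proof.
move=> da; have db := dom_chart_at p.
rewrite /tangent genmxE; split=> [/submxP[w ->]|[v ->]].
  exists ('D_w (coord a \o par (chart_at p)) (c0 p)).
  by rewrite cfield_jac// derive_transitionK.
by rewrite cfield_jac// submxMl.
Qed.

Lemma tangent_cfield a p v : dom a p -> (cfield a v p <= tangent x p)%MS.
Proof. by move=> da; apply/(tangentP _ da); exists v. Qed.

(** The derivative is defined in the chart chosen at [p], which changes with [p]. Along a coordinate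
    field it can be read in any fixed chart: the chain rule turns one into the other, and [jac x p],
    being row free, is cancelled by its pseudo-inverse. *)
Lemma D_cfield {V : normedModType R} (F : M -> V) a W p v :
  smooth_on W F -> W p -> dom a p ->
  deriv x F p (cfield a v p) = 'D_v (F \o par a) (coord a p).
Proof.
move=> sF Wp da; have db := dom_chart_at p.
rewrite derivE cfield_jac// (derive_transition v Wp da db sF) /D mulmxKp; last by have [_] := hx.
by rewrite [RHS]deriveE//; exact: (differentiable_chart Wp db sF).
Qed.

Lemma cfield_inj a p v : dom a p -> cfield a v p = 0 -> v = 0.
Proof.
move=> da; have db := dom_chart_at p.
rewrite cfield_jac// => w0; rewrite -(derive_transitionK v db da).
have [_ /(_ p) rf] := hx.
have -> : 'D_v (coord (chart_at p) \o par a) (coord a p) = 0.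
  by rewrite -[LHS](mulmxKp rf) w0 mul0mx.
by rewrite derive0.
Qed.

Lemma cfield_rV2 a p v : dom a p ->
  cfield a v p = v 0 0 *: cfield a (dir false) p + v 0 1 *: cfield a (dir true) p.
Proof.
move=> da; rewrite !cfieldE !dirE derive_rV2//.
exact: (differentiable_chart (W := setT) _ da smooth_immersion).
Qed.

Lemma smooth_on_D_cfield {V : normedModType R} (F : M -> V) a W v :
  open W -> smooth_on W F ->
  smooth_on (dom a `&` W) (fun q => deriv x F q (cfield a v q)).
Proof.
move=> oW sF; have oaW : open (dom a `&` W) by apply: openI => //; exact: dom_open.
apply: (@smooth_on_eq _ _ _ _ ('D_v (F \o par a) \o coord a)) => //.
  by move=> q [da Wq]; rewrite (D_cfield _ sF).
have sub : dom a `&` W `<=` dom a by move=> q [].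
exact: (smooth_on_comp_coord oaW sub (smooth_derive v (sF a))).
Qed.

Lemma smooth_on_cfield a v : smooth_on (dom a) (cfield a v).
Proof.
have -> : cfield a v = 'D_v (x \o par a) \o coord a.
  by apply/funext => q; rewrite cfieldE.
apply: smooth_on_comp_coord => //; first exact: dom_open.
apply: smooth_derive; apply: smooth_sub (smooth_immersion a).
by move=> _ [q da <-]; exists q.
Qed.

Lemma D_x p X : (X <= tangent x p)%MS -> deriv x x p X = X.
Proof.
have da := dom_chart_at p; move=> /(tangentP _ da)[v ->].
by rewrite (D_cfield v smooth_immersion)// cfieldE.
Qed.

Lemma deriv_chart {V : normedModType R} (F : M -> V) W p X : W p -> smooth_on W F ->
  deriv x F p X = 'D_(X *m pinvmx (jac x p)) (F \o par (chart_at p)) (c0 p).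
Proof.
by move=> Wp sF; rewrite derivE deriveE//; exact: differentiable_chart (dom_chart_at p) sF.
Qed.

Section Leibniz.
Variables (W : set M) (oW : open W) (p : M) (Wp : W p) (X : 'rV[R]_4).

Lemma D_eq {V : normedModType R} (F G : M -> V) : smooth_on W F ->
  (forall q, W q -> F q = G q) -> deriv x F p X = deriv x G p X.
Proof.
move=> sF FG; rewrite !(deriv_chart X Wp)//; last exact: smooth_on_eq sF.
apply: (derive_near_eq _ (chart_image_open (a := chart_at p) oW)).
  by move=> _ [q [dq Wq] <-] /=; rewrite coordK// FG.
by exists p => //; split=> //; exact: dom_chart_at.
Qed.

Lemma D_cst {V : normedModType R} (v : V) : deriv x (fun=> v) p X = 0.
Proof. by rewrite (deriv_chart X Wp); [exact: derive_cst|exact: smooth_on_cst]. Qed.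

Lemma D_add {V : normedModType R} (F G : M -> V) : smooth_on W F -> smooth_on W G ->
  deriv x (fun q => F q + G q) p X = deriv x F p X + deriv x G p X.
Proof.
move=> sF sG; rewrite !(deriv_chart X Wp)//; last exact: smooth_onD.
rewrite -deriveD//; apply: diff_derivable;
  exact: (differentiable_chart Wp (dom_chart_at p)).
Qed.

Lemma D_sub {V : normedModType R} (F G : M -> V) : smooth_on W F -> smooth_on W G ->
  deriv x (fun q => F q - G q) p X = deriv x F p X - deriv x G p X.
Proof.
move=> sF sG; rewrite !(deriv_chart X Wp)//; last exact: smooth_onB.
rewrite -deriveB//; apply: diff_derivable;
  exact: (differentiable_chart Wp (dom_chart_at p)).
Qed.

Lemma D_scale {V : normedModType R} (s : M -> R^o) (F : M -> V) :
  smooth_on W s -> smooth_on W F ->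
  deriv x (fun q => s q *: F q) p X = s p *: deriv x F p X + deriv x s p X *: F p.
Proof.
move=> sF sG; rewrite !(deriv_chart X Wp)//; last exact: smooth_onZ.
have dp := dom_chart_at p.
rewrite (@derive_scale R _ (s \o par (chart_at p)) (F \o par (chart_at p)));
  try exact: (differentiable_chart Wp dp).
by rewrite /= coordK.
Qed.

Lemma D_dot (F G : M -> 'rV[R]_4) : smooth_on W F -> smooth_on W G ->
  deriv x (fun q => dot (F q) (G q) : R^o) p X =
  dot (F p) (deriv x G p X) + dot (deriv x F p X) (G p).
Proof.
move=> sF sG; rewrite !(deriv_chart X Wp)//; last exact: smooth_on_dot.
have dp := dom_chart_at p.
rewrite (@derive_dot R (F \o par (chart_at p)) (G \o par (chart_at p)));
  try exact: (differentiable_chart Wp dp).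
by rewrite /= coordK.
Qed.

End Leibniz.

Lemma D_addr {V : normedModType R} (F : M -> V) p X Y :
  deriv x F p (X + Y) = deriv x F p X + deriv x F p Y.
Proof. by rewrite !derivE /D mulmxDl linearD. Qed.

Lemma D_scaler {V : normedModType R} (F : M -> V) p s X :
  deriv x F p (s *: X) = s *: deriv x F p X.
Proof. by rewrite !derivE /D -scalemxAl linearZ. Qed.

(** Schwarz's theorem in the chart [a]; in other words, coordinate fields commute. *)
Lemma D_cfieldC (F : M -> 'rV[R]_4) a W p v w : open W -> smooth_on W F ->
  W p -> dom a p ->
  deriv x (fun q => deriv x F q (cfield a v q)) p (cfield a w p) =
  deriv x (fun q => deriv x F q (cfield a w q)) p (cfield a v p).
Proof.
move=> oW sF Wp da.
have oaW : open (coord a @` (dom a `&` W)) by exact: chart_image_open.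
have E v' w' : deriv x (fun q => deriv x F q (cfield a v' q)) p (cfield a w' p) =
    'D_w' ('D_v' (F \o par a)) (coord a p).
  rewrite (D_cfield _ (smooth_on_D_cfield a v' oW sF))//.
  apply: (derive_near_eq _ oaW); last by exists p.
  by move=> _ [q [dq Wq] <-] /=; rewrite coordK// (D_cfield _ sF).
have Cp : (coord a @` (dom a `&` W)) (coord a p) by exists p.
rewrite (E v w) (E w v); exact: (schwarz v w oaW (sF a) Cp).
Qed.

End Immersion.

(** * Inner products and Gram determinants *)

Section DotAlgebra.
Context {R : realType}.
Implicit Types (u v w A B : 'rV[R]_4).

Lemma dotDl u v w : dot (u + v) w = dot u w + dot v w.
Proof. exact: linearDl. Qed.

Lemma dotDr u v w : dot u (v + w) = dot u v + dot u w.
Proof. exact: linearDr. Qed.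

Lemma dotNl u v : dot (- u) v = - dot u v.
Proof. exact: linearNl. Qed.

Lemma dotNr u v : dot u (- v) = - dot u v.
Proof. exact: linearNr. Qed.

Lemma dotZl s u v : dot (s *: u) v = s * dot u v.
Proof. exact: linearZl_LR. Qed.

Lemma dotZr s u v : dot u (s *: v) = s * dot u v.
Proof. exact: linearZr_LR. Qed.

Lemma dot0l v : dot 0 v = 0.
Proof. exact: linear0l. Qed.

Lemma dot0r v : dot v 0 = 0.
Proof. exact: linear0r. Qed.

Definition dot_lin := (dotDl, dotDr, dotNl, dotNr, dotZl, dotZr, dot0l, dot0r).

Lemma dot_ge0 v : 0 <= dot v v.
Proof. by rewrite dotE; apply: sumr_ge0 => i _; exact: sqr_ge0. Qed.

Lemma dot_eq0 v : (dot v v == 0) = (v == 0).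
Proof.
apply/idP/idP => [|/eqP->]; last by rewrite dot0l.
rewrite dotE psumr_eq0 => [/allP v0|i _]; last exact: sqr_ge0.
apply/eqP/rowP => i; rewrite mxE; have := v0 i (mem_index_enum i).
by rewrite /= mulf_eq0 orbb => /eqP.
Qed.

Lemma dot_gt0 v : (0 < dot v v) = (v != 0).
Proof. by rewrite lt_neqAle dot_ge0 andbT eq_sym dot_eq0. Qed.

Definition gram A B : R := dot A A * dot B B - dot A B ^+ 2.

(** With [coef2], Cramer's solution of v . A = d0 and v . B = d1 for v in the span of [A] and [B].
    The inverse of the determinant is written as a real power so that [smooth_powR] applies. *)
Definition coef1 A B (d0 d1 : R) : R := (d0 * dot B B - d1 * dot A B) * gram A B `^ (-1).
Definition coef2 A B (d0 d1 : R) : R := (d1 * dot A A - d0 * dot A B) * gram A B `^ (-1).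

Definition dual_vec A B d0 d1 := coef1 A B d0 d1 *: A + coef2 A B d0 d1 *: B.

(** Strict Cauchy-Schwarz: |A|^2 times the Gram determinant is the squared length of |A|^2 B - (A .
    B) A, which is nonzero by independence. *)
Lemma gram_gt0 A B : (forall s r, s *: A + r *: B = 0 -> s = 0 /\ r = 0) ->
  0 < gram A B.
Proof.
move=> free; have A0 : 0 < dot A A.
  rewrite dot_gt0; apply/eqP => A0; have [] := free 1 0.
    by rewrite A0 scaler0 scale0r addr0.
  by move/eqP; rewrite oner_eq0.
have : 0 < dot (dot A A *: B - dot A B *: A) (dot A A *: B - dot A B *: A).
  rewrite dot_gt0; apply/eqP => E; have [] := free (- dot A B) (dot A A).
    by rewrite scaleNr addrC.
  by move=> _ AA; rewrite AA ltxx in A0.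
have -> : dot (dot A A *: B - dot A B *: A) (dot A A *: B - dot A B *: A) =
  dot A A * gram A B.
  by rewrite /gram !dot_lin (dotC B A); ring.
by rewrite pmulr_rgt0.
Qed.

Lemma gram_inv A B : 0 < gram A B -> gram A B `^ (-1) = (gram A B)^-1.
Proof. by move=> g0; rewrite powR_inv1// ltW. Qed.

Lemma dot_dual_vec1 A B d0 d1 : 0 < gram A B -> dot (dual_vec A B d0 d1) A = d0.
Proof.
move=> g0; rewrite /dual_vec /coef1 /coef2 gram_inv// !dot_lin (dotC B A).
have : gram A B != 0 by rewrite gt_eqF.
by rewrite /gram => g1; field.
Qed.

Lemma dot_dual_vec2 A B d0 d1 : 0 < gram A B -> dot (dual_vec A B d0 d1) B = d1.
Proof.
move=> g0; rewrite /dual_vec /coef1 /coef2 gram_inv// !dot_lin.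
have : gram A B != 0 by rewrite gt_eqF.
by rewrite /gram => g1; field.
Qed.

End DotAlgebra.

(** * Orthogonal splitting into tangent and normal parts *)

Section TangentNormal.
Context {R : realType} {M : surface R}.
Implicit Types (x : M -> 'rV[R]_4) (p : M).

Lemma normalP x p w : (w <= normal x p)%MS <->
  forall X, (X <= tangent x p)%MS -> dot w X = 0.
Proof.
rewrite /normal; split=> [/sub_kermxP wT X /submxP[Y ->]|wT].
  by rewrite /dot trmx_mul mulmxA wT mul0mx mxE.
apply/sub_kermxP/rowP => i; rewrite [RHS]mxE.
have := wT (row i (tangent x p)) (row_sub _ _).
rewrite dotE => E; rewrite mxE -[RHS]E; apply: eq_bigr => k _.
by rewrite !mxE.
Qed.

Lemma dot_tangent_normal x p X w : (X <= tangent x p)%MS -> (w <= normal x p)%MS ->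
  dot X w = 0.
Proof. by move=> TX /normalP wN; rewrite dotC wN. Qed.

Lemma tangent_capN x p : (tangent x p :&: normal x p = 0)%MS.
Proof.
apply/eqP/rowV0P => v; rewrite sub_capmx => /andP[vT vN].
by apply/eqP; rewrite -dot_eq0 (dot_tangent_normal vT vN).
Qed.

Lemma tangent_addN x p (v : 'rV[R]_4) : (v <= tangent x p + normal x p)%MS.
Proof.
apply: submx_full; rewrite /row_full.
have := mxrank_sum_cap (tangent x p) (normal x p).
rewrite tangent_capN mxrank0 addn0 => ->.
by rewrite /normal mxrank_ker mxrank_tr subnKC// rank_leq_col.
Qed.

Lemma tpart_npart x p v : tpart x p v + npart x p v = v.
Proof. by rewrite /tpart /npart add_proj_mx ?tangent_capN ?tangent_addN. Qed.

Lemma tpart_tangent x p v : (tpart x p v <= tangent x p)%MS.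
Proof. exact: proj_mx_sub. Qed.

Lemma npart_normal x p v : (npart x p v <= normal x p)%MS.
Proof. exact: proj_mx_sub. Qed.

Lemma npartE x p v : npart x p v = v - tpart x p v.
Proof. by rewrite -{2}(tpart_npart x p v) addrC addKr. Qed.

Lemma tpart_id x p v : (v <= tangent x p)%MS -> tpart x p v = v.
Proof. by move=> ?; rewrite /tpart proj_mx_id// tangent_capN. Qed.

Lemma npart_id x p v : (v <= normal x p)%MS -> npart x p v = v.
Proof. by move=> ?; rewrite /npart proj_mx_id// capmxC tangent_capN. Qed.

Lemma npart_tangent x p v : (v <= tangent x p)%MS -> npart x p v = 0.
Proof. by move=> vT; rewrite npartE tpart_id// subrr. Qed.

Lemma npart_eq0 x p v : npart x p v = 0 -> (v <= tangent x p)%MS.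
Proof. by move=> n0; rewrite -(tpart_npart x p v) n0 addr0 tpart_tangent. Qed.

Lemma dot_tpart x p v X : (X <= tangent x p)%MS -> dot (tpart x p v) X = dot v X.
Proof.
move=> TX; rewrite -{2}(tpart_npart x p v) dotDl (dotC (npart _ _ _)).
by rewrite (dot_tangent_normal TX (npart_normal _ _ _)) addr0.
Qed.

Lemma dot_npart x p v n : (n <= normal x p)%MS -> dot (npart x p v) n = dot v n.
Proof.
move=> Nn; rewrite -{2}(tpart_npart x p v) dotDl.
by rewrite (dot_tangent_normal (tpart_tangent _ _ _) Nn) add0r.
Qed.

Lemma tangent_eq x p X Y : (X <= tangent x p)%MS -> (Y <= tangent x p)%MS ->
  (forall Z, (Z <= tangent x p)%MS -> dot X Z = dot Y Z) -> X = Y.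
Proof.
move=> TX TY XY; apply/eqP; rewrite -subr_eq0 -dot_eq0.
have TXY : (X - Y <= tangent x p)%MS by rewrite addmx_sub// eqmx_opp.
by rewrite dotDl dotNl !XY ?subrr.
Qed.

Lemma normal_eq x p u v : (u <= normal x p)%MS -> (v <= normal x p)%MS ->
  (forall n, (n <= normal x p)%MS -> dot u n = dot v n) -> u = v.
Proof.
move=> Nu Nv uv; apply/eqP; rewrite -subr_eq0 -dot_eq0.
have N : (u - v <= normal x p)%MS by rewrite addmx_sub// eqmx_opp.
by rewrite dotDl dotNl !uv ?subrr.
Qed.

Lemma tpartD x p u v : tpart x p (u + v) = tpart x p u + tpart x p v.
Proof. exact: mulmxDl. Qed.

Lemma tpartZ x p s v : tpart x p (s *: v) = s *: tpart x p v.
Proof. by rewrite /tpart scalemxAl. Qed.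

Lemma npartD x p u v : npart x p (u + v) = npart x p u + npart x p v.
Proof. exact: mulmxDl. Qed.

Lemma npartZ x p s v : npart x p (s *: v) = s *: npart x p v.
Proof. by rewrite /npart scalemxAl. Qed.

End TangentNormal.

(** * Smooth dependence of projections on the point *)

Section Frame.
Context {R : realType} {M : surface R}.
Implicit Types (p q : M) (a b : atlas M) (W : set M).
Variables (x : M -> 'rV[R]_4) (hx : immersion x).

Local Notation E a q := (cfield x a (dir false) q).
Local Notation E' a q := (cfield x a (dir true) q).

Lemma frame_gram a p : dom a p -> 0 < gram (E a p) (E' a p).
Proof.
move=> da; apply: gram_gt0 => s r E0.
pose v : 'rV[R]_2 := s *: 'e_0 + r *: 'e_1.
have v0 : v 0 0 = s by rewrite !mxE /= mulr1 mulr0 addr0.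
have v1 : v 0 1 = r by rewrite !mxE /= mulr1 mulr0 add0r.
have : cfield x a v p = 0 by rewrite cfield_rV2// v0 v1.
by move/(cfield_inj hx da) => vz; rewrite -v0 -v1 vz !mxE.
Qed.

Lemma frame_tangent a p X : dom a p -> (X <= tangent x p)%MS ->
  exists s r, X = s *: E a p + r *: E' a p.
Proof.
move=> da /(tangentP hx _ da)[v ->]; exists (v 0 0), (v 0 1).
exact: cfield_rV2.
Qed.

Lemma dual_vec_frame a p d0 d1 v : dom a p -> (v <= tangent x p)%MS ->
  dot v (E a p) = d0 -> dot v (E' a p) = d1 -> v = dual_vec (E a p) (E' a p) d0 d1.
Proof.
move=> da Tv v0 v1; have g0 := frame_gram da.
have T0 := tangent_cfield hx (dir false) da; have T1 := tangent_cfield hx (dir true) da.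
apply: (tangent_eq Tv); first by rewrite /dual_vec addmx_sub// scalemx_sub.
move=> Z /(frame_tangent da)[s [r ->]].
by rewrite !dotDr !dotZr dot_dual_vec1// dot_dual_vec2// v0 v1.
Qed.

(** An explicit formula for the tangential projection in terms of coordinate fields, from which its
    smoothness is read off. *)
Lemma tpart_frame a p v : dom a p ->
  tpart x p v = dual_vec (E a p) (E' a p) (dot v (E a p)) (dot v (E' a p)).
Proof.
move=> da; apply: dual_vec_frame => //; first exact: tpart_tangent.
  by rewrite dot_tpart//; exact: tangent_cfield.
by rewrite dot_tpart//; exact: tangent_cfield.
Qed.

Lemma smooth_on_coef a W (d0 d1 : M -> R^o) : open W -> W `<=` dom a ->
  smooth_on W d0 -> smooth_on W d1 ->
  smooth_on W (fun q => coef1 (E a q) (E' a q) (d0 q) (d1 q) : R^o) /\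
  smooth_on W (fun q => coef2 (E a q) (E' a q) (d0 q) (d1 q) : R^o).
Proof.
move=> oW Wa sd0 sd1.
have s0 : smooth_on W (cfield x a (dir false)) := smooth_on_sub Wa (smooth_on_cfield hx a (dir
  false)).
have s1 : smooth_on W (cfield x a (dir true)) := smooth_on_sub Wa (smooth_on_cfield hx a (dir
  true)).
have d00 := smooth_on_dot oW s0 s0; have d11 := smooth_on_dot oW s1 s1.
have d01 := smooth_on_dot oW s0 s1.
have sM (G H : M -> R^o) : smooth_on W G -> smooth_on W H -> smooth_on W (fun q => G q * H q : R^o).
  exact: smooth_onZ.
have sg : smooth_on W (fun q => gram (E a q) (E' a q) `^ (-1) : R^o).
  move=> b; apply: (@smooth_powR R _ (fun u => gram (E a (par b u)) (E' a (par b u)))).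
  - exact: chart_image_open.
  - by move=> _ [q [dq Wq] <-]; rewrite coordK//; apply/frame_gram/Wa.
  - exact: (smooth_onB oW (sM _ _ d00 d11) (sM _ _ d01 d01)).
split.
  exact: (sM _ _ (smooth_onB oW (sM _ _ sd0 d11) (sM _ _ sd1 d01)) sg).
exact: (sM _ _ (smooth_onB oW (sM _ _ sd1 d00) (sM _ _ sd0 d01)) sg).
Qed.

Lemma smooth_on_dual_vec a W (d0 d1 : M -> R^o) : open W -> W `<=` dom a ->
  smooth_on W d0 -> smooth_on W d1 ->
  smooth_on W (fun q => dual_vec (E a q) (E' a q) (d0 q) (d1 q)).
Proof.
move=> oW Wa sd0 sd1; have [sc1 sc2] := smooth_on_coef oW Wa sd0 sd1.
have s0 := smooth_on_sub Wa (smooth_on_cfield hx a (dir false)).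
have s1 := smooth_on_sub Wa (smooth_on_cfield hx a (dir true)).
exact: (smooth_onD oW (smooth_onZ oW sc1 s0) (smooth_onZ oW sc2 s1)).
Qed.

Lemma smooth_on_local {V : normedModType R} W (F : M -> V) : open W ->
  (forall a, smooth_on (W `&` dom a) F) -> smooth_on W F.
Proof.
move=> oW sF a; have := sF a a.
by have -> : dom a `&` (W `&` dom a) = dom a `&` W by rewrite (setIC W) setIA setIid.
Qed.

Lemma smooth_on_tpart W (F : M -> 'rV[R]_4) : open W -> smooth_on W F ->
  smooth_on W (fun q => tpart x q (F q)).
Proof.
move=> oW sF; apply: smooth_on_local => // a.
have oWa : open (W `&` dom a) by apply: openI => //; exact: dom_open.
have WaW : W `&` dom a `<=` W by move=> q [].
have Wad : W `&` dom a `<=` dom a by move=> q [].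
have sF' := smooth_on_sub WaW sF.
have s0 := smooth_on_sub Wad (smooth_on_cfield hx a (dir false)).
have s1 := smooth_on_sub Wad (smooth_on_cfield hx a (dir true)).
apply: (smooth_on_eq oWa _ (smooth_on_dual_vec oWa Wad (smooth_on_dot oWa sF' s0) (smooth_on_dot
  oWa sF' s1))).
by move=> q [_ dq]; rewrite (tpart_frame _ dq).
Qed.

Lemma smooth_on_npart W (F : M -> 'rV[R]_4) : open W -> smooth_on W F ->
  smooth_on W (fun q => npart x q (F q)).
Proof.
move=> oW sF; apply: (smooth_on_eq oW _ (smooth_onB oW sF (smooth_on_tpart oW sF))).
by move=> q _; rewrite npartE.
Qed.

Lemma vector_field_frame a W (Y : M -> 'rV[R]_4) : open W -> W `<=` dom a ->
  vector_field x W Y -> exists y0 y1 : M -> R^o,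
  [/\ smooth_on W y0, smooth_on W y1 &
      forall q, W q -> Y q = y0 q *: E a q + y1 q *: E' a q].
Proof.
move=> oW Wa [sY TY].
have s0 := smooth_on_sub Wa (smooth_on_cfield hx a (dir false)).
have s1 := smooth_on_sub Wa (smooth_on_cfield hx a (dir true)).
have [sc1 sc2] := smooth_on_coef oW Wa (smooth_on_dot oW sY s0) (smooth_on_dot oW sY s1).
do 2 eexists; split; [exact: sc1|exact: sc2|move=> q Wq].
by rewrite -{1}(tpart_id (TY q Wq)) (tpart_frame _ (Wa q Wq)).
Qed.

(** In a chart, [Y] is a combination of the coordinate fields with smooth coefficients, and the
    derivative is linear in the direction. *)
Lemma smooth_on_D_field {V : normedModType R} (F : M -> V) W (Y : M -> 'rV[R]_4) :
  open W -> smooth_on W F -> vector_field x W Y ->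
  smooth_on W (fun q => deriv x F q (Y q)).
Proof.
move=> oW sF [sY TY]; apply: smooth_on_local => // a.
have oWa : open (W `&` dom a) by apply: openI => //; exact: dom_open.
have WaW : W `&` dom a `<=` W by move=> q [].
have Wad : W `&` dom a `<=` dom a by move=> q [].
have VY : vector_field x (W `&` dom a) Y.
  by split; [exact: smooth_on_sub sY|move=> q [/TY]].
have [y0 [y1 [s0 s1 YE]]] := vector_field_frame oWa Wad VY.
have sD v : smooth_on (W `&` dom a) (fun q => deriv x F q (cfield x a v q)).
  by rewrite setIC; exact: smooth_on_D_cfield.
apply: (smooth_on_eq oWa _ (smooth_onD oWa (smooth_onZ oWa s0 (sD (dir false))) (smooth_onZ oWa
  s1 (sD (dir true))))).
by move=> q Wq; rewrite (YE q Wq) D_addr !D_scaler.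
Qed.

End Frame.

Section Gradient.
Context {R : realType} {M : surface R}.
Variables (x : M -> 'rV[R]_4) (hx : immersion x).
Implicit Types (p q : M) (W : set M) (h : M -> R^o).

(** The default value of [xget] in [grad] never occurs: Cramer's rule in a coordinate frame produces
    a vector with the required products. *)
Lemma gradP h p :
  (grad x (h : M -> R) p <= tangent x p)%MS /\
  forall X, (X <= tangent x p)%MS -> dot (grad x (h : M -> R) p) X = deriv x h p X.
Proof.
suff [T G] : (grad x (h : M -> R) p <= tangent x p)%MS /\
    forall X, (X <= tangent x p)%MS -> dot (grad x (h : M -> R) p) X = D x h p X.
  by split=> // X TX; rewrite derivE; exact: G.
rewrite /grad; apply: (@xgetPex _ 0 [set v : 'rV[R]_4 | (v <= tangent x p)%MS /\
    forall X : 'rV[R]_4, (X <= tangent x p)%MS -> dot v X = D x h p X]).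
have da := dom_chart_at p.
pose A := cfield x (chart_at p) (dir false) p; pose B := cfield x (chart_at p) (dir true) p.
have g0 : 0 < gram A B by exact: frame_gram.
pose d0 : R := deriv x h p A; pose d1 : R := deriv x h p B.
have TA : (A <= tangent x p)%MS by exact: tangent_cfield.
have TB : (B <= tangent x p)%MS by exact: tangent_cfield.
exists (dual_vec A B d0 d1); split; first by rewrite addmx_sub// scalemx_sub.
move=> X /(frame_tangent hx da)[s [r ->]].
by rewrite -derivE D_addr !D_scaler !dotDr !dotZr dot_dual_vec1// dot_dual_vec2.
Qed.

Lemma smooth_on_grad W h : open W -> smooth_on W h ->
  smooth_on W (grad x (h : M -> R)).
Proof.
move=> oW sh; apply: (smooth_on_local oW) => a.
have oWa : open (W `&` dom a) by apply: openI => //; exact: dom_open.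
have WaW : W `&` dom a `<=` W by move=> q [].
have Wad : W `&` dom a `<=` dom a by move=> q [].
have sD v : smooth_on (W `&` dom a) (fun q => deriv x h q (cfield x a v q)).
  by rewrite setIC; exact: smooth_on_D_cfield.
apply: (smooth_on_eq oWa _ (smooth_on_dual_vec hx oWa Wad (sD (dir false)) (sD (dir true)))).
move=> q [_ dq]; have [Tg gE] := gradP h q.
by apply/esym/dual_vec_frame => //; rewrite gE//; exact: tangent_cfield.
Qed.

End Gradient.

(** * Second fundamental form and Gauss equation *)

(** The second fundamental form [alpha], sealed like [deriv] to keep unification from unfolding
    it. *)
Fact sff_subproof {R : realType} {M : surface R} (x : M -> 'rV[R]_4) :
  {s : M -> 'rV[R]_4 -> 'rV[R]_4 -> 'rV[R]_4 | forall p X Y, s p X Y = alpha x p X Y}.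
Proof. by exists (alpha x). Qed.

Definition sff {R : realType} {M : surface R} (x : M -> 'rV[R]_4) :
  M -> 'rV[R]_4 -> 'rV[R]_4 -> 'rV[R]_4 := sval (sff_subproof x).

Lemma sff_alpha {R : realType} {M : surface R} (x : M -> 'rV[R]_4) p X Y :
  sff x p X Y = alpha x p X Y.
Proof. exact: (svalP (sff_subproof x)). Qed.

Lemma sffE {R : realType} {M : surface R} (x : M -> 'rV[R]_4) p X Y :
  sff x p X Y = npart x p (deriv x (fun q => tpart x q Y) p X).
Proof. by rewrite sff_alpha derivE. Qed.

Section SecondFundamentalForm.
Context {R : realType} {M : surface R}.
Implicit Types (p q : M) (a b : atlas M) (W : set M).
Variables (x : M -> 'rV[R]_4) (hx : immersion x).

(** Extends any vector tangent at a point to a field on the whole of [W]; this is the extension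
    built into [alpha]. *)
Lemma vector_field_tpart W v : open W -> vector_field x W (fun q => tpart x q v).
Proof.
move=> oW; split=> [|q _]; last exact: tpart_tangent.
by apply: smooth_on_tpart => //; exact: smooth_on_cst.
Qed.

Lemma normal_section_npart W v : open W -> normal_section x W (fun q => npart x q v).
Proof.
move=> oW; split=> [|q _]; last exact: npart_normal.
by apply: smooth_on_npart => //; exact: smooth_on_cst.
Qed.

Lemma D_normal_dot W u Z p X : open W -> W p -> normal_section x W u ->
  vector_field x W Z -> dot (deriv x u p X) (Z p) = - dot (u p) (deriv x Z p X).
Proof.
move=> oW Wp [su Nu] [sZ TZ].
have := D_dot x oW Wp X su sZ.
have E q : W q -> dot (u q) (Z q) = 0.
  by move=> Wq; rewrite dotC (dot_tangent_normal (TZ q Wq) (Nu q Wq)).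
rewrite (D_eq x oW Wp X (smooth_on_dot oW su sZ) (G := fun=> 0)) => [|q Wq]; last exact: E.
rewrite (D_cst x oW) => /eqP; rewrite eq_sym addrC addr_eq0 => /eqP.
exact.
Qed.

Lemma sff_normal p X Y : (sff x p X Y <= normal x p)%MS.
Proof. by rewrite sffE npart_normal. Qed.

(** Independence of the extension: for a normal section u one has D_X Z . u = - Z . D_X u, and the
    right-hand side depends only on the value of [Z] at [p]. *)
Lemma sff_field W Z p X : open W -> W p -> vector_field x W Z ->
  npart x p (deriv x Z p X) = sff x p X (Z p).
Proof.
move=> oW Wp VZ; rewrite sffE; apply: normal_eq (npart_normal _ _ _) (npart_normal _ _ _) _ => n Nn.
have Vt := vector_field_tpart (Z p) oW; have Vn := normal_section_npart n oW.
have /eqP := D_normal_dot X oW Wp Vn VZ; have := D_normal_dot X oW Wp Vn Vt.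
rewrite (npart_id Nn) (tpart_id (VZ.2 p Wp)) => ->; rewrite eqr_opp => /eqP E.
by rewrite !dot_npart// (dotC _ n) (dotC _ n) -E.
Qed.

(** The Weingarten equation, from differentiating the vanishing product of [u] with a tangent
    extension of [Y]. *)
Lemma shape W u p X Y : open W -> W p -> normal_section x W u ->
  (Y <= tangent x p)%MS -> dot (deriv x u p X) Y = - dot (u p) (sff x p X Y).
Proof.
move=> oW Wp Nu TY; have := D_normal_dot X oW Wp Nu (vector_field_tpart Y oW).
rewrite (tpart_id TY) => ->; rewrite sffE [in RHS]dotC dot_npart; first by rewrite dotC.
exact: (Nu.2 p Wp).
Qed.

Lemma sff_cfield a p v w : dom a p ->
  sff x p (cfield x a v p) (cfield x a w p) =
  npart x p (deriv x (cfield x a w) p (cfield x a v p)).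
Proof.
move=> da; rewrite (sff_field (W := dom a))//; first exact: dom_open.
by split=> [|q dq]; [exact: smooth_on_cfield|exact: tangent_cfield].
Qed.

(** Coordinate fields are themselves derivatives of the immersion, so both sides are second
    derivatives of [x]. *)
Lemma D_cfield_sym a p v w : dom a p ->
  deriv x (cfield x a w) p (cfield x a v p) = deriv x (cfield x a v) p (cfield x a w p).
Proof.
move=> da.
have E v' w' : deriv x (cfield x a w') p (cfield x a v' p) =
   deriv x (fun q => deriv x x q (cfield x a w' q)) p (cfield x a v' p).
  apply: (@D_eq R M x (dom a)) => //; [exact: dom_open|exact: smooth_on_cfield|].
  by move=> q dq; rewrite D_x//; exact: tangent_cfield.
have oT : open [set: M] by exact: openT.
by rewrite (E v) (E w) (D_cfieldC hx _ _ oT (smooth_immersion hx)).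
Qed.

Lemma sffC p X Y : (X <= tangent x p)%MS -> (Y <= tangent x p)%MS ->
  sff x p X Y = sff x p Y X.
Proof.
have da := dom_chart_at p.
move=> /(tangentP hx _ da)[v ->] /(tangentP hx _ da)[w ->].
by rewrite !sff_cfield// D_cfield_sym.
Qed.

Lemma sffDl p (X X' Y : 'rV[R]_4) : sff x p (X + X') Y = sff x p X Y + sff x p X' Y.
Proof. by rewrite !sffE D_addr npartD. Qed.

Lemma sffZl p s (X Y : 'rV[R]_4) : sff x p (s *: X) Y = s *: sff x p X Y.
Proof. by rewrite !sffE D_scaler npartZ. Qed.

Lemma sffDr p (X Y Y' : 'rV[R]_4) : sff x p X (Y + Y') = sff x p X Y + sff x p X Y'.
Proof.
have oT : open [set: M] by exact: openT.
have sT v : smooth_on setT (fun q => tpart x q v) by apply: (vector_field_tpart v oT).1.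
rewrite !sffE -npartD -(D_add x oT _ X (sT Y) (sT Y'))//; congr (npart _ _ (deriv _ _ _ _)).
by apply/funext => q; rewrite tpartD.
Qed.

Lemma sffZr p s (X Y : 'rV[R]_4) : sff x p X (s *: Y) = s *: sff x p X Y.
Proof.
have oT : open [set: M] by exact: openT.
have sT v : smooth_on setT (fun q => tpart x q v) by apply: (vector_field_tpart v oT).1.
have sS : smooth_on [set: M] (fun=> s : R^o) by exact: smooth_on_cst.
have := D_scale x oT (I : setT p) X sS (sT Y).
rewrite (D_cst x oT) // scale0r addr0 !sffE -npartZ => <-.
by congr (npart _ _ (deriv _ _ _ _)); apply/funext => q; rewrite tpartZ.
Qed.

Lemma nablaTE (Y : M -> 'rV[R]_4) p X : nablaT x Y p X = tpart x p (deriv x Y p X).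
Proof. by rewrite /nablaT derivE. Qed.

Lemma nablaNE (u : M -> 'rV[R]_4) p X : nablaN x u p X = npart x p (deriv x u p X).
Proof. by rewrite /nablaN derivE. Qed.

Lemma bracketE X Y p : bracket x X Y p = deriv x Y p (X p) - deriv x X p (Y p).
Proof. by rewrite /bracket !derivE. Qed.

Lemma curvatureE X Y Z p : curvature x X Y Z p =
  tpart x p (deriv x (fun q => tpart x q (deriv x Z q (Y q))) p (X p)) -
  tpart x p (deriv x (fun q => tpart x q (deriv x Z q (X q))) p (Y p)) -
  tpart x p (deriv x Z p (bracket x X Y p)).
Proof.
rewrite /curvature !nablaTE.
have E Y' : (fun q => nablaT x Z q (Y' q)) = (fun q => tpart x q (deriv x Z q (Y' q))).
  by apply/funext => q; rewrite nablaTE.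
by rewrite (E X) (E Y).
Qed.

(** Both fields are expanded in a coordinate frame. The second derivatives of [F] cancel because
    coordinate fields commute, and only derivatives of the coefficients survive. *)
Lemma D_commutator (F : M -> 'rV[R]_4) X Y p : smooth_on setT F ->
  vector_field x setT X -> vector_field x setT Y ->
  deriv x (fun q => deriv x F q (Y q)) p (X p) - deriv x (fun q => deriv x F q (X q)) p (Y p) =
  deriv x F p (bracket x X Y p).
Proof.
move=> sF VX VY; set a := chart_at p; have da : dom a p := dom_chart_at p.
have oa : open (dom a) by exact: dom_open.
pose A := cfield x a (dir false); pose B := cfield x a (dir true).
have loc Z : vector_field x setT Z -> vector_field x (dom a) Z.
  by move=> [sZ TZ]; split=> [|q _]; [exact: smooth_on_sub sZ|exact: TZ].
have [x0 [x1 [sx0 sx1 XE]]] := vector_field_frame hx oa (@subset_refl _ _) (loc _ VX).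
have [y0 [y1 [sy0 sy1 YE]]] := vector_field_frame hx oa (@subset_refl _ _) (loc _ VY).
have key (G : M -> 'rV[R]_4) : smooth_on setT G ->
  deriv x (fun q => deriv x G q (Y q)) p (X p) - deriv x (fun q => deriv x G q (X q)) p (Y p) =
  (deriv x y0 p (X p) - deriv x x0 p (Y p)) *: deriv x G p (A p) +
  (deriv x y1 p (X p) - deriv x x1 p (Y p)) *: deriv x G p (B p).
  move=> sG.
  have sD v : smooth_on (dom a) (fun q => deriv x G q (cfield x a v q)).
    by have := smooth_on_D_cfield hx a v openT sG; rewrite setIT.
  have expand (Z : M -> 'rV[R]_4) (z0 z1 : M -> R^o) V : vector_field x setT Z ->
      smooth_on (dom a) z0 -> smooth_on (dom a) z1 ->
      (forall q, dom a q -> Z q = z0 q *: A q + z1 q *: B q) ->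
      deriv x (fun q => deriv x G q (Z q)) p V =
      (z0 p *: deriv x (fun q => deriv x G q (A q)) p V + deriv x z0 p V *: deriv x G p (A p)) +
      (z1 p *: deriv x (fun q => deriv x G q (B q)) p V + deriv x z1 p V *: deriv x G p (B p)).
    move=> VZ s0 s1 ZE.
    rewrite -(D_scale x oa da _ s0 (sD _)) -(D_scale x oa da _ s1 (sD _)).
    rewrite -(D_add x oa da _ (smooth_onZ oa s0 (sD _)) (smooth_onZ oa s1 (sD _))).
    apply: (D_eq x oa da); last by move=> q dq; rewrite ZE// D_addr !D_scaler.
    by apply: smooth_on_sub (smooth_on_D_field hx openT sG VZ).
  rewrite (expand Y y0 y1)// (expand X x0 x1)//.
  have comm := D_cfieldC hx (dir false) (dir true) openT sG I da.
  rewrite -/A -/B in comm.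
  rewrite (XE p da) (YE p da) !D_addr !D_scaler comm.
  by apply/rowP => i; rewrite !mxE; ring.
have Dxx Z : vector_field x setT Z -> (fun q => deriv x x q (Z q)) = Z.
  by move=> [_ TZ]; apply/funext => q; rewrite D_x//; exact: TZ.
(* For the immersion itself the derivative along X is X, so [key] identifies the surviving
   combination of coordinate fields with the bracket. *)
have := key x (smooth_immersion hx).
rewrite !Dxx// !D_x//; try exact: tangent_cfield.
rewrite bracketE => ->.
by rewrite D_addr !D_scaler key.
Qed.

(** Dropping the inner projection in a second covariant derivative costs the derivative of a normal
    section, which the Weingarten equation turns into a product of two values of alpha. The
    unprojected second derivatives cancel against the bracket term by [D_commutator]. *)
Lemma gauss X Y Z p V : vector_field x setT X -> vector_field x setT Y ->
  vector_field x setT Z -> (V <= tangent x p)%MS ->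
  dot (curvature x X Y Z p) V =
  dot (sff x p (Y p) (Z p)) (sff x p (X p) V) -
  dot (sff x p (X p) (Z p)) (sff x p (Y p) V).
Proof.
move=> VX VY VZ TV; have oT : open [set: M] by exact: openT.
have half Y' X' : vector_field x setT Y' ->
  dot (tpart x p (deriv x (fun q => tpart x q (deriv x Z q (Y' q))) p X')) V =
  dot (deriv x (fun q => deriv x Z q (Y' q)) p X') V +
  dot (sff x p (Y' p) (Z p)) (sff x p X' V).
  move=> VY'; have sD := smooth_on_D_field hx oT VZ.1 VY'.
  rewrite dot_tpart//.
  have E : deriv x (fun q => tpart x q (deriv x Z q (Y' q))) p X' =
      deriv x (fun q => deriv x Z q (Y' q)) p X' - deriv x (fun q => npart x q (deriv x Z q (Y'
        q))) p X'.
    rewrite -(D_sub x oT _ _ sD (smooth_on_npart hx oT sD))//; congr (deriv _ _ _ _).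
    by apply/funext => q; rewrite npartE opprB addrC subrK.
  have NN : normal_section x setT (fun q => npart x q (deriv x Z q (Y' q))).
    by split=> [|q _]; [exact: (smooth_on_npart hx oT sD)|exact: npart_normal].
  rewrite E dotDl dotNl (shape X' oT I NN TV) opprK.
  by rewrite (sff_field _ oT I VZ).
rewrite curvatureE !dotDl !dotNl !half// dot_tpart//.
rewrite -D_commutator//; last exact: VZ.1.
by rewrite dotDl dotNl; ring.
Qed.

(** Vanishing of the curvature tensor at one point, as the Gauss equation expresses it through
    alpha. *)
Definition gauss_flat p := forall X Y Z V, (X <= tangent x p)%MS ->
  (Y <= tangent x p)%MS -> (Z <= tangent x p)%MS -> (V <= tangent x p)%MS ->
  dot (sff x p Y Z) (sff x p X V) = dot (sff x p X Z) (sff x p Y V).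

Lemma flatP : flat x <-> forall p, gauss_flat p.
Proof.
have oT : open [set: M] by exact: openT.
split=> [fx p X Y Z V TX TY TZ TV|gf X Y Z VX VY VZ p].
  have Vt v := vector_field_tpart v oT.
  have := gauss (Vt X) (Vt Y) (Vt Z) TV.
  rewrite fx// dot0l !tpart_id// => /eqP; rewrite eq_sym subr_eq0 => /eqP.
  exact.
have TC : (curvature x X Y Z p <= tangent x p)%MS.
  by rewrite curvatureE !addmx_sub// ?eqmx_opp; exact: tpart_tangent.
apply: (tangent_eq TC); first exact: sub0mx.
move=> V TV; rewrite (gauss VX VY VZ TV) dot0l.
by rewrite (gf p) ?subrr//; [apply: VX.2|apply: VY.2|apply: VZ.2].
Qed.

End SecondFundamentalForm.

(** * Orthogonal bases of R^4 *)

Section OrthonormalBasis.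
Context {R : realType}.
Implicit Types (v : 'rV[R]_4).

(** For the square matrix Q with rows [q i], orthonormality says that Q Q^T is the identity; then
    Q^T Q is too, which is the expansion. *)
Lemma orthonormal_basis (q : 'I_4 -> 'rV[R]_4) :
  (forall i k, dot (q i) (q k) = (i == k)%:R) ->
  forall v, v = \sum_i dot v (q i) *: q i.
Proof.
move=> orth v; pose Q := \matrix_i q i.
have Q1 : Q *m Q^T = 1%:M.
  apply/matrixP => i k; rewrite [RHS]mxE -orth dotE mxE.
  by apply: eq_bigr => l _; rewrite !mxE.
rewrite -{1}[v]mulmx1 -(mulmx1C Q1) mulmxA mulmx_sum_row.
apply: eq_bigr => i _; rewrite rowK; congr (_ *: _).
by rewrite mxE dotE; apply: eq_bigr => l _; rewrite !mxE.
Qed.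

(** Normalizing [a1] and [a2] gives an orthonormal quadruple; each inverse square root occurs twice
    and leaves a rational coefficient. *)
Lemma orthogonal_expansion (E1 E2 a1 a2 : 'rV[R]_4) :
  dot E1 E1 = 1 -> dot E2 E2 = 1 -> dot E1 E2 = 0 ->
  dot E1 a1 = 0 -> dot E1 a2 = 0 -> dot E2 a1 = 0 -> dot E2 a2 = 0 ->
  dot a1 a2 = 0 -> a1 != 0 -> a2 != 0 ->
  forall v, v = dot v E1 *: E1 + dot v E2 *: E2 +
    ((dot v a1 / dot a1 a1) *: a1 + (dot v a2 / dot a2 a2) *: a2).
Proof.
move=> E11 E22 E12 E1a1 E1a2 E2a1 E2a2 a12 a10 a20 v.
have n1 : 0 < dot a1 a1 by rewrite dot_gt0.
have n2 : 0 < dot a2 a2 by rewrite dot_gt0.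
pose s1 := Num.sqrt (dot a1 a1); pose s2 := Num.sqrt (dot a2 a2).
have s1s1 : s1^-1 * s1^-1 = (dot a1 a1)^-1.
  by rewrite -invfM -expr2 sqr_sqrtr// ltW.
have s2s2 : s2^-1 * s2^-1 = (dot a2 a2)^-1.
  by rewrite -invfM -expr2 sqr_sqrtr// ltW.
pose q (i : 'I_4) := nth 0 [:: E1; E2; s1^-1 *: a1; s2^-1 *: a2] i.
have orth i k : dot (q i) (q k) = (i == k)%:R.
  have u1 : s1^-1 * (s1^-1 * dot a1 a1) = 1 by rewrite mulrA s1s1 mulVf// gt_eqF.
  have u2 : s2^-1 * (s2^-1 * dot a2 a2) = 1 by rewrite mulrA s2s2 mulVf// gt_eqF.
  case: i => [[|[|[|[|//]]]] ?]; case: k => [[|[|[|[|//]]]] ?]; rewrite /q /= ?dotZl ?dotZr;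
    rewrite ?E11 ?E22 ?E12 ?(dotC E2 E1) ?E12 ?(dotC a1 E1) ?(dotC a1 E2) ?(dotC a2 E1)
      ?(dotC a2 E2) ?(dotC a2 a1) ?E1a1 ?E1a2 ?E2a1 ?E2a2 ?a12 ?mulr0 ?u1 ?u2//.
rewrite [LHS](orthonormal_basis orth) !big_ord_recl big_ord0 addr0 /q /=.
have e1 : s1^-1 * dot v a1 * s1^-1 = dot v a1 / dot a1 a1 by rewrite -s1s1; ring.
have e2 : s2^-1 * dot v a2 * s2^-1 = dot v a2 / dot a2 a2 by rewrite -s2s2; ring.
by rewrite !dotZr !scalerA e1 e2 !addrA.
Qed.

End OrthonormalBasis.

(** * Principal frames and the shape of the curvature ellipse *)

Section Principal.
Context {R : realType} {M : surface R}.
Implicit Types (p q : M).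
Variables (x : M -> 'rV[R]_4) (hx : immersion x).

(* The curvature ellipse is the segment from [alpha(E1,E1)] to [alpha(E2,E2)]. *)
Record principal p (E1 E2 : 'rV[R]_4) : Prop := Principal {
  prin_T1 : (E1 <= tangent x p)%MS;
  prin_T2 : (E2 <= tangent x p)%MS;
  prin_11 : dot E1 E1 = 1;
  prin_22 : dot E2 E2 = 1;
  prin_12 : dot E1 E2 = 0;
  prin_sff : sff x p E1 E2 = 0;
  prin_orth : dot (sff x p E1 E1) (sff x p E2 E2) = 0;
  prin_n1 : sff x p E1 E1 != 0;
  prin_n2 : sff x p E2 E2 != 0 }.

Section Expansion.
Variables (p : M) (E1 E2 : 'rV[R]_4) (pE : principal p E1 E2).
Local Notation a1 := (sff x p E1 E1).
Local Notation a2 := (sff x p E2 E2).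

Lemma principal_expansion v : v = dot v E1 *: E1 + dot v E2 *: E2 +
  ((dot v a1 / dot a1 a1) *: a1 + (dot v a2 / dot a2 a2) *: a2).
Proof.
have [T1 T2 u1 u2 o s an n1 n2] := pE.
have N1 := sff_normal x p E1 E1; have N2 := sff_normal x p E2 E2.
exact: (orthogonal_expansion u1 u2 o (dot_tangent_normal T1 N1)
  (dot_tangent_normal T1 N2) (dot_tangent_normal T2 N1) (dot_tangent_normal T2 N2) an n1 n2).
Qed.

Lemma principal_tangent X : (X <= tangent x p)%MS ->
  X = dot X E1 *: E1 + dot X E2 *: E2.
Proof.
move=> TX; rewrite {1}(principal_expansion X).
by rewrite !(dot_tangent_normal TX (sff_normal _ _ _ _)) !mul0r !scale0r !addr0.
Qed.

Lemma principal_normal n : (n <= normal x p)%MS ->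
  n = (dot n a1 / dot a1 a1) *: a1 + (dot n a2 / dot a2 a2) *: a2.
Proof.
move=> Nn; rewrite {1}(principal_expansion n) !(dotC n E1) !(dotC n E2).
rewrite (dot_tangent_normal (prin_T1 pE) Nn) (dot_tangent_normal (prin_T2 pE) Nn).
by rewrite !scale0r !add0r.
Qed.

Lemma principal_sff X Y : (X <= tangent x p)%MS -> (Y <= tangent x p)%MS ->
  sff x p X Y = (dot X E1 * dot Y E1) *: a1 + (dot X E2 * dot Y E2) *: a2.
Proof.
move=> TX TY; have [T1 T2 _ _ _ s _ _ _] := pE.
rewrite {1}(principal_tangent TX) {1}(principal_tangent TY).
rewrite !(sffDl x) !(sffDr hx) !(sffZl x) !(sffZr hx) (sffC hx T2 T1) s.
by rewrite !scaler0 addr0 add0r !scalerA.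
Qed.

(** By orthogonality of the two values, alpha(Y,Z) . alpha(X,V) is a sum over i of |ai|^2 times the
    product of the i-th coordinates of the four vectors, hence totally symmetric. *)
Lemma principal_gauss_flat : gauss_flat x p.
Proof.
move=> X Y Z V TX TY TZ TV; have [_ _ _ _ _ _ o _ _] := pE.
rewrite (principal_sff TY TZ) (principal_sff TX TV) (principal_sff TX TZ) (principal_sff TY TV).
move: a1 a2 o => A1 A2 o; rewrite !dot_lin (dotC A2 A1) o; ring.
Qed.

Lemma principal_semiumbilic : semiumbilic x p.
Proof.
have [T1 T2 u1 u2 o _ an n1 n2] := pE.
exists a1, (a2 - a1); split.
- exact: sff_normal.
- by rewrite addmx_sub ?eqmx_opp ?sff_normal.
- apply/eqP => /subr0_eq a21; move/eqP: an; rewrite a21 dot_eq0.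
  by rewrite (negPf n1).
- move=> _ [v [Tv v0] <-]; rewrite -sff_alpha.
  have vv : dot v v = dot v E1 ^+ 2 + dot v E2 ^+ 2.
    rewrite {1 2}(principal_tangent Tv) !dot_lin u1 u2 (dotC E2 E1) o; ring.
  have vv0 : dot v v != 0 by rewrite dot_eq0.
  (* The normalized value of alpha is a convex combination of a1 and a2; the parameter is the weight
     of a2. *)
  exists (dot v E2 ^+ 2 / dot v v) => //.
  rewrite (principal_sff Tv Tv); move: vv0; rewrite vv => vv0.
  move: a1 a2 => A1 A2; apply/rowP => i; rewrite !mxE; field; exact: vv0.
Qed.

(** On a line through the origin, a1 and a2 would be multiples of one vector, which is impossible
    for nonzero orthogonal vectors. *)
Lemma principal_not_inflection : ~ inflection x p.
Proof.
have [T1 T2 u1 u2 o _ an n1 n2] := pE.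
move=> [d [_ d0 sub]].
have unit_nz E : dot E E = 1 -> E != 0.
  by move=> EE; rewrite -dot_eq0 EE oner_eq0.
have on E : (E <= tangent x p)%MS -> dot E E = 1 -> exists s, sff x p E E = s *: d.
  move=> TE EE; have [|s _] := sub (sff x p E E).
    by exists E; [split=> //; exact: unit_nz|rewrite EE invr1 scale1r sff_alpha].
  by rewrite add0r => <-; exists s.
have [s1 E1s] := on _ T1 u1; have [s2 E2s] := on _ T2 u2.
move: an n1 n2; rewrite E1s E2s !dot_lin => /eqP; rewrite !mulf_eq0 dot_eq0 (negPf d0) orbF.
by case/orP => /eqP ->; rewrite scale0r eqxx.
Qed.

End Expansion.

(** For orthogonal tangent vectors the affine line forces alpha(A,B) to be a multiple of its
    direction [d]. On a rotated orthogonal pair that multiple is a quadratic form in the rotation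
    parameters, and it has a nontrivial zero. *)
Lemma semiumbilic_orthogonal_frame p : semiumbilic x p ->
  exists E1 E2 : 'rV[R]_4, [/\ (E1 <= tangent x p)%MS, (E2 <= tangent x p)%MS,
    dot E1 E2 = 0, sff x p E1 E2 = 0 & 0 < dot E1 E1 /\ 0 < dot E2 E2].
Proof.
move=> [a0 [d [_ _ _ sub]]].
have da := dom_chart_at p.
set A := cfield x (chart_at p) (dir false) p; set B0 := cfield x (chart_at p) (dir true) p.
have g0 : 0 < gram A B0 by exact: frame_gram.
have TA : (A <= tangent x p)%MS by exact: tangent_cfield.
have TB0 : (B0 <= tangent x p)%MS by exact: tangent_cfield.
move: A B0 TA TB0 g0 => {da} A B0 TA TB0 g0.
have a_gt0 : 0 < dot A A.
  rewrite dot_gt0; apply/eqP => A0; move: g0.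
  by rewrite A0 /gram !dot0l mul0r expr0n subr0 ltxx.
(* Gram-Schmidt without division. *)
pose B := dot A A *: B0 - dot A B0 *: A.
have TB : (B <= tangent x p)%MS by rewrite addmx_sub ?eqmx_opp ?scalemx_sub.
have AB : dot A B = 0 by rewrite /B !dot_lin; ring.
have b_gt0 : 0 < dot B B.
  have -> : dot B B = dot A A * gram A B0.
    by rewrite /B /gram !dot_lin (dotC B0 A); ring.
  exact: mulr_gt0.
move: B TB AB b_gt0 => {TB0 g0 B0} B TB AB b_gt0.
set a := dot A A in a_gt0; set b := dot B B in b_gt0.
have onl v : (v <= tangent x p)%MS -> 0 < dot v v ->
    exists s, sff x p v v = dot v v *: (a0 + s *: d).
  move=> Tv v0; have [|s _ sE] := sub ((dot v v)^-1 *: sff x p v v).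
    by exists v; [split=> //; rewrite -dot_gt0|rewrite sff_alpha].
  by exists s; rewrite sE scalerA mulfV ?scale1r// gt_eqF.
have [s1 S1] := onl A TA a_gt0; have [s2 S2] := onl B TB b_gt0.
have AB2 : dot (A + B) (A + B) = a + b by rewrite !dot_lin (dotC B A) AB /a /b; ring.
have [||s3 S3] := onl (A + B); [exact: addmx_sub|by rewrite AB2 addr_gt0|].
rewrite AB2 !(sffDl x) !(sffDr hx) (sffC hx TB TA) S1 S2 -/a -/b in S3.
(* Polarization of alpha(A+B, A+B): since |A+B|^2 = a + b, the contributions of [a0] cancel and only
   a multiple of [d] remains. *)
pose m := ((a + b) * s3 - a * s1 - b * s2) / 2.
have Sm : sff x p A B = m *: d.
  apply/rowP => i; move/rowP/(_ i): S3; rewrite !mxE => S3; rewrite /m.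
  by lra.
(* The vectors sA + rB and -rbA + saB are orthogonal, and alpha of the pair is ((s^2 a - r^2 b) m -
   s r k) d, where [a0] has cancelled again. The condition below makes this vanish with sA + rB
   nonzero. *)
pose k := a * b * (s1 - s2).
have [s [r [sr sr0]]] : exists s r : R, (s ^+ 2 * a - r ^+ 2 * b) * m - s * r * k = 0 /\
    0 < s ^+ 2 * a + r ^+ 2 * b.
  have [m0|m0] := eqVneq m 0.
    by exists 1, 0; rewrite m0; split; rewrite ?mulr0 ?mul0r ?subr0// expr1n mul1r expr0n mul0r
      addr0.
  have D0 : 0 <= k ^+ 2 + 4 * (a * b) * m ^+ 2.
    by rewrite addr_ge0 ?sqr_ge0// mulr_ge0 ?sqr_ge0// !mulr_ge0// ltW.
  (* With r = 1 the condition reads a m s^2 - k s - b m = 0; its discriminant is nonnegative because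
     a and b are positive. *)
  exists ((k + Num.sqrt (k ^+ 2 + 4 * (a * b) * m ^+ 2)) / (2 * a * m)), 1; split; last first.
    by rewrite expr1n mul1r ltr_wpDl// mulr_ge0 ?sqr_ge0// ltW.
  have := sqr_sqrtr D0; set w := Num.sqrt _ => ww.
  have an0 : a != 0 by rewrite gt_eqF.
  have : w ^+ 2 - (k ^+ 2 + 4 * (a * b) * m ^+ 2) = 0 by rewrite ww subrr.
  move=> wE; transitivity ((w ^+ 2 - (k ^+ 2 + 4 * (a * b) * m ^+ 2)) / (4 * a * m)).
    by field; rewrite an0 m0.
  by rewrite wE mul0r.
exists (s *: A + r *: B), (- (r * b) *: A + (s * a) *: B); split.
- by rewrite addmx_sub ?scalemx_sub.
- by rewrite addmx_sub ?scalemx_sub.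
- by rewrite !dot_lin (dotC B A) AB -/a -/b; ring.
- rewrite !(sffDl x) !(sffDr hx) !(sffZl x) !(sffZr hx) (sffC hx TB TA) S1 S2 Sm -/a -/b.
  apply/rowP => i; rewrite !mxE.
  transitivity (((s ^+ 2 * a - r ^+ 2 * b) * m - s * r * k) * d 0 i); last by rewrite sr mul0r.
  by rewrite /k; ring.
- rewrite !dot_lin (dotC B A) AB -/a -/b; split.
    by rewrite [X in 0 < X](_ : _ = s ^+ 2 * a + r ^+ 2 * b); last by ring.
  rewrite [X in 0 < X](_ : _ = (a * b) * (s ^+ 2 * a + r ^+ 2 * b)); last by ring.
  by rewrite !mulr_gt0.
Qed.

Lemma principal_exists p c : semiumbilic x p -> gauss_flat x p ->
  (forall X Y, (X <= tangent x p)%MS -> (Y <= tangent x p)%MS ->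
    dot c (sff x p X Y) = dot X Y) ->
  exists E1 E2, principal p E1 E2.
Proof.
move=> /semiumbilic_orthogonal_frame[E1 [E2 [T1 T2 o s [n1 n2]]]] gf cE.
pose r1 := (Num.sqrt (dot E1 E1))^-1; pose r2 := (Num.sqrt (dot E2 E2))^-1.
have u1 : r1 * (r1 * dot E1 E1) = 1.
  by rewrite mulrA -invfM -expr2 sqr_sqrtr ?mulVf ?gt_eqF ?ltW.
have u2 : r2 * (r2 * dot E2 E2) = 1.
  by rewrite mulrA -invfM -expr2 sqr_sqrtr ?mulVf ?gt_eqF ?ltW.
have T1' : (r1 *: E1 <= tangent x p)%MS by exact: scalemx_sub.
have T2' : (r2 *: E2 <= tangent x p)%MS by exact: scalemx_sub.
have s' : sff x p (r1 *: E1) (r2 *: E2) = 0.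
  by rewrite (sffZl x) (sffZr hx) s !scaler0.
(* If alpha(E,E) were zero, its product with [c] could not be the squared length 1 of E. *)
have nz E : (E <= tangent x p)%MS -> dot E E = 1 -> sff x p E E != 0.
  move=> TE EE; apply/eqP => S0; have := cE _ _ TE TE.
  by rewrite S0 dot0r EE => /eqP; rewrite eq_sym oner_eq0.
have d1 : dot (r1 *: E1) (r1 *: E1) = 1 by rewrite dotZl dotZr.
have d2 : dot (r2 *: E2) (r2 *: E2) = 1 by rewrite dotZl dotZr.
exists (r1 *: E1), (r2 *: E2); split=> //; try exact: nz.
  by rewrite dotZl dotZr o !mulr0.
(* Gauss on this pair says that the product of the two diagonal values of alpha is the squared
   length of the mixed one. *)
by rewrite (gf _ _ _ _ T2' T1' T1' T2') (sffC hx T2' T1') s' dot0l.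
Qed.

End Principal.

(** * The dual surface *)

Section DualSurface.
Context {R : realType} {M : surface R}.
Implicit Types (p q : M) (a : atlas M) (W V : set M).
Variables (x : M -> 'rV[R]_4) (hx : immersion x).
Hypothesis x_semi : forall p, semiumbilic x p.
Hypothesis x_flat : forall p, gauss_flat x p.
Variable c : M -> 'rV[R]_4.
Hypothesis c_normal : normal_section x setT c.
Hypothesis c_metric : forall p X Y, (X <= tangent x p)%MS -> (Y <= tangent x p)%MS ->
  dot (c p) (sff x p X Y) = dot X Y.
Variable e : M -> 'rV[R]_4.
Hypothesis e_field : vector_field x setT e.
Hypothesis e_nabla : forall p X, (X <= tangent x p)%MS -> tpart x p (deriv x e p X) = X.
Variable j : M -> 'rV[R]_4.
Hypothesis j_field : vector_field x setT j.
Hypothesis j_grad : forall p X, (X <= tangent x p)%MS ->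
  dot (j p) X = dot (c p) (deriv x c p X).
Variables (t : R) (f : M -> 'rV[R]_4).
Hypothesis fE : forall p, f p = x p + t *: c p - (1 - t) *: e p.

Let oT : open [set: M]. Proof. exact: openT. Qed.

Lemma deriv_e p X : (X <= tangent x p)%MS -> deriv x e p X = X + sff x p X (e p).
Proof.
move=> TX; rewrite -(tpart_npart x p (deriv x e p X)) e_nabla//.
by rewrite (sff_field hx X oT I e_field).
Qed.

Lemma tpart_deriv_c p X : (X <= tangent x p)%MS -> tpart x p (deriv x c p X) = - X.
Proof.
move=> TX; apply: (tangent_eq (tpart_tangent _ _ _)); first by rewrite eqmx_opp.
move=> Y TY; rewrite dot_tpart// (shape hx X oT I c_normal TY) dotNl.
by rewrite c_metric.
Qed.

Lemma deriv_c p X : (X <= tangent x p)%MS ->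
  deriv x c p X = npart x p (deriv x c p X) - X.
Proof. by move=> TX; rewrite npartE tpart_deriv_c// opprK addrK. Qed.

(* Differentiating [c . alpha = g] once more: by the Codazzi equation the
   trilinear form [nabla^bot_Y c . alpha(Z, U)] is totally symmetric. *)
Lemma cubic_sym p (Y Z U : 'rV[R]_4) : (Y <= tangent x p)%MS -> (Z <= tangent x p)%MS ->
  (U <= tangent x p)%MS ->
  dot (npart x p (deriv x c p Y)) (sff x p Z U) =
  dot (npart x p (deriv x c p Z)) (sff x p Y U).
Proof.
have da := dom_chart_at p; set a := chart_at p in da.
have oa : open (dom a) by exact: dom_open.
move=> /(tangentP hx _ da)[u ->] /(tangentP hx _ da)[v ->] /(tangentP hx _ da)[w ->].
(* Second derivatives of the immersion along coordinate fields. The normal part of [S v w] is alpha;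
   the normal vector [c] does not see the tangent part. *)
pose S v w q := deriv x (cfield x a w) q (cfield x a v q).
have sE w' : smooth_on (dom a) (cfield x a w') by exact: smooth_on_cfield.
have sS v' w' : smooth_on (dom a) (S v' w').
  by have := smooth_on_D_cfield hx a v' oa (sE w'); rewrite setIid.
have sc : smooth_on (dom a) c by exact: smooth_on_sub c_normal.1.
have TE v' q : dom a q -> (cfield x a v' q <= tangent x q)%MS.
  by move=> dq; exact: tangent_cfield.
have cS v' w' q : dom a q -> dot (c q) (S v' w' q) = dot (cfield x a v' q) (cfield x a w' q).
  move=> dq; rewrite -(c_metric (TE v' q dq) (TE w' q dq)).
  rewrite (sff_cfield hx _ _ dq) [in RHS]dotC dot_npart 1?dotC//.
  exact: c_normal.2.
have expand u' v' : dot (npart x p (deriv x c p (cfield x a u' p)))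
      (sff x p (cfield x a v' p) (cfield x a w p)) =
    dot (cfield x a u' p) (S v' w p) - dot (c p) (deriv x (S v' w) p (cfield x a u' p)) +
    (dot (cfield x a v' p) (S u' w p) + dot (S u' v' p) (cfield x a w p)).
  rewrite (sff_cfield hx _ _ da) -/(S v' w p).
  have Nc := npart_normal x p (deriv x c p (cfield x a u' p)).
  rewrite [LHS]dotC (dot_npart _ Nc) dotC.
  have -> : npart x p (deriv x c p (cfield x a u' p)) =
      deriv x c p (cfield x a u' p) + cfield x a u' p.
    by rewrite {2}deriv_c ?subrK//; exact: TE.
  have D1 := D_dot x oa da (cfield x a u' p) sc (sS v' w).
  have D2 := D_dot x oa da (cfield x a u' p) (sE v') (sE w).
  have := D_eq x oa da (cfield x a u' p) (smooth_on_dot oa sc (sS v' w)) (cS v' w).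
  rewrite D1 D2 -/(S u' w p) -/(S u' v' p) dotDl => E.
  have alg (k1 k2 k3 k4 k5 : R) : k2 + k1 = k4 + k5 -> k1 + k3 = k3 - k2 + (k4 + k5).
    by move=> <-; ring.
  exact: alg E.
rewrite !expand.
(* The Codazzi equation in coordinates: third derivatives of the immersion are symmetric. *)
have comm : deriv x (S v w) p (cfield x a u p) = deriv x (S u w) p (cfield x a v p).
  exact: (D_cfieldC hx v u oa (sE w) da da).
have sym : S u v p = S v u p by exact: D_cfield_sym.
rewrite comm sym.
move: (dot (c p) _) (dot (S v u p) _) (dot (cfield x a u p) _) (dot (cfield x a v p) _).
move=> k1 k2 k3 k4; ring.
Qed.

Lemma principal_frame p : exists E1 E2, principal x p E1 E2.
Proof. exact: (principal_exists hx (@x_semi p) (@x_flat p) (@c_metric p)). Qed.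

(** Write beta(Y) for the normal derivative of [c]. Cubic symmetry and alpha(E1,E2) = 0 make
    beta(E1) orthogonal to a2 and beta(E2) orthogonal to a1, so beta(Ei) is a multiple of ai. Since
    c . ai = 1, the factor is c . beta(Ei) = j . Ei. *)
Lemma sff_j p Y : (Y <= tangent x p)%MS ->
  npart x p (deriv x c p Y) = sff x p (j p) Y.
Proof.
have [E1 [E2 pE]] := principal_frame p.
have [T1 T2 u1 u2 o s an n1 n2] := pE.
set a1 := sff x p E1 E1 in an n1; set a2 := sff x p E2 E2 in an n2.
have N1 : (a1 <= normal x p)%MS by exact: sff_normal.
have N2 : (a2 <= normal x p)%MS by exact: sff_normal.
have Tj : (j p <= tangent x p)%MS by exact: j_field.2.
have Nc : (c p <= normal x p)%MS by exact: c_normal.2.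
pose beta Y := npart x p (deriv x c p Y).
have c12 : c p = (dot a1 a1)^-1 *: a1 + (dot a2 a2)^-1 *: a2.
  by rewrite {1}(principal_normal pE Nc) -/a1 -/a2 !c_metric// u1 u2 !mul1r.
have s21 : sff x p E2 E1 = 0 by rewrite (sffC hx T2 T1).
have b12 : dot (beta E1) a2 = 0 by rewrite (cubic_sym T1 T2 T2) s dot0r.
have b21 : dot (beta E2) a1 = 0 by rewrite (cubic_sym T2 T1 T1) s21 dot0r.
have jb E : (E <= tangent x p)%MS -> dot (j p) E = dot (c p) (beta E).
  by move=> TE; rewrite (j_grad TE) /beta dotC -(dot_npart _ Nc) dotC.
have Nb E : (beta E <= normal x p)%MS by exact: npart_normal.
have q1 : dot a1 a1 != 0 by rewrite dot_eq0.
have q2 : dot a2 a2 != 0 by rewrite dot_eq0.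
have b11 : dot (beta E1) a1 = dot (j p) E1 * dot a1 a1.
  by rewrite jb// c12 !dot_lin (dotC a2) b12 mulr0 addr0 (dotC a1 (beta _)) mulrAC mulVf ?mul1r.
have b22 : dot (beta E2) a2 = dot (j p) E2 * dot a2 a2.
  by rewrite jb// c12 !dot_lin (dotC a1) b21 mulr0 add0r (dotC a2 (beta _)) mulrAC mulVf ?mul1r.
have B1 : beta E1 = dot (j p) E1 *: a1.
  by rewrite {1}(principal_normal pE (Nb E1)) -/a1 -/a2 b12 b11
    mul0r scale0r addr0 mulfK.
have B2 : beta E2 = dot (j p) E2 *: a2.
  by rewrite {1}(principal_normal pE (Nb E2)) -/a1 -/a2 b21 b22
    mul0r scale0r add0r mulfK.
move=> TY; rewrite (principal_sff hx pE Tj TY) -/a1 -/a2.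
rewrite {1}(principal_tangent pE TY) D_addr !D_scaler npartD !npartZ.
by rewrite -/(beta E1) -/(beta E2) B1 B2 !scalerA !(mulrC (dot Y _)).
Qed.

(** The tangent field of M that governs the differential of [f] through alpha, and that turns out to
    be the dual section of f(M), pulled back to M. *)
Definition dual_section p := (1 - t) *: e p - t *: j p.

Lemma dual_section_field : vector_field x setT dual_section.
Proof.
have sc (s : R) : smooth_on setT (fun _ : M => s : R^o) by exact: smooth_on_cst.
split=> [|p _].
  exact: (smooth_onB oT (smooth_onZ oT (sc (1 - t)) e_field.1) (smooth_onZ oT (sc t) j_field.1)).
by rewrite addmx_sub ?eqmx_opp// scalemx_sub// ?e_field.2// j_field.2.
Qed.

Lemma deriv_f p Y : (Y <= tangent x p)%MS ->
  deriv x f p Y = - sff x p (dual_section p) Y.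
Proof.
move=> TY; have sc (s : R) : smooth_on setT (fun _ : M => s : R^o) by exact: smooth_on_cst.
have sx := smooth_immersion hx.
have stc := smooth_onZ oT (sc t) c_normal.1.
have ste := smooth_onZ oT (sc (1 - t)) e_field.1.
have -> : f = (fun p => (x p + t *: c p) - (1 - t) *: e p) by apply/funext.
rewrite (D_sub x oT I Y (smooth_onD oT sx stc) ste).
rewrite (D_add x oT I Y sx stc).
rewrite (D_scale x oT I Y (sc t) c_normal.1) (D_scale x oT I Y (sc (1 - t)) e_field.1).
rewrite !(D_cst x oT) !scale0r !addr0 (D_x hx TY) (deriv_c TY) (deriv_e TY) (sff_j TY).
rewrite /dual_section -[- (t *: _)]scaleNr (sffDl x) !(sffZl x) (sffC hx TY (e_field.2 p I)).
by apply/rowP => i; rewrite !mxE; ring.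
Qed.

Lemma deriv_f_normal p Y : (Y <= tangent x p)%MS -> (deriv x f p Y <= normal x p)%MS.
Proof. by move=> TY; rewrite deriv_f// eqmx_opp sff_normal. Qed.

(** * Normal sections k with the same normal derivative as e *)

Section PositionField.
Variables (W : set M) (k : M -> 'rV[R]_4).
Hypotheses (oW : open W) (k_normal : normal_section x W k).
Hypothesis k_eq : forall p X, W p -> (X <= tangent x p)%MS ->
  npart x p (deriv x (fun q => e q - k q) p X) = 0.

Lemma npart_deriv_k p X : W p -> (X <= tangent x p)%MS ->
  npart x p (deriv x k p X) = sff x p X (e p).
Proof.
move=> Wp TX; have se : smooth_on W e by exact: smooth_on_sub e_field.1.
have := k_eq Wp TX; rewrite (D_sub x oW Wp X se k_normal.1) npartD (deriv_e TX).
rewrite npartD (npart_tangent TX) add0r (npart_id (sff_normal _ _ _ _)).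
by rewrite -scaleN1r npartZ scaleN1r => /subr0_eq.
Qed.

(** The condition on a section u says that its normal derivative along X is alpha(X, e). Two
    sections satisfy it together exactly when their difference is parallel. *)
Lemma position_field_unique k' :
  (normal_section x W k' /\
    forall p X, W p -> (X <= tangent x p)%MS ->
      npart x p (deriv x (fun q => e q - k' q) p X) = 0) <->
  (normal_section x W (fun q => k' q - k q) /\
    forall p X, W p -> (X <= tangent x p)%MS ->
      npart x p (deriv x (fun q => k' q - k q) p X) = 0).
Proof.
have se : smooth_on W e by exact: smooth_on_sub e_field.1.
have [sk Nk] := k_normal.
have sub' u p X : smooth_on W u -> W p -> npart x p (deriv x (fun q => u q - k q) p X) =
    npart x p (deriv x u p X) - npart x p (deriv x k p X).
  move=> su Wp; rewrite (D_sub x oW Wp X su sk) npartD.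
  by rewrite -[- deriv _ _ _ _]scaleN1r npartZ scaleN1r.
have sube u p X : smooth_on W u -> W p -> (X <= tangent x p)%MS ->
    npart x p (deriv x (fun q => e q - u q) p X) = sff x p X (e p) - npart x p (deriv x u p X).
  move=> su Wp TX; rewrite (D_sub x oW Wp X se su) npartD (deriv_e TX) npartD.
  rewrite (npart_tangent TX) add0r (npart_id (sff_normal _ _ _ _)).
  by rewrite -[- deriv _ _ _ _]scaleN1r npartZ scaleN1r.
split=> [[[sk' Nk'] k'_eq]|[[sd Nd] d_eq]].
  split; first split; first exact: smooth_onB.
    by move=> p Wp; rewrite addmx_sub ?eqmx_opp ?Nk' ?Nk.
  move=> p X Wp TX; rewrite sub'// npart_deriv_k//.
  by have := k'_eq p X Wp TX; rewrite sube// => /subr0_eq ->; rewrite subrr.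
have E q : W q -> k' q - k q + k q = k' q by rewrite subrK.
have sk' : smooth_on W k' by apply: (smooth_on_eq oW E (smooth_onD oW sd sk)).
split; first split => // p Wp.
  by rewrite -E// addmx_sub ?Nd ?Nk.
move=> p X Wp TX; rewrite sube//.
by have := d_eq p X Wp TX; rewrite sub'// npart_deriv_k// => /subr0_eq ->; rewrite subrr.
Qed.

End PositionField.

(** * The geometry of f(M) expressed on M *)

Section DualImmersion.
Hypothesis hf : immersion f.

Lemma deriv_f_cfield a p v : dom a p -> deriv x f p (cfield x a v p) = cfield f a v p.
Proof. by move=> da; rewrite (D_cfield hx v (smooth_immersion hf))// cfieldE. Qed.

(** A tangent vector of M is named by its image under dx or under df; either name gives the same
    derivative of a map on M. *)
Lemma deriv_change {U : normedModType R} (F : M -> U) W p Y : smooth_on W F -> W p ->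
  (Y <= tangent x p)%MS -> deriv f F p (deriv x f p Y) = deriv x F p Y.
Proof.
have da := dom_chart_at p; move=> sF Wp /(tangentP hx _ da)[v ->].
by rewrite deriv_f_cfield// (D_cfield hf v sF)// (D_cfield hx v sF).
Qed.

Lemma tangent_f_lift p u : (u <= tangent f p)%MS ->
  exists2 Y, (Y <= tangent x p)%MS & u = deriv x f p Y.
Proof.
have da := dom_chart_at p; move=> /(tangentP hf _ da)[v ->].
exists (cfield x (chart_at p) v p); first exact: tangent_cfield.
by rewrite deriv_f_cfield.
Qed.

Lemma deriv_f_tangent p Y : (Y <= tangent x p)%MS -> (deriv x f p Y <= tangent f p)%MS.
Proof.
have da := dom_chart_at p; move=> /(tangentP hx _ da)[v ->].
by rewrite deriv_f_cfield// tangent_cfield.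
Qed.

Lemma deriv_f_inj p Y : (Y <= tangent x p)%MS -> deriv x f p Y = 0 -> Y = 0.
Proof.
have da := dom_chart_at p; move=> /(tangentP hx _ da)[v ->].
rewrite deriv_f_cfield// => /(cfield_inj hf da) ->.
by rewrite cfieldE derive0.
Qed.

(** One inclusion is [deriv_f_normal]; equality follows since both planes have rank 2. *)
Lemma tangent_f_eq p : (tangent f p == normal x p)%MS.
Proof.
have sub : (tangent f p <= normal x p)%MS.
  apply/row_subP => i; have := row_sub i (tangent f p).
  by move=> /tangent_f_lift[Y TY ->]; exact: deriv_f_normal.
rewrite -(geq_leqif (mxrank_leqif_eq sub)).
have rk y : immersion y -> \rank (tangent y p) = 2.
  by move=> [_ /(_ p) /eqP]; rewrite /tangent genmxE.
have rN : \rank (normal x p) = 2.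
  by rewrite /normal mxrank_ker mxrank_tr (rk x hx).
exact: (eq_leq (etrans rN (esym (rk f hf)))).
Qed.

Lemma tangent_fE p (v : 'rV[R]_4) : (v <= tangent f p)%MS = (v <= normal x p)%MS.
Proof. by have /eqmxP E := tangent_f_eq p; rewrite E. Qed.

Lemma normal_fE p (v : 'rV[R]_4) : (v <= normal f p)%MS = (v <= tangent x p)%MS.
Proof.
apply/idP/idP => [/normalP Nv|Tv].
  apply: npart_eq0; apply/eqP; rewrite -dot_eq0.
  rewrite {1}npartE dotDl dotNl.
  have Nn := npart_normal x p v.
  rewrite (dot_tangent_normal (tpart_tangent x p v) Nn) subr0.
  by rewrite Nv// tangent_fE.
by apply/normalP => X; rewrite tangent_fE => NX; exact: dot_tangent_normal Tv NX.
Qed.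

Lemma normal_f_eq p : (normal f p == tangent x p)%MS.
Proof.
apply/andP; split; apply/row_subP => i.
  by rewrite -normal_fE row_sub.
by rewrite normal_fE row_sub.
Qed.

Lemma tpart_f p v : tpart f p v = npart x p v.
Proof.
apply: (tangent_eq (tpart_tangent _ _ _)); first by rewrite tangent_fE npart_normal.
move=> Z TZ; rewrite dot_tpart//; move: TZ; rewrite tangent_fE => NZ.
by rewrite dot_npart.
Qed.

Lemma npart_f p v : npart f p v = tpart x p v.
Proof. by rewrite npartE tpart_f npartE opprB addrC subrK. Qed.

Lemma sff_f p X Y v : (X <= tangent x p)%MS -> (v <= normal x p)%MS ->
  (Y <= tangent x p)%MS ->
  dot X (sff f p (deriv x f p Y) v) = - dot v (sff x p X Y).
Proof.
move=> TX Nv TY.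
have Vv := normal_section_npart hx v oT.
have -> : sff f p (deriv x f p Y) v = tpart x p (deriv x (fun q => npart x q v) p Y).
  rewrite sffE npart_f -(deriv_change Vv.1 I TY); congr (tpart _ _ (deriv _ _ _ _)).
  by apply/funext => q; rewrite tpart_f.
by rewrite dotC dot_tpart// (shape hx Y oT I Vv TX) (npart_id Nv) (sffC hx TY TX).
Qed.

(** Evaluating [deriv_f] on the principal frame gives df(Ei) = - gi ai with gi nonzero, so each
    normalized ai is df of a multiple of Ei. Then [sff_f] transports the diagonal form of alpha: the
    diagonal values become Ei / gi and the mixed value stays zero. *)
Lemma principal_f p : exists E1 E2, principal f p E1 E2.
Proof.
have [E1 [E2 pE]] := principal_frame p.
have [T1 T2 u1 u2 o s an n1 n2] := pE.
set a1 := sff x p E1 E1 in an n1; set a2 := sff x p E2 E2 in an n2.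
have N1 : (a1 <= normal x p)%MS by exact: sff_normal.
have N2 : (a2 <= normal x p)%MS by exact: sff_normal.
have Td : (dual_section p <= tangent x p)%MS by exact: dual_section_field.2.
have nz (E : 'rV[R]_4) : dot E E = 1 -> E != 0.
  by move=> EE; rewrite -dot_eq0 EE oner_eq0.
pose g1 := dot (dual_section p) E1; pose g2 := dot (dual_section p) E2.
have D1 : deriv x f p E1 = - g1 *: a1.
  rewrite (deriv_f T1) (principal_sff hx pE Td T1) u1 o -/a1 -/a2 -/g1.
  by rewrite mulr1 mulr0 scale0r addr0 scaleNr.
have D2 : deriv x f p E2 = - g2 *: a2.
  rewrite (deriv_f T2) (principal_sff hx pE Td T2) u2 (dotC E2) o -/a1 -/a2 -/g2.
  by rewrite mulr1 mulr0 scale0r add0r scaleNr.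
have g10 : g1 != 0.
  apply/eqP => g10; have := nz _ u1; rewrite (deriv_f_inj T1) ?eqxx//.
  by rewrite D1 g10 oppr0 scale0r.
have g20 : g2 != 0.
  apply/eqP => g20; have := nz _ u2; rewrite (deriv_f_inj T2) ?eqxx//.
  by rewrite D2 g20 oppr0 scale0r.
pose r1 := (Num.sqrt (dot a1 a1))^-1; pose r2 := (Num.sqrt (dot a2 a2))^-1.
have q1 : r1 * (r1 * dot a1 a1) = 1.
  by rewrite mulrA -invfM -expr2 sqr_sqrtr ?dot_ge0// mulVf// dot_eq0.
have q2 : r2 * (r2 * dot a2 a2) = 1.
  by rewrite mulrA -invfM -expr2 sqr_sqrtr ?dot_ge0// mulVf// dot_eq0.
have lift (g : R) (a E : 'rV[R]_4) (r : R) : g != 0 -> deriv x f p E = - g *: a ->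
    r *: a = deriv x f p ((- r / g) *: E).
  by move=> g0 DE; rewrite D_scaler DE scalerA; congr (_ *: _); field.
have S1 X : (X <= tangent x p)%MS -> sff x p X ((- r1 / g1) *: E1) = (- r1 / g1 * dot X E1) *: a1.
  move=> TX; rewrite (sffZr hx) (principal_sff hx pE TX T1) u1 o -/a1 -/a2.
  by rewrite mulr0 scale0r addr0 mulr1 scalerA.
have S2 X : (X <= tangent x p)%MS -> sff x p X ((- r2 / g2) *: E2) = (- r2 / g2 * dot X E2) *: a2.
  move=> TX; rewrite (sffZr hx) (principal_sff hx pE TX T2) u2 (dotC E2) o -/a1 -/a2.
  by rewrite mulr0 scale0r add0r mulr1 scalerA.
have Tb1 : (r1 *: a1 <= normal x p)%MS by exact: scalemx_sub.
have Tb2 : (r2 *: a2 <= normal x p)%MS by exact: scalemx_sub.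
have TY1 : ((- r1 / g1) *: E1 <= tangent x p)%MS by exact: scalemx_sub.
have TY2 : ((- r2 / g2) *: E2 <= tangent x p)%MS by exact: scalemx_sub.
have Tsff X Y : (sff f p X Y <= tangent x p)%MS by rewrite -normal_fE sff_normal.
have F11 : sff f p (r1 *: a1) (r1 *: a1) = g1^-1 *: E1.
  apply: (tangent_eq (Tsff _ _)); first exact: scalemx_sub.
  move=> X TX; rewrite dotC {1}(lift _ _ _ _ g10 D1) sff_f// S1// !dot_lin (dotC E1).
  rewrite -[dot X E1]mul1r -{2}q1; field; exact: g10.
have F22 : sff f p (r2 *: a2) (r2 *: a2) = g2^-1 *: E2.
  apply: (tangent_eq (Tsff _ _)); first exact: scalemx_sub.
  move=> X TX; rewrite dotC {1}(lift _ _ _ _ g20 D2) sff_f// S2// !dot_lin (dotC E2).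
  rewrite -[dot X E2]mul1r -{2}q2; field; exact: g20.
have F12 : sff f p (r1 *: a1) (r2 *: a2) = 0.
  apply: (tangent_eq (Tsff _ _)); first exact: sub0mx.
  move=> X TX; rewrite dotC {1}(lift _ _ _ _ g10 D1) sff_f// S1// !dot_lin (dotC a2) an.
  by rewrite !mulr0 oppr0.
exists (r1 *: a1), (r2 *: a2); split.
- by rewrite tangent_fE.
- by rewrite tangent_fE.
- by rewrite dotZl dotZr.
- by rewrite dotZl dotZr.
- by rewrite dotZl dotZr an !mulr0.
- exact: F12.
- by rewrite F11 F22 dotZl dotZr o !mulr0.
- by rewrite F11 scaler_eq0 invr_eq0 negb_or g10 nz.
- by rewrite F22 scaler_eq0 invr_eq0 negb_or g20 nz.
Qed.

Lemma flat_f : flat f.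
Proof.
apply/(flatP hf) => p; have [E1 [E2 pE]] := principal_f p.
exact: (principal_gauss_flat hf pE).
Qed.

Lemma semiumbilical_f : semiumbilical f.
Proof.
move=> p; have [E1 [E2 pE]] := principal_f p; split.
  exact: (principal_semiumbilic hf pE).
exact: (principal_not_inflection pE).
Qed.

(** For normal n, s . alpha~(df Y, n) is - n . alpha(s, Y), while df(Y) . n is - n . alpha(d, Y)
    with d the [dual_section]. So the condition is alpha(s - d, Y) = 0 for all Y, and pairing with
    [c] turns this into s = d. *)
Lemma metric_section_f V s : open V ->
  metric_section f V s <-> (forall p, V p -> s p = dual_section p).
Proof.
move=> oV; have [sd Td] := dual_section_field.
split=> [[[ss Ns] sE] p Vp|sE].
  have Ts : (s p <= tangent x p)%MS by rewrite -normal_fE Ns.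
  have Tdp : (dual_section p <= tangent x p)%MS by exact: Td.
  have Tm : (- dual_section p <= tangent x p)%MS by rewrite eqmx_opp.
  have Tsd : (s p - dual_section p <= tangent x p)%MS by rewrite addmx_sub.
  apply/subr0_eq/(tangent_eq Tsd (sub0mx _ _)) => Y TY.
  rewrite -(c_metric Tsd TY).
  suff -> : sff x p (s p - dual_section p) Y = 0 by rewrite dot0r dot0l.
  apply: (normal_eq (sff_normal _ _ _ _) (sub0mx _ _)) => n Nn.
  have := sE p (deriv x f p Y) n Vp (deriv_f_tangent TY).
  rewrite tangent_fE -sff_alpha => /(_ Nn); rewrite (sff_f Ts Nn TY) (deriv_f TY).
  rewrite (sffDl x) -[- dual_section p]scaleN1r (sffZl x) scaleN1r dotDl !dotNl dot0l (dotC n).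
  by move=> /eqP; rewrite eqr_opp => /eqP ->; rewrite subrr.
split; first split.
- by apply: (smooth_on_eq oV _ (smooth_on_sub (@subsetT _ V) sd)) => q Vq; rewrite sE.
- by move=> p Vp; rewrite sE// normal_fE Td.
move=> p u v Vp Tu; rewrite tangent_fE => Nv; rewrite -sff_alpha sE//.
have [Y TY ->] := tangent_f_lift Tu.
have Tdp : (dual_section p <= tangent x p)%MS by exact: Td.
by rewrite (sff_f Tdp Nv TY) (deriv_f TY) dotNl (dotC v).
Qed.

(** The tangential part for f is the normal part for x. For tc - (1-t)k, the normal derivative along
    Y is t alpha(j, Y) - (1-t) alpha(Y, e), which is exactly df(Y). *)
Lemma position_field_f W k V s : open W -> open V -> V `<=` W -> normal_section x W k ->
  (forall p X, W p -> (X <= tangent x p)%MS ->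
    npart x p (deriv x (fun q => e q - k q) p X) = 0) ->
  (forall p, V p -> s p = t *: c p - (1 - t) *: k p) ->
  vector_field f V s /\
  forall p u, V p -> (u <= tangent f p)%MS -> tpart f p (deriv f s p u) = u.
Proof.
move=> oW oV VW Nk k_eq sE.
have sc (r : R) : smooth_on V (fun _ : M => r : R^o) by exact: smooth_on_cst.
have skV : smooth_on V k by exact: smooth_on_sub Nk.1.
have scV : smooth_on V c by exact: smooth_on_sub c_normal.1.
have stc := smooth_onZ oV (sc t) scV; have stk := smooth_onZ oV (sc (1 - t)) skV.
have E q : V q -> t *: c q - (1 - t) *: k q = s q by move=> /sE.
have ss : smooth_on V s by exact: (smooth_on_eq oV E (smooth_onB oV stc stk)).
split.
  split=> // p Vp; rewrite sE// tangent_fE addmx_sub ?eqmx_opp// scalemx_sub//.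
    exact: c_normal.2.
  exact/Nk.2/VW.
move=> p u Vp /tangent_f_lift[Y TY ->].
rewrite tpart_f (deriv_change ss Vp TY).
rewrite -(D_eq x oV Vp Y (smooth_onB oV stc stk) E) (D_sub x oV Vp Y stc stk).
rewrite (D_scale x oV Vp Y (sc t) scV) (D_scale x oV Vp Y (sc (1 - t)) skV).
rewrite !(D_cst x oV) !scale0r !addr0 -scaleNr npartD !npartZ (sff_j TY).
rewrite (npart_deriv_k oW Nk k_eq (VW p Vp) TY) (deriv_f TY) /dual_section.
rewrite -[- (t *: _)]scaleNr (sffDl x) !(sffZl x) (sffC hx TY (e_field.2 p I)).
by apply/rowP => i; rewrite !mxE; ring.
Qed.

End DualImmersion.

End DualSurface.

(** * Parallel normal frames *)

Section LocalPrimitives.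
Context {R : realType} {M : surface R}.
Implicit Types (p q : M) (a : atlas M) (W : set M).

(** Brings an open set of the plane, where a potential or a positivity region has been found, back
    to an open set of M. *)
Lemma chart_nbhd a W p (B : set 'rV[R]_2) : open B -> B (coord a p) -> dom a p ->
  B `<=` coord a @` (dom a `&` W) ->
  let W' := dom a `&` coord a @^-1` B in
  [/\ open W', W' p, W' `<=` W & coord a @` W' = B].
Proof.
move=> oB Bp dp BW; have od : open (dom a) by exact: dom_open.
have cc : {in dom a, continuous (coord a)}.
  by move: (@Defs.coord_continuous R M a); rewrite (continuous_open_subspace _ od).
split.
- rewrite openE => q [dq Bq]; apply: filterI; first exact: open_nbhs_nbhs.
  apply: (cc q (mem_set dq)); exact: open_nbhs_nbhs.
- by split.
- move=> q [dq /= Bq]; have [r [dr Wr] rq] := BW _ Bq.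
  by rewrite -(coordK dq) -rq coordK.
apply/seteqP; split=> [_ [q [_ Bq] <-]//|u Bu].
have [r [dr Wr] ru] := BW u Bu; exists r => //.
by split=> //; rewrite /= ru.
Qed.

Lemma positive_nbhd W (s : M -> R^o) p : open W -> W p -> smooth_on W s ->
  0 < (s p : R) -> exists W', [/\ open W', W' p, W' `<=` W & forall q, W' q -> 0 < (s q : R)].
Proof.
move=> oW Wp ss s0; have da := dom_chart_at p; set a := chart_at p in da.
have oA : open (coord a @` (dom a `&` W)) by exact: chart_image_open.
have Ap : (coord a @` (dom a `&` W)) (coord a p) by exists p.
have cs := smooth_continuous (ss a) Ap.
have N0 : nbhs (coord a p) (coord a @` (dom a `&` W)) by exact: open_nbhs_nbhs.
have N1 : nbhs (coord a p) (fun u => 0 < ((s \o par a) u : R)).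
  have /cvgrPdist_lt /(_ _ s0) := cs; rewrite /= coordK//.
  apply: filterS => u; rewrite ltr_distlC => /andP[+ _].
  by rewrite subrr.
have : nbhs (coord a p) ((coord a @` (dom a `&` W)) `&` (fun u => 0 < ((s \o par a) u : R))).
  exact: filterI.
rewrite nbhsE => -[B [oB Bp] sB].
have [oW' W'p W'W _] := chart_nbhd oB Bp da (fun u Bu => (sB u Bu).1).
exists (dom a `&` coord a @^-1` B); split=> // q [dq Bq].
by have [_] := sB _ Bq; rewrite /= coordK.
Qed.

Variables (x : M -> 'rV[R]_4) (hx : immersion x).

Lemma deriv_comp_fun (g : R -> R) (h k : M -> R^o) W p X (dg : R) : W p ->
  smooth_on W h -> smooth_on W k -> (forall q, k q = g (h q)) ->
  is_derive (h p) (1 : R) g dg ->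
  deriv x k p X = dg * deriv x h p X :> R.
Proof.
move=> Wp sh sk kE dgp; have da := dom_chart_at p.
have dh := differentiable_chart Wp da sh.
have dgp' : is_derive ((h \o par (chart_at p)) (coord (chart_at p) p)) (1 : R) g dg.
  by rewrite /= coordK.
have kp : k \o par (chart_at p) = (fun u => g ((h \o par (chart_at p)) u) : R^o).
  by apply/funext => u; rewrite /= kE.
rewrite (deriv_chart x X Wp sk) (deriv_chart x X Wp sh) kp.
exact: (derive_comp_fun (X *m pinvmx (jac x p)) dgp' dh).2.
Qed.

(** Because coordinate fields commute, closedness of the form with values [w0] and [w1] on them
    involves no bracket and is the hypothesis of [poincare] in the chart. *)
Lemma primitive_on a W p (w0 w1 : M -> R^o) : open W -> W p -> W `<=` dom a ->
  smooth_on W w0 -> smooth_on W w1 ->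
  (forall q, W q -> deriv x w0 q (cfield x a (dir true) q) =
                    deriv x w1 q (cfield x a (dir false) q)) ->
  exists W' (F : M -> R^o), [/\ open W', W' p, W' `<=` W, smooth_on W' F &
    forall q, W' q -> deriv x F q (cfield x a (dir false) q) = w0 q /\
                      deriv x F q (cfield x a (dir true) q) = w1 q].
Proof.
move=> oW Wp Wa s0 s1 closed.
have oA : open (coord a @` (dom a `&` W)) by exact: chart_image_open.
have Ap : (coord a @` (dom a `&` W)) (coord a p) by exists p => //; split=> //; exact: Wa.
have cl u : (coord a @` (dom a `&` W)) u ->
    'D_('e_1) (w0 \o par a) u = 'D_('e_0) (w1 \o par a) u.
  move=> [q [dq Wq] <-]; have := closed q Wq.
  by rewrite (D_cfield hx _ s0 Wq dq) (D_cfield hx _ s1 Wq dq) !dirE.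
have [B [G [oB Bp BA sG dG]]] := poincare oA Ap (s0 a) (s1 a) cl.
have dp := Wa p Wp.
have [oW' W'p W'W W'B] := chart_nbhd oB Bp dp BA.
set W' := _ `&` _ in oW' W'p W'W W'B.
have W'd : W' `<=` dom a by move=> q [].
have sF : smooth_on W' (G \o coord a) by apply: smooth_on_comp_coord; rewrite ?W'B.
exists W', (G \o coord a); split=> // q W'q.
have dq := W'd q W'q; have Bq : B (coord a q) by rewrite -W'B; exists q.
have E v : deriv x (G \o coord a) q (cfield x a v q) = form (w0 \o par a) (w1 \o par a) v (coord
  a q).
  rewrite (D_cfield hx v sF W'q dq) -dG//.
  apply: (derive_near_eq v oB) => // u; rewrite -W'B => -[r [dr _] <-].
  by rewrite /= coordK.
by rewrite !E !dirE /form /= coordK// !mxE /=; split; ring.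
Qed.

End LocalPrimitives.

(** * Orthonormal frames of the normal bundle *)

Section NormalFrame.
Context {R : realType} {M : surface R}.
Implicit Types (p q : M) (a : atlas M) (W : set M).
Variables (x : M -> 'rV[R]_4) (hx : immersion x).
Hypothesis x_principal : forall p, exists E1 E2, principal x p E1 E2.

Lemma submx_linear (N : 'M[R]_4) (u v : 'rV[R]_4) (s : R) :
  (u <= N)%MS -> (v <= N)%MS -> (u - s *: v <= N)%MS.
Proof. by move=> uN vN; rewrite addmx_sub ?eqmx_opp// scalemx_sub. Qed.

Lemma normalize_section W w p : open W -> W p -> normal_section x W w -> w p != 0 ->
  exists W' (s : M -> R) (n : M -> 'rV[R]_4), [/\ open W', W' p, W' `<=` W,
    normal_section x W' n & forall q, W' q -> n q = s q *: w q /\ dot (n q) (n q) = 1].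
Proof.
move=> oW Wp [sw Nw]; rewrite -dot_gt0 => w0.
have [W' [oW' W'p W'W pos]] := positive_nbhd oW Wp (smooth_on_dot oW sw sw) w0.
have sw' : smooth_on W' w by exact: smooth_on_sub sw.
(* The inverse length as a power of the squared length; [W'] is chosen so that the base stays
   positive. *)
pose s q : R^o := dot (w q) (w q) `^ (- 2^-1).
have ss : smooth_on W' s.
  move=> b; apply: (@smooth_powR R _ (fun u => dot (w (par b u)) (w (par b u)))).
  - exact: chart_image_open.
  - by move=> _ [q [dq W'q] <-]; rewrite coordK//; exact: pos.
  - exact: (smooth_on_dot oW' sw' sw').
exists W', s, (fun q => s q *: w q); split=> //.
  split=> [|q W'q]; first exact: smooth_onZ.
  by rewrite scalemx_sub// Nw//; exact: W'W.
move=> q W'q; split=> //; rewrite dotZl dotZr mulrA /s -powRD; last first.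
  by apply/implyP => _; rewrite gt_eqF// pos.
have -> : - 2^-1 - 2^-1 = -1 :> R by field.
by rewrite powR_inv1 ?mulVf// ?gt_eqF ?ltW// pos.
Qed.

Definition normal_frame W (n1 n2 : M -> 'rV[R]_4) :=
  [/\ normal_section x W n1, normal_section x W n2 &
    forall q, W q -> [/\ dot (n1 q) (n1 q) = 1, dot (n2 q) (n2 q) = 1 &
                         dot (n1 q) (n2 q) = 0]].

Lemma normal_frame_sub W W' n1 n2 : W' `<=` W -> normal_frame W n1 n2 ->
  normal_frame W' n1 n2.
Proof.
move=> WW' [[s1 N1] [s2 N2] o]; split.
- by split=> [|q /WW'/N1//]; exact: smooth_on_sub s1.
- by split=> [|q /WW'/N2//]; exact: smooth_on_sub s2.
- by move=> q /WW'/o.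
Qed.

(** Gram-Schmidt on the normal projections of alpha(E1,E1) and alpha(E2,E2), frozen at [p]. These
    are orthogonal at [p], so the second vector is unchanged there and can be normalized nearby. *)
Lemma normal_frame_exists p : exists W n1 n2, [/\ open W, W p & normal_frame W n1 n2].
Proof.
have [E1 [E2 pE]] := x_principal p.
have [_ _ _ _ _ _ an v10 v20] := pE.
have Nv1 := sff_normal x p E1 E1; have Nv2 := sff_normal x p E2 E2.
move: (sff x p E1 E1) (sff x p E2 E2) an v10 v20 Nv1 Nv2 => v1 v2 an v10 v20 Nv1 Nv2.
have oT : open [set: M] by exact: openT.
have Nw1 := normal_section_npart hx v1 oT.
have w10 : npart x p v1 != 0 by rewrite npart_id.
have [W1 [s1 [n1 [oW1 W1p _ Nn1 u1]]]] := normalize_section oT I Nw1 w10.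
pose w2 q : 'rV[R]_4 := npart x q v2 - dot (npart x q v2) (n1 q) *: n1 q.
have Nw2 : normal_section x W1 w2.
  have [sv Nv] := normal_section_npart hx v2 oW1.
  have sd := smooth_on_dot oW1 sv Nn1.1.
  split=> [|q W1q]; first exact: (smooth_onB oW1 sv (smooth_onZ oW1 sd Nn1.1)).
  have Nn : (n1 q <= normal x q)%MS := Nn1.2 q W1q.
  have Nv' : (npart x q v2 <= normal x q)%MS := npart_normal x q v2.
  exact: submx_linear.
have w2p : w2 p = v2.
  rewrite /w2 (u1 p W1p).1 (npart_id Nv1) (npart_id Nv2) dotZr (dotC v2) an.
  by rewrite mulr0 scale0r subr0.
have w2n q : W1 q -> dot (n1 q) (w2 q) = 0.
  move=> /u1[_ u1q]; rewrite /w2 dotDr dotNr dotZr u1q mulr1 (dotC (n1 q)).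
  by rewrite subrr.
have w20 : w2 p != 0 by rewrite w2p.
have [W2 [s2 [n2 [oW2 W2p W21 Nn2 u2]]]] := normalize_section oW1 W1p Nw2 w20.
exists W2, n1, n2; split; [exact: oW2|exact: W2p|split].
- by split=> [|q /W21 W1q]; [exact: (smooth_on_sub W21 Nn1.1)|exact: (Nn1.2 q W1q)].
- exact: Nn2.
- move=> q W2q; have W1q := W21 q W2q; split; first exact: (u1 q W1q).2.
    exact: (u2 q W2q).2.
  by rewrite (u2 q W2q).1 dotZr w2n// mulr0.
Qed.

Section Frame.
Variables (W : set M) (n1 n2 : M -> 'rV[R]_4).
Hypotheses (oW : open W) (nF : normal_frame W n1 n2).

(** Together with E1 and E2 the frame is an orthogonal basis of R^4. *)
Lemma normal_frame_zero q v : W q -> (v <= normal x q)%MS ->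
  dot v (n1 q) = 0 -> dot v (n2 q) = 0 -> v = 0.
Proof.
move=> Wq Nv v1 v2; have [[s1 N1] [s2 N2] orth] := nF; have [h1 h2 h12] := orth q Wq.
have [E1 [E2 pE]] := x_principal q.
have [T1 T2 u1 u2 u12 _ _ _ _] := pE.
have nz (n : 'rV[R]_4) : dot n n = 1 -> n != 0 by move=> nn; rewrite -dot_eq0 nn oner_eq0.
rewrite (orthogonal_expansion u1 u2 u12 (dot_tangent_normal T1 (N1 q Wq))
  (dot_tangent_normal T1 (N2 q Wq)) (dot_tangent_normal T2 (N1 q Wq))
  (dot_tangent_normal T2 (N2 q Wq)) h12 (nz _ h1) (nz _ h2) v).
rewrite v1 v2 (dotC v) (dot_tangent_normal T1 Nv) (dotC v) (dot_tangent_normal T2 Nv).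
by rewrite !mul0r !scale0r !addr0.
Qed.

Lemma deriv_unit (n : M -> 'rV[R]_4) q X : W q -> smooth_on W n ->
  (forall r, W r -> dot (n r) (n r) = 1) -> dot (deriv x n q X) (n q) = 0.
Proof.
move=> Wq sn u; have := D_dot x oW Wq X sn sn.
rewrite (D_eq x oW Wq X (smooth_on_dot oW sn sn) u) (D_cst x oW) (dotC (n q)).
move/eqP; rewrite eq_sym -mulr2n mulrn_eq0 /= => /eqP.
exact.
Qed.

Lemma deriv_frame_anti q X : W q ->
  dot (deriv x n2 q X) (n1 q) = - dot (deriv x n1 q X) (n2 q).
Proof.
move=> Wq; have [[s1 _] [s2 _] o] := nF.
have o12 r : W r -> dot (n1 r) (n2 r) = 0 by move=> /o[].
have := D_dot x oW Wq X s1 s2.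
rewrite (D_eq x oW Wq X (smooth_on_dot oW s1 s2) o12) (D_cst x oW) (dotC (n1 q)).
by move/eqP; rewrite eq_sym addr_eq0 => /eqP.
Qed.

(* The principal directions diagonalize all the shape operators at once. *)
Lemma ricci q X Y : W q -> (X <= tangent x q)%MS -> (Y <= tangent x q)%MS ->
  dot (deriv x n1 q X) (deriv x n2 q Y) = dot (deriv x n1 q Y) (deriv x n2 q X).
Proof.
move=> Wq TX TY; have [N1 N2 orth] := nF; have [h1 h2 h12] := orth q Wq.
have [E1 [E2 pE]] := x_principal q.
have [T1 T2 u1 u2 u12 s12 _ _ _] := pE.
have U1 : forall r, W r -> dot (n1 r) (n1 r) = 1 by move=> r /orth[].
have U2 : forall r, W r -> dot (n2 r) (n2 r) = 1 by move=> r /orth[].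
have nz (n : 'rV[R]_4) : dot n n = 1 -> n != 0 by move=> nn; rewrite -dot_eq0 nn oner_eq0.
have expand := orthogonal_expansion u1 u2 u12 (dot_tangent_normal T1 (N1.2 q Wq))
  (dot_tangent_normal T1 (N2.2 q Wq)) (dot_tangent_normal T2 (N1.2 q Wq))
  (dot_tangent_normal T2 (N2.2 q Wq)) h12 (nz _ h1) (nz _ h2).
have key Z Z' : (Z <= tangent x q)%MS -> (Z' <= tangent x q)%MS ->
    dot (deriv x n1 q Z) (deriv x n2 q Z') =
    dot Z E1 * dot Z' E1 * (dot (n1 q) (sff x q E1 E1) * dot (n2 q) (sff x q E1 E1)) +
    dot Z E2 * dot Z' E2 * (dot (n1 q) (sff x q E2 E2) * dot (n2 q) (sff x q E2 E2)).
  move=> TZ TZ'.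
  have sh (n : M -> 'rV[R]_4) V E : normal_section x W n -> (V <= tangent x q)%MS -> (E <=
    tangent x q)%MS ->
    dot (deriv x n q V) E = - dot (n q) (sff x q V E).
    by move=> Nn TV TE; exact: (shape hx V oW Wq Nn TE).
  have sE1 V : (V <= tangent x q)%MS -> sff x q V E1 = dot V E1 *: sff x q E1 E1.
    move=> TV; rewrite (principal_sff hx pE TV T1) u1 u12 mulr0 scale0r addr0 mulr1.
    by [].
  have sE2 V : (V <= tangent x q)%MS -> sff x q V E2 = dot V E2 *: sff x q E2 E2.
    move=> TV; rewrite (principal_sff hx pE TV T2) u2 (dotC E2) u12 mulr0 scale0r add0r mulr1.
    by [].
  rewrite (expand (deriv x n1 q Z)) (deriv_unit Z Wq N1.1 U1).
  rewrite !dotDl !dotZl !(dotC _ (deriv x n2 q Z')) (deriv_unit Z' Wq N2.1 U2).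
  rewrite mul0r mul0r add0r mulr0 addr0.
  rewrite (sh n1 Z E1 N1 TZ T1) (sh n1 Z E2 N1 TZ T2).
  rewrite (sh n2 Z' E1 N2 TZ' T1) (sh n2 Z' E2 N2 TZ' T2).
  rewrite (sE1 Z TZ) (sE2 Z TZ) (sE1 Z' TZ') (sE2 Z' TZ') !dotZr.
  move: (dot Z E1) (dot Z E2) (dot Z' E1) (dot Z' E2) => z1 z2 z1' z2'.
  move: (dot (n1 q) _) (dot (n2 q) _) (dot (n1 q) _) (dot (n2 q) _) => m1 m2 m3 m4.
  ring.
rewrite !key// (mulrC (dot X E1)) (mulrC (dot X E2)).
by [].
Qed.

End Frame.

End NormalFrame.

Section ParallelFrame.
Context {R : realType} {M : surface R}.
Implicit Types (p q : M) (a : atlas M) (W : set M).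
Variables (x : M -> 'rV[R]_4) (hx : immersion x).
Hypothesis x_principal : forall p, exists E1 E2, principal x p E1 E2.

(** The connection form X |-> D_X n1 . n2 is closed: the second derivatives of [n1] cancel by
    Schwarz's theorem and the remaining products by [ricci]. *)
Lemma connection_potential a W p (n1 n2 : M -> 'rV[R]_4) : open W -> W p -> W `<=` dom a ->
  normal_frame x W n1 n2 ->
  exists W' (th : M -> R^o), [/\ open W', W' p, W' `<=` W, smooth_on W' th &
    forall q X, W' q -> (X <= tangent x q)%MS ->
      deriv x th q X = dot (deriv x n1 q X) (n2 q)].
Proof.
move=> oW Wp Wa nF; have [[s1 N1] [s2 N2] _] := nF.
have aW : dom a `&` W = W by apply/setIidPr.
have sE b : smooth_on W (fun q => deriv x n1 q (cfield x a (dir b) q)).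
  by have := smooth_on_D_cfield hx a (dir b) oW s1; rewrite aW.
have sw b := smooth_on_dot oW (sE b) s2.
have [W' [th [oW' W'p W'W sth dth]]] : exists W' (F : M -> R^o),
    [/\ open W', W' p, W' `<=` W, smooth_on W' F &
    forall q, W' q -> deriv x F q (cfield x a (dir false) q) =
        dot (deriv x n1 q (cfield x a (dir false) q)) (n2 q) /\
      deriv x F q (cfield x a (dir true) q) =
        dot (deriv x n1 q (cfield x a (dir true) q)) (n2 q)].
  apply: (primitive_on hx oW Wp Wa (sw false) (sw true)) => q Wq.
  have dq := Wa q Wq.
  rewrite (D_dot x oW Wq _ (sE false) s2) (D_dot x oW Wq _ (sE true) s2).
  rewrite (D_cfieldC hx (dir false) (dir true) oW s1 Wq dq).
  by rewrite (ricci hx x_principal oW nF Wq (tangent_cfield hx _ dq) (tangent_cfield hx _ dq)).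
exists W', th; split=> // q X W'q TX.
have dq := Wa q (W'W q W'q); have [dth0 dth1] := dth q W'q.
have [s [r ->]] := frame_tangent hx dq TX.
by rewrite !D_addr !D_scaler dth0 dth1 dotDl !dotZl.
Qed.

Definition parallel_frame W (m1 m2 : M -> 'rV[R]_4) := normal_frame x W m1 m2 /\
  forall q X, W q -> (X <= tangent x q)%MS ->
    npart x q (deriv x m1 q X) = 0 /\ npart x q (deriv x m2 q X) = 0.

(** For an orthonormal pair, differentiating the constant inner products leaves a single independent
    component of the normal derivatives. *)
Lemma parallel_frameI W (m1 m2 : M -> 'rV[R]_4) : open W -> normal_frame x W m1 m2 ->
  (forall q X, W q -> (X <= tangent x q)%MS -> dot (deriv x m1 q X) (m2 q) = 0) ->
  parallel_frame W m1 m2.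
Proof.
move=> oW mF m12; split=> // q X Wq TX; have [[s1 N1] [s2 N2] orth] := mF.
have U1 r : W r -> dot (m1 r) (m1 r) = 1 by move=> /orth[].
have U2 r : W r -> dot (m2 r) (m2 r) = 1 by move=> /orth[].
have zero v : dot v (m1 q) = 0 -> dot v (m2 q) = 0 -> npart x q v = 0.
  move=> v1 v2; apply: (normal_frame_zero x_principal mF Wq (npart_normal _ _ _)).
    by rewrite dot_npart ?N1.
  by rewrite dot_npart ?N2.
split; apply: zero.
- exact: (deriv_unit x oW X Wq s1 U1).
- exact: m12.
- by rewrite (deriv_frame_anti oW mF X Wq) m12 ?oppr0.
- exact: (deriv_unit x oW X Wq s2 U2).
Qed.

Lemma parallel_frame_exists a p : dom a p ->
  exists W m1 m2, [/\ open W, W p, W `<=` dom a & parallel_frame W m1 m2].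
Proof.
move=> da; have [W0 [n1 [n2 [oW0 W0p F0]]]] := normal_frame_exists hx x_principal p.
have oW1 : open (dom a `&` W0) by apply: openI => //; exact: dom_open.
have F1 := normal_frame_sub (@subIsetr _ (dom a) W0) F0.
have [W [th [oW Wp WW1 sth dth]]] :=
  connection_potential oW1 (conj da W0p) (@subIsetl _ (dom a) W0) F1.
have F := normal_frame_sub WW1 F1; have [[s1 N1] [s2 N2] orth] := F.
have oA b : open (coord b @` (dom b `&` W)) by exact: chart_image_open.
pose sn : M -> R^o := fun q => sin (th q); pose cs : M -> R^o := fun q => cos (th q).
have ssn : smooth_on W sn by move=> b; have [] := smooth_sin_cos (oA b) (sth b).
have scs : smooth_on W cs by move=> b; have [] := smooth_sin_cos (oA b) (sth b).
have dsn q X : W q -> deriv x sn q X = cs q * deriv x th q X :> R.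
  by move=> Wq; exact: (@deriv_comp_fun R M x (@sin R) th sn W q X (cs q) Wq sth ssn (fun=>
    erefl) (is_derive_sin _)).
have dcs q X : W q -> deriv x cs q X = - sn q * deriv x th q X :> R.
  by move=> Wq; exact: (@deriv_comp_fun R M x (@cos R) th cs W q X (- sn q) Wq sth scs (fun=>
    erefl) (is_derive_cos _)).
have cs2 q : cs q * cs q + sn q * sn q = 1 :> R.
  by rewrite -!expr2 cos2Dsin2.
move: sn cs ssn scs dsn dcs cs2 => sn cs ssn scs dsn dcs cs2.
(* Rotation by the angle [th]: the connection form of the new frame is the old one minus the
   differential of [th], hence zero. *)
pose m1 q : 'rV[R]_4 := cs q *: n1 q - sn q *: n2 q.
pose m2 q : 'rV[R]_4 := sn q *: n1 q + cs q *: n2 q.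
have c1 := smooth_onZ oW scs s1; have sn2 := smooth_onZ oW ssn s2.
exists W, m1, m2; split=> //; first by move=> q /WW1[].
apply: parallel_frameI => //.
  split.
  - split=> [|q Wq]; first exact: (smooth_onB oW c1 sn2).
    by apply: submx_linear; rewrite ?N2// scalemx_sub// N1.
  - split=> [|q Wq].
      exact: (smooth_onD oW (smooth_onZ oW ssn s1) (smooth_onZ oW scs s2)).
    by rewrite addmx_sub// scalemx_sub ?N1 ?N2.
  - move=> q Wq; have [n11 n22 n12] := orth q Wq; have := cs2 q.
    rewrite /m1 /m2 !dot_lin (dotC (n2 q)) n11 n22 n12.
    move: (cs q : R) (sn q : R) => c s E.
    by split; [rewrite -[RHS]E; ring|rewrite -[RHS]E; ring|ring].
move=> q X Wq TX; have [n11 n22 n12] := orth q Wq.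
have U1 r : W r -> dot (n1 r) (n1 r) = 1 by move=> /orth[].
have U2 r : W r -> dot (n2 r) (n2 r) = 1 by move=> /orth[].
rewrite (D_sub x oW Wq X c1 sn2) (D_scale x oW Wq X scs s1) (D_scale x oW Wq X ssn s2).
have d1 := deriv_unit x oW X Wq s1 U1; have d2 := deriv_unit x oW X Wq s2 U2.
have d21 := deriv_frame_anti oW F X Wq.
have dX := dth q X Wq TX.
have dsX := dsn q X Wq; have dcX := dcs q X Wq.
rewrite dX in dsX dcX.
rewrite /m2 !dot_lin dsX dcX d1 d2 d21 n11 n22 (dotC (n2 q)) n12.
move: (dot _ _) (cs q : R) (sn q : R) => w c s; ring.
Qed.

(** * Local existence of the normal section k *)

Section PositionFieldExistence.
Variables (e : M -> 'rV[R]_4).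
Hypothesis e_field : vector_field x setT e.
Hypothesis e_deriv : forall p X, (X <= tangent x p)%MS ->
  deriv x e p X = X + sff x p X (e p).

(* As [m] is parallel its derivatives are tangent, so the 1-form [X |-> D_X e . m]
   is closed by the symmetry of the shape operator of [m]. *)
Lemma parallel_potential a W p (m : M -> 'rV[R]_4) : open W -> W p -> W `<=` dom a ->
  normal_section x W m ->
  (forall q X, W q -> (X <= tangent x q)%MS -> npart x q (deriv x m q X) = 0) ->
  exists W' (h : M -> R^o), [/\ open W', W' p, W' `<=` W, smooth_on W' h &
    forall q X, W' q -> (X <= tangent x q)%MS ->
      deriv x h q X = dot (deriv x e q X) (m q)].
Proof.
move=> oW Wp Wa Nm pm; have sm := Nm.1.
have se : smooth_on W e by exact: smooth_on_sub e_field.1.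
have aW : dom a `&` W = W by apply/setIidPr.
have sE b : smooth_on W (fun q => deriv x e q (cfield x a (dir b) q)).
  by have := smooth_on_D_cfield hx a (dir b) oW se; rewrite aW.
have sw b := smooth_on_dot oW (sE b) sm.
have sym q X Y : W q -> (X <= tangent x q)%MS -> (Y <= tangent x q)%MS ->
    dot (deriv x e q X) (deriv x m q Y) = - dot (m q) (sff x q Y X).
  move=> Wq TX TY; have Tm : (deriv x m q Y <= tangent x q)%MS.
    by rewrite -[deriv x m q Y](tpart_npart x q) pm// addr0 tpart_tangent.
  rewrite (e_deriv TX) dotDl (dotC (sff _ _ _ _)).
  rewrite (dot_tangent_normal Tm (sff_normal x q X (e q))) addr0 dotC.
  exact: (shape hx Y oW Wq Nm TX).
have [W' [h [oW' W'p W'W sh dh]]] : exists W' (F : M -> R^o),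
    [/\ open W', W' p, W' `<=` W, smooth_on W' F &
    forall q, W' q -> deriv x F q (cfield x a (dir false) q) =
        dot (deriv x e q (cfield x a (dir false) q)) (m q) /\
      deriv x F q (cfield x a (dir true) q) =
        dot (deriv x e q (cfield x a (dir true) q)) (m q)].
  apply: (primitive_on hx oW Wp Wa (sw false) (sw true)) => q Wq.
  have dq := Wa q Wq.
  have T0 := tangent_cfield hx (dir false) dq; have T1 := tangent_cfield hx (dir true) dq.
  rewrite (D_dot x oW Wq _ (sE false) sm) (D_dot x oW Wq _ (sE true) sm).
  rewrite (D_cfieldC hx (dir false) (dir true) oW se Wq dq).
  by rewrite (sym q _ _ Wq T0 T1) (sym q _ _ Wq T1 T0) (sffC hx T0 T1).
exists W', h; split=> // q X W'q TX.
have dq := Wa q (W'W q W'q); have [dh0 dh1] := dh q W'q.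
have [s [r ->]] := frame_tangent hx dq TX.
by rewrite !D_addr !D_scaler dh0 dh1 dotDl !dotZl.
Qed.

Lemma position_field_exists p : exists W k, [/\ open W, W p, normal_section x W k &
  forall q X, W q -> (X <= tangent x q)%MS ->
    npart x q (deriv x (fun q => e q - k q) q X) = 0].
Proof.
have [W [m1 [m2 [oW Wp Wa [mF pm]]]]] := parallel_frame_exists (dom_chart_at p).
have [Nm1 Nm2 _] := mF.
have pm1 q X : W q -> (X <= tangent x q)%MS -> npart x q (deriv x m1 q X) = 0.
  by move=> Wq TX; have [] := pm q X Wq TX.
have [W1 [h1 [oW1 W1p W1W sh1' dh1]]] := parallel_potential oW Wp Wa Nm1 pm1.
have F1 := normal_frame_sub W1W mF; have [_ Nm2' _] := F1.
have pm2 q X : W1 q -> (X <= tangent x q)%MS -> npart x q (deriv x m2 q X) = 0.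
  by move=> /W1W Wq TX; have [] := pm q X Wq TX.
have W1a : W1 `<=` dom (chart_at p) by move=> q /W1W /Wa.
have [W2 [h2 [oW2 W2p W21 sh2 dh2]]] := parallel_potential oW1 W1p W1a Nm2' pm2.
have F2 := normal_frame_sub W21 F1; have [[s1 N1] [s2 N2] orth] := F2.
have sh1 : smooth_on W2 h1 by exact: smooth_on_sub sh1'.
have t1 := smooth_onZ oW2 sh1 s1; have t2 := smooth_onZ oW2 sh2 s2.
have sk := smooth_onD oW2 t1 t2.
have se : smooth_on W2 e by exact: smooth_on_sub e_field.1.
exists W2, (fun q => h1 q *: m1 q + h2 q *: m2 q); split=> //.
  by split=> // q Wq; rewrite addmx_sub// scalemx_sub ?N1 ?N2.
move=> q X W2q TX; have W1q := W21 q W2q; have Wq := W1W q W1q.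
have [n11 n22 n12] := orth q W2q.
have orth0 m n v : npart x q (deriv x m q X) = 0 -> (n <= normal x q)%MS ->
    v = deriv x m q X -> dot v n = 0.
  by move=> m0 Nn ->; rewrite -(dot_npart _ Nn) m0 dot0l.
have d11 := orth0 m1 _ _ (pm1 q X Wq TX) (N1 q W2q) erefl.
have d12 := orth0 m1 _ _ (pm1 q X Wq TX) (N2 q W2q) erefl.
have d21 := orth0 m2 _ _ (pm2 q X W1q TX) (N1 q W2q) erefl.
have d22 := orth0 m2 _ _ (pm2 q X W1q TX) (N2 q W2q) erefl.
have e1 := dh1 q X W1q TX; have e2 := dh2 q X W2q TX.
(* Since the frame is parallel, the normal components of the derivative of k are the differentials
   of [h1] and [h2], which were chosen to match those of the derivative of e. *)
apply: (normal_frame_zero x_principal F2 W2q (npart_normal _ _ _)).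
  rewrite (dot_npart _ (N1 q W2q)) (D_sub x oW2 W2q X se sk) (D_add x oW2 W2q X t1 t2).
  rewrite (D_scale x oW2 W2q X sh1 s1) (D_scale x oW2 W2q X sh2 s2) !dot_lin.
  rewrite d11 d21 (dotC (m2 q)) n11 n12 e1.
  move: (dot _ _) (h1 q : R) (h2 q : R) (deriv x h2 q X : R) => w a b c; ring.
rewrite (dot_npart _ (N2 q W2q)) (D_sub x oW2 W2q X se sk) (D_add x oW2 W2q X t1 t2).
rewrite (D_scale x oW2 W2q X sh1 s1) (D_scale x oW2 W2q X sh2 s2) !dot_lin.
rewrite d12 d22 n22 n12 e2.
move: (dot _ _) (h1 q : R) (h2 q : R) (deriv x h1 q X : R) => w a b c; ring.
Qed.

End PositionFieldExistence.

End ParallelFrame.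

(** * Properties of f(M), from the data given on M *)

Theorem theorem5p5 (R : realType) (M : surface R) (x : M -> 'rV[R]_4)
    (hx : immersion x) (hflat : flat x) (hsemi : semiumbilical x)
    (c : M -> 'rV[R]_4) (hc : metric_section x setT c)
    (e : M -> 'rV[R]_4) (he : vector_field x setT e)
    (hnabla : forall X : M -> 'rV[R]_4, vector_field x setT X ->
       forall p, nablaT x e p (X p) = X p)
    (j : M -> 'rV[R]_4)
    (hj : forall p, j p = 2^-1 *: grad x (fun q => dot (c q) (c q)) p)
    (t : R) (f : M -> 'rV[R]_4)
    (hf : forall p, f p = x p + t *: c p - (1 - t) *: e p) :
  (forall p (X : 'rV[R]_4),
     (X <= tangent x p)%MS -> (D x f p X <= normal x p)%MS) /\
  (immersion f ->
   [/\ flat f /\ semiumbilical f,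
       (forall p, (normal f p == tangent x p)%MS /\
                  (tangent f p == normal x p)%MS),
       (* (1) *)
       (forall (V : set M) (phi : 'rV[R]_4 -> M), local_inverse f V phi ->
          forall p (X u v : 'rV[R]_4), V p ->
            (X <= tangent x p)%MS ->
            (u <= normal x p)%MS -> (v <= normal x p)%MS ->
            dot X (alpha f p u v) =
              - dot v (alpha x p X (dinverse x f phi p u))) /\
       (forall p (X v Y : 'rV[R]_4),
          (X <= tangent x p)%MS -> (v <= normal x p)%MS ->
          (Y <= tangent x p)%MS ->
          dot X (alpha f p (D x f p Y) v) = - dot v (alpha x p X Y)),
       (* (2) *)
       (forall (V : set M) (phi : 'rV[R]_4 -> M), local_inverse f V phi ->
          (forall ct : 'rV[R]_4 -> 'rV[R]_4,
             metric_section f V (ct \o f) <->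
             (forall y, (f @` V) y ->
                ct y = (1 - t) *: e (phi y)
                       - (t / 2) *: grad x (fun q => dot (c q) (c q)) (phi y)))
          /\
          (forall y, (f @` V) y ->
             (1 - t) *: e (phi y)
             - (t / 2) *: grad x (fun q => dot (c q) (c q)) (phi y) =
             (1 - t) *: e (phi y) - t *: j (phi y)))
     & (* (3) *)
       t != 1 ->
       let solves W k := normal_section x W k /\
         (forall p (X : 'rV[R]_4), W p -> (X <= tangent x p)%MS ->
            npart x p (D x (fun q => e q - k q) p X) = 0) in
       [/\ (forall p, exists W k, [/\ open W, W p & solves W k]),
           (forall W k k', open W -> solves W k ->
              (solves W k' <-> parallel x W (fun q => k' q - k q)))
         & (forall W k, open W -> solves W k ->
              forall V phi, local_inverse f V phi -> V `<=` W ->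
              let et y := t *: c (phi y) - (1 - t) *: k (phi y) in
              vector_field f V (et \o f) /\
              (forall p (u : 'rV[R]_4), V p -> (u <= tangent f p)%MS ->
                 nablaT f (et \o f) p u = u))]]).
Proof.
have oT : open [set: M] by exact: openT.
have x_flat := (flatP hx).1 hflat.
have x_semi p : semiumbilic x p by have [] := hsemi p.
have c_normal := hc.1.
have c_metric p X Y : (X <= tangent x p)%MS -> (Y <= tangent x p)%MS ->
    dot (c p) (sff x p X Y) = dot X Y.
  by move=> TX TY; rewrite sff_alpha; exact: hc.2.
(* The hypothesis on [e] concerns fields; it is applied to the field obtained by projecting the
   constant [X]. *)
have e_nabla p X : (X <= tangent x p)%MS -> tpart x p (deriv x e p X) = X.
  move=> TX; have := hnabla _ (vector_field_tpart hx X oT) p.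
  by rewrite nablaTE (tpart_id TX).
have scc : smooth_on setT (fun q => dot (c q) (c q) : R^o).
  exact: (smooth_on_dot oT c_normal.1 c_normal.1).
have sj : smooth_on setT j.
  have sg := smooth_onZ oT (smooth_on_cst setT (2^-1 : R^o)) (smooth_on_grad hx oT scc).
  by apply: (smooth_on_eq oT _ sg) => q _; rewrite hj.
have j_field : vector_field x setT j.
  by split=> // p _; rewrite hj scalemx_sub//; have [] := gradP hx (fun q => dot (c q) (c q)) p.
have j_grad p X : (X <= tangent x p)%MS -> dot (j p) X = dot (c p) (deriv x c p X).
  move=> TX; rewrite hj dotZl.
  have [_ /(_ X TX) ->] := gradP hx (fun q => dot (c q) (c q)) p.
  rewrite (D_dot x oT I X c_normal.1 c_normal.1) (dotC (deriv x c p X)).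
  by move: (dot _ _) => w; field.
have e_deriv := deriv_e hx he e_nabla.
have x_principal := principal_frame hx x_semi x_flat c_metric.
split.
  move=> p X TX; rewrite -derivE.
  exact: (deriv_f_normal hx x_semi x_flat c_normal c_metric he e_nabla j_field j_grad hf TX).
move=> f_imm.
split.
- split.
    exact: (flat_f hx x_semi x_flat c_normal c_metric he e_nabla j_field j_grad hf f_imm).
  exact: (semiumbilical_f hx x_semi x_flat c_normal c_metric he e_nabla j_field j_grad hf f_imm).
- move=> p; split.
    exact: (normal_f_eq hx x_semi x_flat c_normal c_metric he e_nabla j_field j_grad hf f_imm).
  exact: (tangent_f_eq hx x_semi x_flat c_normal c_metric he e_nabla j_field j_grad hf f_imm).
- have S := sff_f hx x_semi x_flat c_normal c_metric he e_nabla j_field j_grad hf f_imm.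
  split=> [V phi [oV phiK] p X u v Vp TX Nu Nv|p X v Y TX Nv TY].
    have [Y TY uE] : exists2 Y, (Y <= tangent x p)%MS & u = deriv x f p Y.
      apply: (tangent_f_lift hx f_imm).
      by rewrite (tangent_fE hx x_semi x_flat c_normal c_metric he e_nabla j_field j_grad hf f_imm).
    have sx : smooth_on V x by exact: smooth_on_sub (smooth_immersion hx).
    (* [phi \o f] is the identity on the open set [V], which is enough because derivatives at a
       point of [V] are local. *)
    have xE q : V q -> x q = (x \o phi \o f) q by move=> Vq; rewrite /= phiK.
    have -> : dinverse x f phi p u = Y.
      rewrite /dinverse -derivE -(D_eq f oV Vp u sx xE) uE.
      by rewrite (deriv_change hx f_imm sx Vp TY) (D_x hx TY).
    by rewrite -!sff_alpha uE; exact: S.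
  by rewrite -derivE -!sff_alpha; exact: S.
- move=> V phi [oV phiK].
  have tj y : (t / 2) *: grad x (fun q => dot (c q) (c q)) (phi y) = t *: j (phi y).
    by rewrite hj scalerA.
  split=> [ct|y _]; last by rewrite tj.
  have H := metric_section_f hx x_semi x_flat c_normal c_metric he e_nabla j_field j_grad
    hf f_imm (ct \o f) oV.
  split=> [/H E _ [p Vp <-]|E].
    by rewrite tj phiK//; exact: E.
  by apply/H => p Vp; rewrite /= E ?tj ?phiK//; exists p.
move=> t1 solves.
have solvesE W k : solves W k <-> normal_section x W k /\
    (forall p (X : 'rV[R]_4), W p -> (X <= tangent x p)%MS ->
      npart x p (deriv x (fun q => e q - k q) p X) = 0).
  by split=> -[Nk k_eq]; split=> // p X Wp TX; have := k_eq p X Wp TX; rewrite derivE.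
split.
- move=> p; have [W [k [oW Wp Nk k_eq]]] := position_field_exists hx x_principal he e_deriv p.
  by exists W, k; split=> //; apply/solvesE.
- move=> W k k' oW /solvesE[Nk k_eq].
  have U := position_field_unique hx he e_nabla oW Nk k_eq k'.
  split=> [/solvesE/U[Nd d_eq]|[Nd d_eq]].
    by split=> // p X Wp TX; rewrite nablaNE; exact: d_eq.
  apply/solvesE/U; split=> // p X Wp TX.
  by have := d_eq p X Wp TX; rewrite nablaNE.
- move=> W k oW /solvesE[Nk k_eq] V phi [oV phiK] VW et.
  have sE p : V p -> (et \o f) p = t *: c p - (1 - t) *: k p.
    by move=> Vp; rewrite /et /= phiK.
  have [F1 F2] := position_field_f hx x_semi x_flat c_normal c_metric he e_nabla j_field j_grad
    hf f_imm oW oV VW Nk k_eq sE.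
  by split=> // p u Vp Tu; rewrite nablaTE; exact: F2.
Qed.
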